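(* Let $D=D_{\varepsilon_1}\times D_{\varepsilon_2}^1$, where $$D_{\varepsilon_1}=\Big\{f: f(\lambda)=(1-\varepsilon_1)f_1(\lambda)+\varepsilon_1w(\lambda),\ \tfrac1{2\pi}\int_{-\infty}^\infty f(\lambda)d\lambda\le P_1\Big\},\qquad D_{\varepsilon_2}^1=\Big\{g:\tfrac1{2\pi}\int_{-\infty}^\infty|g(\lambda)-g_1(\lambda)|d\lambda\le\varepsilon_2\Big\}$$ are sets of spectral densities, $f_1,g_1$ are fixed spectral densities and $w$ is an unknown (arbitrary) spectral density. Let $f_0\in D_{\varepsilon_1}$, $g_0\in D_{\varepsilon_2}^1$ satisfy the minimality condition $\int_{-\infty}^\infty\frac{|\gamma(\lambda)|^2}{f_0(\lambda)+g_0(\lambda)}d\lambda<\infty$ for some nontrivial function of exponential type $\gamma(\lambda)=\int_0^\infty\alpha(t)e^{it\lambda}dt$, and let the functions $$h_f(f_0,g_0)=\frac{|A(e^{i\lambda})g_0(\lambda)+C^0(e^{i\lambda})|^2}{(f_0(\lambda)+g_0(\lambda))^2},\qquad h_g(f_0,g_0)=\frac{|A(e^{i\lambda})f_0(\lambda)-C^0(e^{i\lambda})|^2}{(f_0(\lambda)+g_0(\lambda))^2}$$ be bounded. Suppose that $$|A(e^{i\lambda})g_0(\lambda)+C^0(e^{i\lambda})|=(f_0(\lambda)+g_0(\lambda))(\varphi(\lambda)+\alpha_1^{-1}),$$ $$|A(e^{i\lambda})f_0(\lambda)-C^0(e^{i\lambda})|=(f_0(\lambda)+g_0(\lambda))\Psi(\lambda)\alpha_2,$$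 where $\alpha_1,\alpha_2$ are constants, $\varphi(\lambda)\le0$ and $\varphi(\lambda)=0$ if $f_0(\lambda)>(1-\varepsilon_1)f_1(\lambda)$, $|\Psi(\lambda)|\le1$ and $\Psi(\lambda)=\operatorname{sign}(g_0(\lambda)-g_1(\lambda))$ if $g_0(\lambda)\ne g_1(\lambda)$, and that $(f_0,g_0)$ determines a solution of the optimization problem $$\max_{(f,g)\in D}\Big(\langle\mathbf R\mathbf a,\mathbf B^{-1}\mathbf R\mathbf a\rangle+\langle\mathbf Q\mathbf a,\mathbf a\rangle\Big)=\langle\mathbf R^0\mathbf a,(\mathbf B^0)^{-1}\mathbf R^0\mathbf a\rangle+\langle\mathbf Q^0\mathbf a,\mathbf a\rangle .$$ Then $f_0,g_0$ are the least favorable in the class $D_{\varepsilon_1}\times D_{\varepsilon_2}^1$ for the optimal linear filtering of the functional $A\xi$, and the function $$h(f_0,g_0)=\frac{A(e^{i\lambda})f_0(\lambda)-C^0(e^{i\lambda})}{f_0(\lambda)+g_0(\lambda)}$$ is the minimax-robust spectral characteristic of the optimal estimate of $A\xi$.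
   Context: Index sets. Let $s\ge1$, $N_0=K_0=0$, let $N_1,\dots,N_s,K_1,\dots,K_s$ be nonnegative reals and $M_l=\sum_{k=0}^l(N_k+K_k)$. Put $\mathbb R^-=(-\infty,0)$, $S=\bigcup_{l=1}^s[-M_l-N_l,-M_l]$, $S^+=\bigcup_{l=1}^s[M_l,M_l+N_l]$, $R^s=[0,\infty)\setminus S^+$, $T=S\cup[0,\infty)$. Processes and functional. $\xi,\eta$ are zero-mean, mutually uncorrelated stationary processes on $\mathbb R$ with spectral densities $f,g$ (nonnegative integrable functions, $E\xi(t)\overline{\xi(u)}=\frac1{2\pi}\int e^{i(t-u)\lambda}f(\lambda)d\lambda$, similarly for $\eta,g$). The functional is $A\xi=\int_{R^s}a(t)\xi(-t)dt$, estimated from observations of $\xi(t)+\eta(t)$, $t\in\mathbb R^-\setminus S$, where $\int_{R^s}|a|dt<\infty$, $\int_{R^s}t|a(t)|^2dt<\infty$. $\mathbf a$ is the function on $T$ equal to $a$ on $R^s$ and $0$ on $S\cup S^+$, regarded as an element of $L_2(T)$. $A(e^{i\lambda})=\int_{R^s}a(t)e^{-it\lambda}dt$. Estimates. $L_2^s(f+g)$ is the closed linear span of $\{e^{it\lambda}:t\in\mathbb R^-\setminus S\}$ in $L_2(\mathbb R,(f+g)d\lambda)$. For a linear estimate with spectral characteristic $h\in L_2^s(f+g)$ the mean-square error is $\Delta(h;f,g)=\frac1{2\pi}\int|A(e^{i\lambda})-h(e^{i\lambda})|^2f(\lambda)d\lambda+\frac1{2\pi}\int|h(e^{i\lambda})|^2g(\lambda)d\lambda$.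 $h(f,g)$ denotes the spectral characteristic of the optimal estimate, i.e. the minimizer of $\Delta(\cdot;f,g)$ over $L_2^s(f+g)$, and $\Delta(f,g)=\Delta(h(f,g);f,g)$. Operators in $L_2(T)$ for a pair $(f,g)$, $t\in T$: $(\mathbf B\mathbf x)(t)=\frac1{2\pi}\int_{-\infty}^\infty\frac{e^{-it\lambda}}{f+g}\big(\int_T\mathbf x(u)e^{iu\lambda}du\big)d\lambda$ (on those $\mathbf x$ for which $\frac1{f+g}\int_T\mathbf x(u)e^{iu\lambda}du\in L_2(\mathbb R)$), $(\mathbf R\mathbf x)(t)=\frac1{2\pi}\int_{-\infty}^\infty\frac{fe^{-it\lambda}}{f+g}\big(\int_T\mathbf x(u)e^{-iu\lambda}du\big)d\lambda$, $(\mathbf Q\mathbf x)(t)=\frac1{2\pi}\int_{-\infty}^\infty\frac{fg\,e^{it\lambda}}{f+g}\big(\int_T\mathbf x(u)e^{-iu\lambda}du\big)d\lambda$, as Fourier integrals in the $L_2$ sense or absolutely convergent. $\mathbf B$ is assumed invertible (with $\mathbf B^{-1}$ on $L_2(T)$) for the densities considered. $\langle x,y\rangle=\int_Tx\overline y\,dt$. $\mathbf B^0,\mathbf R^0,\mathbf Q^0$ are these operators for $(f,g)=(f_0,g_0)$, and $C^0(e^{i\lambda})=\int_T((\mathbf B^0)^{-1}\mathbf R^0\mathbf a)(t)e^{it\lambda}dt$. Minimax notions. For $D=D_f\times D_g$: $(f_0,g_0)\in D$ is least favorable in $D$ for the optimal linear filtering of $A\xi$ if $\Delta(f_0,g_0)=\max_{(f,g)\in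 D}\Delta(f,g)$. With $H_D=\bigcap_{(f,g)\in D}L_2^s(f+g)$, a spectral characteristic $h^0$ is minimax-robust if $h^0\in H_D$ and $\min_{h\in H_D}\max_{(f,g)\in D}\Delta(h;f,g)=\max_{(f,g)\in D}\Delta(h^0;f,g)$. *)

(* Defs.v *)
From HB Require Import structures.
From mathcomp Require Import all_boot all_order all_algebra.
From mathcomp Require Import all_classical all_reals all_analysis.
From mathcomp.real_closed Require Import complex.

Set Implicit Arguments.
Unset Strict Implicit.
Unset Printing Implicit Defensive.

Import Order.TTheory GRing.Theory Num.Theory.
Import numFieldNormedType.Exports.

Local Open Scope classical_set_scope.
Local Open Scope ring_scope.
Local Open Scope complex_scope.

Section Definitions.
Context {R : realType}.

Local Notation mu := (@lebesgue_measure R).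
Local Notation C := R[i].
Local Notation cabs := (@ComplexField.Normc.normc R).

Definition measC (D : set R) (x : R -> C) : Prop :=
  measurable_fun D (fun t => complex.Re (x t)) /\
  measurable_fun D (fun t => complex.Im (x t)).

Definition integrableC (D : set R) (x : R -> C) : Prop :=
  mu.-integrable D (fun t => (complex.Re (x t))%:E) /\
  mu.-integrable D (fun t => (complex.Im (x t))%:E).

Definition integralC (D : set R) (x : R -> C) : C :=
  (\int[mu]_(t in D) complex.Re (x t)) +i* (\int[mu]_(t in D) complex.Im (x t)).

Definition L2C (D : set R) (x : R -> C) : Prop :=
  measC D x /\ (\int[mu]_(t in D) (cabs (x t) ^+ 2)%:E < +oo)%E.

Definition cexpi (theta : R) : C := cos theta +i* sin theta.

(* sg is 1 or -1. *)
Definition fourierL1 (sg : R) (D : set R) (x : R -> C) (l : R) : C :=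
  integralC D (fun u => x u * cexpi (sg * u * l)).

Definition is_fourierL2 (sg : R) (D : set R) (x X : R -> C) : Prop :=
  L2C setT X /\
  (fun n : nat =>
     \int[mu]_l (cabs (X l - fourierL1 sg (D `&` `[- n%:R, n%:R]%classic) x l) ^+ 2)%:E)%E
    @ \oo --> 0%E.

(* \int_D x(u) e^{i sg u l} du: absolutely convergent integral when x is in L_1(D), and a representative
   of the limit in the mean of order 2 otherwise; for x in L_1(D) and L_2(D)
   both are equal almost everywhere. *)
Definition fourier (sg : R) (D : set R) (x : R -> C) : R -> C :=
  if `[< integrableC D x >] then fourierL1 sg D x
  else xget (fun=> 0) [set X | is_fourierL2 sg D x X].

Definition Mpt (N K : nat -> R) (l : nat) : R := \sum_(0 <= k < l.+1) (N k + K k).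

Definition Sset (s : nat) (N K : nat -> R) : set R :=
  \bigcup_(l in [set l | (1 <= l <= s)%N]) `[- Mpt N K l - N l, - Mpt N K l]%classic.

Definition Splus (s : nat) (N K : nat -> R) : set R :=
  \bigcup_(l in [set l | (1 <= l <= s)%N]) `[Mpt N K l, Mpt N K l + N l]%classic.

Definition Rs (s : nat) (N K : nat -> R) : set R := `[0, +oo[%classic `\` Splus s N K.

Definition Tset (s : nat) (N K : nat -> R) : set R := Sset s N K `|` `[0, +oo[%classic.

Definition Obs (s : nat) (N K : nat -> R) : set R := `]-oo, 0[%classic `\` Sset s N K.

Definition spectral_density (f : R -> R) : Prop :=
  (forall l, 0 <= f l) /\ mu.-integrable setT (EFin \o f).

Definition normw2 (w : R -> R) (x : R -> C) : \bar R :=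
  (\int[mu]_l (cabs (x l) ^+ 2 * w l)%:E)%E.

Definition L2s (Ob : set R) (w : R -> R) (h : R -> C) : Prop :=
  [/\ measC setT h, (normw2 w h < +oo)%E &
      forall e : R, 0 < e ->
        exists (n : nat) (c : 'I_n -> C) (t : 'I_n -> R),
          (forall i, Ob (t i)) /\
          (normw2 w (fun l => h l - \sum_(i < n) c i * cexpi (t i * l))%R < e%:E)%E].

Definition Afun (E : set R) (a : R -> C) : R -> C := fourierL1 (-1) E a.

Definition pairsum (f g : R -> R) : R -> R := fun l => f l + g l.

Definition mse (A : R -> C) (h : R -> C) (f g : R -> R) : \bar R :=
  (((2 * pi)^-1)%:E * normw2 f (fun l => A l - h l)%R
   + ((2 * pi)^-1)%:E * normw2 g h)%E.

Definition is_optimal (Ob : set R) (A : R -> C) (f g : R -> R) (h : R -> C) : Prop :=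
  L2s Ob (pairsum f g) h /\
  forall h', L2s Ob (pairsum f g) h' -> (mse A h f g <= mse A h' f g)%E.

(* A minimizer is unique up to equality almost everywhere for f + g. *)
Definition opt_char (Ob : set R) (A : R -> C) (f g : R -> R) : R -> C :=
  xget (fun=> 0) [set h | is_optimal Ob A f g h].

Definition opt_mse (Ob : set R) (A : R -> C) (f g : R -> R) : \bar R :=
  mse A (opt_char Ob A f g) f g.

Definition least_favorable (Ob : set R) (A : R -> C)
    (D : set ((R -> R) * (R -> R))) (f0 g0 : R -> R) : Prop :=
  D (f0, g0) /\
  forall f g, D (f, g) -> (opt_mse Ob A f g <= opt_mse Ob A f0 g0)%E.

Definition HD (Ob : set R) (D : set ((R -> R) * (R -> R))) : set (R -> C) :=
  [set h | forall f g, D (f, g) -> L2s Ob (pairsum f g) h].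

Definition worst_mse (A : R -> C) (D : set ((R -> R) * (R -> R))) (h : R -> C) : \bar R :=
  ereal_sup [set mse A h p.1 p.2 | p in D].

(* The maximum over D is a supremum for a general h in H_D, which need not be
   attained; for the robust characteristic itself attainment is required. *)
Definition minimax_robust (Ob : set R) (A : R -> C)
    (D : set ((R -> R) * (R -> R))) (h0 : R -> C) : Prop :=
  [/\ HD Ob D h0,
      exists2 p, D p & mse A h0 p.1 p.2 = worst_mse A D h0 &
      forall h, HD Ob D h -> (worst_mse A D h0 <= worst_mse A D h)%E].

(* Elements of L_2(T) are functions on R of which only the values on T matter. *)

Definition eqT (T : set R) (x y : R -> C) : Prop :=
  {ae mu, forall t, T t -> x t = y t}.

Definition innerT (T : set R) (x y : R -> C) : C :=
  integralC T (fun t => x t * (y t)^*).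

Definition invsum (f g : R -> R) (x : R -> C) : R -> C :=
  fun l => x l / (f l + g l)%:C.

Definition opB (T : set R) (f g : R -> R) (x : R -> C) : R -> C :=
  fun t => ((2 * pi)^-1)%:C * fourier (-1) setT (invsum f g (fourier 1 T x)) t.

(* (f+g)^-1 \int_T x(u)e^{iul}du belongs to L_2(R). Since _ / 0 = 0 here, the
   zeros of f+g, where the quotient is infinite, are treated separately. *)
Definition domB (T : set R) (f g : R -> R) (x : R -> C) : Prop :=
  [/\ L2C T x,
      {ae mu, forall l, f l + g l = 0 -> fourier 1 T x l = 0} &
      L2C setT (invsum f g (fourier 1 T x))].

Definition opR (T : set R) (f g : R -> R) (x : R -> C) : R -> C :=
  fun t => ((2 * pi)^-1)%:C *
    fourier (-1) setT (invsum f g (fun l => (f l)%:C * fourier (-1) T x l)) t.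

Definition opQ (T : set R) (f g : R -> R) (x : R -> C) : R -> C :=
  fun t => ((2 * pi)^-1)%:C *
    fourier 1 setT (invsum f g (fun l => (f l * g l)%:C * fourier (-1) T x l)) t.

Definition is_Binv (T : set R) (f g : R -> R) (r c : R -> C) : Prop :=
  domB T f g c /\ eqT T (opB T f g c) r.

(* B is one-to-one on its domain, so that the operator B^-1 in L_2(T), with
   domain the range of B, exists, and r belongs to the domain of B^-1. *)
Definition B_invertible_at (T : set R) (f g : R -> R) (r : R -> C) : Prop :=
  (forall x y, domB T f g x -> domB T f g y ->
     eqT T (opB T f g x) (opB T f g y) -> eqT T x y) /\
  exists c, is_Binv T f g r c.

Definition opBinv (T : set R) (f g : R -> R) (r : R -> C) : R -> C :=
  xget (fun=> 0) [set c | is_Binv T f g r c].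

(* Values are compared in the order of R[i], in which x <= y means that y - x is
   a nonnegative real; this quantity is real. *)
Definition opt_value (T : set R) (a : R -> C) (f g : R -> R) : C :=
  innerT T (opR T f g a) (opBinv T f g (opR T f g a)) + innerT T (opQ T f g a) a.

Definition Cfun (T : set R) (a : R -> C) (f g : R -> R) : R -> C :=
  fourier 1 T (opBinv T f g (opR T f g a)).

Definition extend0 (E : set R) (a : R -> C) : R -> C :=
  fun t => if `[< E t >] then a t else 0.

Definition exp_type (gam : R -> C) : Prop :=
  exists (G : C -> C) (c : nat -> C) (K tau : R),
    [/\ forall z : C,
          (fun n : nat => cabs (G z - \sum_(k < n) c k * z ^+ k)) @ \oo --> (0 : R),
        forall z : C, cabs (G z) <= K * expR (tau * cabs z) &
        forall l : R, gam l = G l%:C].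

(* In \bar R, 0^-1 = +oo, so the integral sees the zeros of f + g. *)
Definition minimality (f g : R -> R) : Prop :=
  exists (alpha gam : R -> C),
    [/\ integrableC `[0, +oo[%classic alpha,
        gam = fourierL1 1 `[0, +oo[%classic alpha,
        exp_type gam,
        exists l, gam l != 0 &
        (\int[mu]_l ((cabs (gam l) ^+ 2)%:E * ((f l + g l)%:E)^-1) < +oo)%E].

Definition D_eps (eps P : R) (f1 : R -> R) : set (R -> R) :=
  [set f | [/\ spectral_density f,
      exists2 w, spectral_density w &
        {ae mu, forall l, f l = (1 - eps) * f1 l + eps * w l} &
      (((2 * pi)^-1)%:E * \int[mu]_l (f l)%:E <= P%:E)%E]].

Definition D1_eps (eps : R) (g1 : R -> R) : set (R -> R) :=
  [set g | spectral_density g /\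
      (((2 * pi)^-1)%:E * \int[mu]_l `|g l - g1 l|%:E <= eps%:E)%E].

Definition ess_bounded (x : R -> R) : Prop :=
  exists K : R, {ae mu, forall l, `|x l| <= K}.

End Definitions.

(* Main.v *)
(* For densities (f, g) let h_fg = (A f - C) / (f + g) be the characteristic built
   from B^-1 R a, and W the space of square-integrable functions whose Fourier
   transform vanishes on T. Since C is the transform of a function on T, every k
   in W is orthogonal to C, so on W the error is
     Delta(h_fg + k; f, g) = Delta(h_fg; f, g) + (2 pi)^-1 int |k|^2 (f + g),
   and Delta(h_fg; f, g) is the value maximized by (f0, g0).
   The pair (h0, (f0, g0)) is a saddle point. For (f, g) in D the mixture of weights
   (1 - tau, tau) of (f0, g0) and (f, g) is in D; let h_tau be its characteristic.
   The error of h_tau at the mixture is (1 - tau) Delta(h_tau; f0, g0) +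
   tau Delta(h_tau; f, g), and is at most V0 = Delta(h0; f0, g0) by maximality.
   Completing the square at h0 gives Delta(h_tau; f, g) <= V0 and
   int |h_tau - h0|^2 (f0 + g0) = O(tau), and Fatou's lemma along tau -> 0 yields
   Delta(h0; f, g) <= V0. Minimality serves to make f0 + g0 positive almost
   everywhere, an entire function having only isolated zeros.
   Boundedness of h0 puts it in L_2^s(f + g) for all densities: its Abel means are
   bounded and converge to it weak-*, so h0 is orthogonal to every integrable
   function whose transform vanishes on the observation set, in particular to the
   residual of its own projection. *)

Require Import Defs.
From HB Require Import structures.
From mathcomp Require Import all_boot all_order all_algebra.
From mathcomp Require Import all_classical all_reals all_analysis.
From mathcomp Require Import measurable_realfun ring lra.
From mathcomp.real_closed Require Import complex.

Set Implicit Arguments.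
Unset Strict Implicit.
Unset Printing Implicit Defensive.

Import Order.TTheory GRing.Theory Num.Theory.
Import numFieldNormedType.Exports.

Local Open Scope classical_set_scope.
Local Open Scope ring_scope.
Local Open Scope complex_scope.

(** The quantity that [(f0, g0)] maximizes is the error of a pair's own characteristic, built from
    B^-1 R a. Away from [(f0, g0)] this characteristic is only known to lie in W and to have finite
    error; it need not be bounded, so its membership in L_2^s(f + g) is not at hand and its error
    cannot be identified with Delta(f, g). Maximality therefore says nothing directly about optimal
    estimates, and every comparison is made at h0, the characteristic that the hypotheses bound. The
    mixtures enter because their characteristics also lie in W, where orthogonality to C makes them
    comparable with h0. W and C are described by the L_2 Fourier transform, of which three facts are
    used: the inequality int |x^|^2 <= const int |x|^2, the multiplication formula int x^ y = int x
    y^, and inversion up to a null set. The inequality and the inversion come from the explicit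
    transform of exp(- y |t|), a positive kernel of mass 2 pi. *)

Local Notation cabs := (@ComplexField.Normc.normc _).

(** * Complex numbers through their real and imaginary parts *)

Section ComplexNumbers.
Context {R : realType}.
Implicit Types (z w : R[i]) (r : R).

Lemma ReD z w : complex.Re (z + w) = complex.Re z + complex.Re w.
Proof. by case: z => a b; case: w. Qed.
Lemma ImD z w : complex.Im (z + w) = complex.Im z + complex.Im w.
Proof. by case: z => a b; case: w. Qed.
Lemma ReN z : complex.Re (- z) = - complex.Re z.
Proof. by case: z. Qed.
Lemma ImN z : complex.Im (- z) = - complex.Im z.
Proof. by case: z. Qed.
Lemma ReM z w :
  complex.Re (z * w) = complex.Re z * complex.Re w - complex.Im z * complex.Im w.
Proof. by case: z => a b; case: w. Qed.
Lemma ImM z w :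
  complex.Im (z * w) = complex.Re z * complex.Im w + complex.Im z * complex.Re w.
Proof. by case: z => a b; case: w. Qed.
Lemma ReJ z : complex.Re (conjc z) = complex.Re z.
Proof. by case: z. Qed.
Lemma ImJ z : complex.Im (conjc z) = - complex.Im z.
Proof. by case: z. Qed.
Definition ReImE := (ReD, ImD, ReN, ImN, ReM, ImM, ReJ, ImJ).

Lemma complex_ext z w :
  complex.Re z = complex.Re w -> complex.Im z = complex.Im w -> z = w.
Proof. by case: z => a b; case: w => c d /= -> ->. Qed.

Lemma cabs2E z : cabs z ^+ 2 = complex.Re z ^+ 2 + complex.Im z ^+ 2.
Proof. by case: z => a b /=; rewrite sqr_sqrtr ?addr_ge0 ?sqr_ge0. Qed.

Lemma cabs_ge0 z : 0 <= cabs z.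
Proof. by case: z => a b /=; rewrite sqrtr_ge0. Qed.

Lemma cabs0 : cabs (0 : R[i]) = 0.
Proof. exact: ComplexField.Normc.normc0. Qed.

Lemma cabsM z w : cabs (z * w) = cabs z * cabs w.
Proof. exact: ComplexField.Normc.normcM. Qed.

Lemma cabsD z w : cabs (z + w) <= cabs z + cabs w.
Proof. exact: le_normcD. Qed.

Lemma cabsN z : cabs (- z) = cabs z.
Proof. exact: normcN. Qed.

Lemma ler_dist_cabs z w : `|cabs z - cabs w| <= cabs (z - w).
Proof.
have h1 : cabs z <= cabs (z - w) + cabs w by have := cabsD (z - w) w; rewrite subrK.
have h2 : cabs w <= cabs (z - w) + cabs z.
  by have := cabsD (- (z - w)) z; rewrite cabsN opprB subrK.
by rewrite ler_norml; apply/andP; split; lra.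
Qed.

Lemma cabsJ z : cabs (conjc z) = cabs z.
Proof. by case: z => a b /=; rewrite sqrrN. Qed.

Lemma cabs_real r : cabs r%:C = `|r|.
Proof. by rewrite /= expr0n /= addr0 sqrtr_sqr. Qed.

Lemma cabs_cexpi r : cabs (cexpi r) = 1.
Proof. by rewrite /= cos2Dsin2 sqrtr1. Qed.

Lemma cexpiD r s : cexpi (r + s) = cexpi r * cexpi s.
Proof.
by apply: complex_ext; rewrite !ReImE /= ?cosD ?sinD //; ring.
Qed.

Lemma cexpiJ r : conjc (cexpi r) = cexpi (- r).
Proof. by rewrite /cexpi /= cosN sinN. Qed.

Lemma cexpi0 : cexpi 0 = 1 :> R[i].
Proof. by rewrite /cexpi cos0 sin0. Qed.

Lemma conjCM z w : conjc (z * w) = conjc z * conjc w.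
Proof. by apply: complex_ext; rewrite !ReImE; ring. Qed.

Lemma conjCD z w : conjc (z + w) = conjc z + conjc w.
Proof. by apply: complex_ext; rewrite !ReImE; ring. Qed.

Lemma conjCN z : conjc (- z) = - conjc z.
Proof. by apply: complex_ext; rewrite !ReImE; ring. Qed.

Lemma mulJ_cabs z : z * conjc z = (cabs z ^+ 2)%:C.
Proof. by apply: complex_ext; rewrite ?cabs2E !ReImE /=; ring. Qed.

Lemma Re_le_cabs z : `|complex.Re z| <= cabs z.
Proof.
rewrite -[leRHS]ger0_norm ?cabs_ge0// -ler_sqr ?nnegrE//.
by rewrite !real_normK ?num_real// cabs2E lerDl sqr_ge0.
Qed.

Lemma Im_le_cabs z : `|complex.Im z| <= cabs z.
Proof.
rewrite -[leRHS]ger0_norm ?cabs_ge0// -ler_sqr ?nnegrE//.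
by rewrite !real_normK ?num_real// cabs2E lerDr sqr_ge0.
Qed.

Lemma cabs_le_ReIm z : cabs z <= `|complex.Re z| + `|complex.Im z|.
Proof.
rewrite -ler_sqr ?nnegrE ?addr_ge0 ?cabs_ge0//.
rewrite sqrrD !real_normK ?num_real// cabs2E.
by rewrite -addrA [X in _ <= _ + X]addrC addrA lerDl mulrn_wge0 ?mulr_ge0.
Qed.

Lemma cabs_eq0 z : (cabs z == 0) = (z == 0).
Proof.
by apply/eqP/eqP => [/ComplexField.Normc.eq0_normc//|->]; rewrite cabs0.
Qed.

Lemma cabs_divr z r : cabs (z / r%:C) = cabs z / `|r|.
Proof.
by rewrite cabsM ComplexField.Normc.normcV cabs_real.
Qed.

Lemma invrC r : (r%:C)^-1 = (r^-1)%:C :> R[i].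
Proof. by rewrite -fmorphV. Qed.

End ComplexNumbers.

(** * Measurability and integration of complex functions *)

Section ComplexIntegral.
Context {R : realType}.
Local Notation mu := (@lebesgue_measure R).
Local Notation C := R[i].
Implicit Types (x y : R -> C) (D : set R) (w : R -> R).

Lemma aeS (P Q : R -> Prop) : (forall t, P t -> Q t) ->
  {ae mu, forall t, P t} -> {ae mu, forall t, Q t}.
Proof. by move=> PQ; have F := ae_filter_ringOfSetsType mu; exact: filterS. Qed.

Lemma ae_and (P Q : R -> Prop) : {ae mu, forall t, P t} ->
  {ae mu, forall t, Q t} -> {ae mu, forall t, P t /\ Q t}.
Proof. by have F := ae_filter_ringOfSetsType mu; exact: filterI. Qed.

Lemma measC_cst D (c : C) : measC D (fun=> c).
Proof. by split; exact: measurable_cst. Qed.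

Lemma measCD D x y : measC D x -> measC D y -> measC D (fun t => x t + y t).
Proof.
move=> [x1 x2] [y1 y2]; split.
  by under eq_fun do rewrite ReD; exact: measurable_funD.
by under eq_fun do rewrite ImD; exact: measurable_funD.
Qed.

Lemma measCN D x : measC D x -> measC D (fun t => - x t).
Proof.
move=> [x1 x2]; split.
  by under eq_fun do rewrite ReN; exact: measurableT_comp.
by under eq_fun do rewrite ImN; exact: measurableT_comp.
Qed.

Lemma measCB D x y : measC D x -> measC D y -> measC D (fun t => x t - y t).
Proof. by move=> mx my; apply: measCD => //; exact: measCN. Qed.

Lemma measCM D x y : measC D x -> measC D y -> measC D (fun t => x t * y t).
Proof.
move=> [x1 x2] [y1 y2]; split.
  under eq_fun do rewrite ReM.
  by apply: measurable_funB; exact: measurable_funM.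
under eq_fun do rewrite ImM.
by apply: measurable_funD; exact: measurable_funM.
Qed.

Lemma measCJ D x : measC D x -> measC D (fun t => conjc (x t)).
Proof.
move=> [x1 x2]; split; first by under eq_fun do rewrite ReJ.
by under eq_fun do rewrite ImJ; exact: measurableT_comp.
Qed.

Lemma measC_real D w : measurable_fun D w -> measC D (fun t => (w t)%:C).
Proof. by move=> mw; split => //=; exact: measurable_cst. Qed.

(** Inversion is continuous off 0, and on the singleton {0} every function is measurable. *)
Lemma measurable_invr D w :
  measurable_fun D w -> measurable_fun D (fun t => (w t)^-1).
Proof.
move=> mw; suff: measurable_fun setT (@GRing.inv R) by move/measurableT_comp; apply.
have -> : setT = [set~ 0] `|` [set 0 : R] by rewrite setUC setUv.
apply/measurable_funU.
- by apply: measurableC.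
- by [].
split; last first.
  move=> _ Y mY; have [Y0|Y0] := pselect (Y (0^-1)).
    by rewrite (_ : _ `&` _ = [set 0])//; apply/seteqP; split=> [t []//|t ->].
  by rewrite (_ : _ `&` _ = set0)//; apply/seteqP; split=> [t [->]//|].
apply: open_continuous_measurable_fun.
  by rewrite openC; exact: closed_eq.
by move=> t /set_mem/= /eqP t0; exact: inv_continuous.
Qed.

Lemma measC_divr D x w : measC D x -> measurable_fun D w ->
  measC D (fun t => x t / (w t)%:C).
Proof.
move=> mx mw; apply: measCM => //.
by under eq_fun do rewrite invrC; apply: measC_real; exact: measurable_invr.
Qed.

Lemma continuous_cos_lin (s : R) : continuous (fun t : R => cos (s * t)).
Proof.
move=> t; apply: (@continuous_comp _ _ _ (fun t => s * t) cos).
  by apply: mulrl_continuous.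
exact: continuous_cos.
Qed.

Lemma continuous_sin_lin (s : R) : continuous (fun t : R => sin (s * t)).
Proof.
move=> t; apply: (@continuous_comp _ _ _ (fun t => s * t) sin).
  by apply: mulrl_continuous.
exact: continuous_sin.
Qed.

Lemma measC_cexpi D w : measurable_fun D w -> measC D (fun t => cexpi (w t)).
Proof.
move=> mw; split => /=.
  apply: (measurableT_comp _ mw); apply: continuous_measurable_fun.
  exact: continuous_cos.
apply: (measurableT_comp _ mw); apply: continuous_measurable_fun.
exact: continuous_sin.
Qed.

Lemma measC_cexpil (s : R) : measC setT (fun t => cexpi (s * t)).
Proof. by apply: measC_cexpi; exact: measurable_funM. Qed.

Lemma measurable_sqrtr (A : set R) : measurable_fun A (@Num.sqrt R).
Proof.
apply: (@measurable_funS _ _ _ _ setT) => //.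
by apply: continuous_measurable_fun => t; exact: sqrt_continuous.
Qed.

Lemma measurable_cabs D x : measC D x -> measurable_fun D (fun t => cabs (x t)).
Proof.
move=> [x1 x2].
have -> : (fun t => cabs (x t)) =
    (fun t => Num.sqrt (complex.Re (x t) ^+ 2 + complex.Im (x t) ^+ 2)).
  by apply/funext => t; case: (x t).
apply: (measurableT_comp (@measurable_sqrtr setT)).
by apply: measurable_funD; exact: measurable_funX.
Qed.

Lemma measurable_cabsE D x :
  measC D x -> measurable_fun D (fun t => (cabs (x t))%:E).
Proof. by move=> mx; apply/measurable_EFinP; exact: measurable_cabs. Qed.

Lemma measurable_cabs2 D x w : measC D x -> measurable_fun D w ->
  measurable_fun D (fun t => (cabs (x t) ^+ 2 * w t)%:E).
Proof.
move=> mx mw; apply/measurable_EFinP; apply: measurable_funM => //.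
by apply: measurable_funX; exact: measurable_cabs.
Qed.

Lemma extend0_in D x t : D t -> extend0 D x t = x t.
Proof. by move=> Dt; rewrite /extend0; case: asboolP. Qed.

Lemma extend0_out D x t : ~ D t -> extend0 D x t = 0.
Proof. by move=> Dt; rewrite /extend0; case: asboolP. Qed.

Lemma Re_extend0 D x :
  (fun t => complex.Re (extend0 D x t)) = (fun t => complex.Re (x t)) \_ D.
Proof.
apply/funext => t; rewrite patchE; have [Dt|Dt] := pselect (D t).
  by rewrite extend0_in// mem_set.
by rewrite extend0_out// memNset.
Qed.

Lemma Im_extend0 D x :
  (fun t => complex.Im (extend0 D x t)) = (fun t => complex.Im (x t)) \_ D.
Proof.
apply/funext => t; rewrite patchE; have [Dt|Dt] := pselect (D t).
  by rewrite extend0_in// mem_set.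
by rewrite extend0_out// memNset.
Qed.

Lemma integralC_extend0 D x : integralC D x = integralC setT (extend0 D x).
Proof.
rewrite /integralC; congr Complex; rewrite Rintegral_mkcond.
  by rewrite -Re_extend0.
by rewrite -Im_extend0.
Qed.

Lemma measC_extend0 D x : measurable D -> measC D x <-> measC setT (extend0 D x).
Proof.
by move=> mD; rewrite /measC Re_extend0 Im_extend0; split => -[m1 m2];
  split; apply/(measurable_restrictT _ mD).
Qed.

Lemma integrableC_extend0 D x :
  measurable D -> integrableC D x <-> integrableC setT (extend0 D x).
Proof.
have EFr (u : R -> R) : (fun t => ((u \_ D) t)%:E) = (fun t => (u t)%:E) \_ D.
  by apply/funext => t; rewrite !patchE; case: ifP.
move=> mD; have ReE := Re_extend0 D x; have ImE := Im_extend0 D x.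
split => -[m1 m2]; split.
- by have := (@integrable_mkcond _ _ _ mu D _ mD).1 m1; rewrite -EFr -ReE.
- by have := (@integrable_mkcond _ _ _ mu D _ mD).1 m2; rewrite -EFr -ImE.
- by apply: (@integrable_mkcond _ _ _ mu D _ mD).2; rewrite -EFr -ReE.
- by apply: (@integrable_mkcond _ _ _ mu D _ mD).2; rewrite -EFr -ImE.
Qed.

Lemma integrableCP D x : measurable D -> integrableC D x <->
  measC D x /\ (\int[mu]_(t in D) (cabs (x t))%:E < +oo)%E.
Proof.
move=> mD; split=> [[/integrableP[m1 i1] /integrableP[m2 i2]]|[[m1 m2] ix]].
  have mx : measC D x by split; apply/measurable_EFinP.
  split => //; apply: (@le_lt_trans _ _ (\int[mu]_(t in D)
     (`|(complex.Re (x t))%:E| + `|(complex.Im (x t))%:E|))%E).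
    apply: ge0_le_integral => //.
    - by move=> t _; rewrite lee_fin cabs_ge0.
    - exact: measurable_cabsE.
    - by apply: emeasurable_funD; exact: measurableT_comp.
    - by move=> t _; rewrite -EFinD lee_fin cabs_le_ReIm.
  rewrite ge0_integralD//.
  - exact: lte_add_pinfty.
  - exact: measurableT_comp.
  - exact: measurableT_comp.
split; apply/integrableP; split; try exact/measurable_EFinP.
  apply: le_lt_trans ix; apply: ge0_le_integral => //.
  - by apply: measurableT_comp => //; exact/measurable_EFinP.
  - exact: measurable_cabsE.
  - by move=> t _; rewrite lee_fin Re_le_cabs.
apply: le_lt_trans ix; apply: ge0_le_integral => //.
- by apply: measurableT_comp => //; exact/measurable_EFinP.
- exact: measurable_cabsE.
- by move=> t _; rewrite lee_fin Im_le_cabs.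
Qed.

Lemma integrableC_le D x (g : R -> R) : measurable D -> measC D x ->
  mu.-integrable D (EFin \o g) -> (forall t, D t -> cabs (x t) <= g t) ->
  integrableC D x.
Proof.
move=> mD mx ig xg; have [m1 m2] := mx.
split; apply: (@le_integrable _ _ _ mu D mD _ _ _ _ ig); try exact/measurable_EFinP.
  move=> t Dt /=; rewrite lee_fin (le_trans (Re_le_cabs _))//.
  by rewrite (le_trans (xg _ Dt))// ler_norm.
move=> t Dt /=; rewrite lee_fin (le_trans (Im_le_cabs _))//.
by rewrite (le_trans (xg _ Dt))// ler_norm.
Qed.

Lemma integrableC_measC D x : integrableC D x -> measC D x.
Proof. by move=> [/measurable_int/measurable_EFinP ? /measurable_int/measurable_EFinP ?]. Qed.

Lemma integrable_cabs D x : measurable D -> integrableC D x ->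
  mu.-integrable D (EFin \o (fun t => cabs (x t))).
Proof.
move=> mD ix; have [mx i] := (integrableCP _ mD).1 ix.
apply/integrableP; split; first exact: measurable_cabsE.
by under eq_integral do rewrite /= ger0_norm ?cabs_ge0//.
Qed.

Lemma integrableCD D x y : measurable D -> integrableC D x -> integrableC D y ->
  integrableC D (fun t => x t + y t).
Proof.
move=> mD [x1 x2] [y1 y2]; split.
  rewrite (_ : (fun t => _) = (fun t => (complex.Re (x t))%:E) \+
    (fun t => (complex.Re (y t))%:E))%E; first exact: integrableD.
  by apply/funext => t; rewrite ReD.
rewrite (_ : (fun t => _) = (fun t => (complex.Im (x t))%:E) \+
  (fun t => (complex.Im (y t))%:E))%E; first exact: integrableD.
by apply/funext => t; rewrite ImD.
Qed.

Lemma integrableCN D x : measurable D -> integrableC D x ->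
  integrableC D (fun t => - x t).
Proof.
move=> mD [x1 x2]; split.
  by under eq_fun do rewrite ReN EFinN; exact: integrableN.
by under eq_fun do rewrite ImN EFinN; exact: integrableN.
Qed.

Lemma integrableCB D x y : measurable D -> integrableC D x -> integrableC D y ->
  integrableC D (fun t => x t - y t).
Proof. by move=> mD ix iy; apply: integrableCD => //; exact: integrableCN. Qed.

Lemma integrableCMb D x y (K : R) : measurable D -> integrableC D x ->
  measC D y -> (forall t, D t -> cabs (y t) <= K) ->
  integrableC D (fun t => x t * y t).
Proof.
move=> mD ix my yK.
apply: (@integrableC_le _ _ (fun t => K * cabs (x t))) => //.
- by apply: measCM => //; exact: integrableC_measC.
- have := @integrableZl _ _ _ mu D mD K _ (integrable_cabs mD ix).
  exact: eq_integrable.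
- by move=> t Dt; rewrite cabsM mulrC ler_wpM2r ?cabs_ge0 ?yK.
Qed.

Lemma integrableCZl D x (c : C) : measurable D -> integrableC D x ->
  integrableC D (fun t => c * x t).
Proof.
move=> mD ix; under eq_fun do rewrite mulrC.
by apply: (@integrableCMb _ _ _ (cabs c)) => //; exact: measC_cst.
Qed.

Lemma integrableCJ D x : measurable D -> integrableC D x ->
  integrableC D (fun t => conjc (x t)).
Proof.
move=> mD [x1 x2]; split; first by under eq_fun do rewrite ReJ.
by under eq_fun do rewrite ImJ EFinN; exact: integrableN.
Qed.

Lemma integralCD D x y : measurable D -> integrableC D x -> integrableC D y ->
  integralC D (fun t => x t + y t) = integralC D x + integralC D y.
Proof.
move=> mD [x1 x2] [y1 y2]; apply: complex_ext; rewrite !ReImE /=.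
  by rewrite -RintegralD//; apply: eq_Rintegral => t _; rewrite ReD.
by rewrite -RintegralD//; apply: eq_Rintegral => t _; rewrite ImD.
Qed.

Lemma integralCN D x : measurable D -> integrableC D x ->
  integralC D (fun t => - x t) = - integralC D x.
Proof.
move=> mD [x1 x2]; apply: complex_ext; rewrite !ReImE /=.
  by rewrite -mulN1r -RintegralZl//; apply: eq_Rintegral => t _; rewrite ReN mulN1r.
by rewrite -mulN1r -RintegralZl//; apply: eq_Rintegral => t _; rewrite ImN mulN1r.
Qed.

Lemma integralCB D x y : measurable D -> integrableC D x -> integrableC D y ->
  integralC D (fun t => x t - y t) = integralC D x - integralC D y.
Proof.
by move=> mD ix iy; rewrite integralCD ?integralCN//; exact: integrableCN.
Qed.

Lemma integralCZl D x (c : C) : measurable D -> integrableC D x ->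
  integralC D (fun t => c * x t) = c * integralC D x.
Proof.
move=> mD [x1 x2].
have Z (r : R) (u : R -> R) : mu.-integrable D (fun t => (u t)%:E) ->
    mu.-integrable D (EFin \o (fun t => r * u t)).
  by move=> iu; have := @integrableZl _ _ _ mu D mD r _ iu; exact: eq_integrable.
apply: complex_ext; rewrite !ReImE /=.
  rewrite -!RintegralZl// -RintegralB//; [|exact: Z|exact: Z].
  by apply: eq_Rintegral => t _; rewrite ReM.
rewrite -!RintegralZl// -RintegralD//; [|exact: Z|exact: Z].
by apply: eq_Rintegral => t _; rewrite ImM.
Qed.

Lemma integralCZr D x (c : C) : measurable D -> integrableC D x ->
  integralC D (fun t => x t * c) = integralC D x * c.
Proof.
by move=> mD ix; under eq_fun do rewrite mulrC; rewrite integralCZl// mulrC.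
Qed.

Lemma integralCJ D x : measurable D -> integrableC D x ->
  integralC D (fun t => conjc (x t)) = conjc (integralC D x).
Proof.
move=> mD [x1 x2]; apply: complex_ext; rewrite !ReImE /=.
  by apply: eq_Rintegral => t _; rewrite ReJ.
rewrite -mulN1r -RintegralZl//.
by apply: eq_Rintegral => t _; rewrite ImJ mulN1r.
Qed.

Lemma eq_integralC D x y : {in D, x =1 y} -> integralC D x = integralC D y.
Proof.
by move=> xy; rewrite /integralC; congr Complex; apply: eq_Rintegral => t Dt; rewrite xy.
Qed.

Lemma cabs_integralC D x : measurable D -> integrableC D x ->
  ((cabs (integralC D x))%:E <= \int[mu]_(t in D) (cabs (x t))%:E)%E.
Proof.
move=> mD ix; move zE : (integralC D x) => z.
have [->|z0] := eqVneq z 0.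
  by rewrite cabs0; apply: integral_ge0 => t _; rewrite lee_fin cabs_ge0.
have cz0 : cabs z != 0 by rewrite cabs_eq0.
(* Rotate the integral onto the positive real axis. *)
pose u := conjc z / (cabs z)%:C.
have cu : cabs u = 1 by rewrite cabs_divr cabsJ ger0_norm ?cabs_ge0 ?divff.
have uz : u * z = (cabs z)%:C.
  rewrite /u mulrAC [_ * z]mulrC mulJ_cabs expr2 rmorphM /= mulfK//.
  by apply: contra cz0 => /eqP[->].
have iux := integrableCZl u mD ix.
have -> : (cabs z)%:E = (\int[mu]_(t in D) (complex.Re (u * x t))%:E)%E.
  have -> : cabs z = complex.Re (integralC D (fun t => u * x t)).
    by rewrite integralCZl// zE uz.
  by rewrite /= /Rintegral fineK//; apply: integrable_fin_num; case: iux.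
apply: le_integral => //.
- by case: iux.
- exact: integrable_cabs.
- move=> t _; rewrite lee_fin (le_trans (ler_norm _))//.
  by rewrite (le_trans (Re_le_cabs _))// cabsM cu mul1r.
Qed.

Lemma ae_eq_integralC D x y : measurable D -> measC D x -> measC D y ->
  {ae mu, forall t, D t -> x t = y t} -> integralC D x = integralC D y.
Proof.
move=> mD [x1 x2] [y1 y2] xy; rewrite /integralC /Rintegral.
congr Complex; congr fine; apply: ae_eq_integral => //; try exact/measurable_EFinP.
  by apply: aeS xy => t xy Dt; rewrite xy.
by apply: aeS xy => t xy Dt; rewrite xy.
Qed.

End ComplexIntegral.

(** * The absolutely convergent Fourier integral *)

Section FourierL1.
Context {R : realType}.
Local Notation mu := (@lebesgue_measure R).
Local Notation C := R[i].
Implicit Types (x y : R -> C) (s : R).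

Lemma aeT (P : R -> Prop) : (forall t, P t) -> {ae mu, forall t, P t}.
Proof. by move=> h; exact: (aeW mu). Qed.

Lemma EFin_Rintegral (D : set R) (f : R -> R) : measurable D ->
  mu.-integrable D (EFin \o f) ->
  (\int[mu]_(t in D) (f t)%:E = (\int[mu]_(t in D) f t)%:E)%E.
Proof.
by move=> mD fi; rewrite fineK//; exact: (@integrable_fin_num _ _ _ mu D mD _ fi).
Qed.

(** Domination by a product of integrable functions makes every section integrable, not only almost
    every one, so the real-valued inner integrals agree everywhere with the extended ones to which
    Fubini's theorem applies. *)
Lemma fubini_bounded (k : R -> R -> R) (p q : R -> R) :
  measurable_fun setT (fun z : R * R => k z.1 z.2) ->
  mu.-integrable setT (EFin \o p) -> mu.-integrable setT (EFin \o q) ->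
  (forall t, 0 <= p t) -> (forall t, 0 <= q t) ->
  (forall l u, `|k l u| <= p l * q u) ->
  \int[mu]_l (\int[mu]_u k l u) = \int[mu]_u (\int[mu]_l k l u).
Proof.
move=> mk ip iq p0 q0 kpq.
have mp : measurable_fun setT p by have /measurable_int/measurable_EFinP := ip.
have mq : measurable_fun setT q by have /measurable_int/measurable_EFinP := iq.
have mk1 l : measurable_fun setT (k l).
  exact: (measurableT_comp mk (pair1_measurable l)).
have mk2 u : measurable_fun setT (k ^~ u).
  exact: (measurableT_comp mk (pair2_measurable u)).
have i1 l : mu.-integrable setT (EFin \o k l).
  apply: (@le_integrable _ _ _ mu setT measurableT _ (fun u => (p l * q u)%:E)) => //.
  - by apply/measurable_EFinP; exact: mk1.
  - by move=> u _; rewrite /= lee_fin (le_trans (kpq _ _))// ler_norm.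
  - by under eq_fun do rewrite EFinM; exact: integrableZl.
have i2 u : mu.-integrable setT (EFin \o k ^~ u).
  apply: (@le_integrable _ _ _ mu setT measurableT _ (fun l => (q u * p l)%:E)) => //.
  - by apply/measurable_EFinP; exact: mk2.
  - by move=> l _; rewrite /= lee_fin (le_trans (kpq _ _))// mulrC ler_norm.
  - by under eq_fun do rewrite EFinM; exact: integrableZl.
have mK : measurable_fun setT (fun z : R * R => (k z.1 z.2)%:E).
  exact/measurable_EFinP.
rewrite /Rintegral; congr fine.
transitivity (\int[mu]_l \int[mu]_u (k l u)%:E)%E.
  by apply: eq_integral => l _; rewrite fineK//; exact: integrable_fin_num (i1 l).
transitivity (\int[mu]_u \int[mu]_l (k l u)%:E)%E; last first.
  by apply: eq_integral => u _; rewrite fineK//; exact: integrable_fin_num (i2 u).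
apply: (@Fubini _ _ _ _ _ mu mu (fun z => (k z.1 z.2)%:E)).
apply/integrable12ltyP; first exact: mK.
apply: (@le_lt_trans _ _ (\int[mu]_l ((p l)%:E * \int[mu]_u (q u)%:E))%E).
  apply: ge0_le_integral => //.
  - by move=> l _; exact: integral_ge0.
  - apply: (@measurable_fun_fubini_tonelli_F _ _ _ _ _ mu (fun z => `|(k z.1 z.2)%:E|)%E) => //.
    exact: measurableT_comp.
  - by apply: emeasurable_funM => //; exact/measurable_EFinP.
  move=> l _; rewrite -ge0_integralZl//.
  - apply: ge0_le_integral => //.
    + by apply: measurableT_comp => //; apply/measurable_EFinP; exact: mk1.
    + by apply/measurable_EFinP; exact: measurable_funM.
    + by move=> u _; rewrite lee_fin.
  - exact/measurable_EFinP.
  - by move=> u _; rewrite lee_fin.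
  - by rewrite lee_fin.
rewrite ge0_integralZr//.
- rewrite lte_mul_pinfty ?integrable_lty//.
  + by apply: integral_ge0 => l _; rewrite lee_fin.
  + exact: integrable_fin_num.
- exact/measurable_EFinP.
- by move=> l _; rewrite lee_fin.
- by apply: integral_ge0 => u _; rewrite lee_fin.
Qed.

Lemma measurable_fourier_kernel s x y : measC setT x -> measC setT y ->
  measurable_fun setT
    (fun z : R * R => complex.Re (x z.2 * y z.1 * cexpi (s * z.2 * z.1))) /\
  measurable_fun setT
    (fun z : R * R => complex.Im (x z.2 * y z.1 * cexpi (s * z.2 * z.1))).
Proof.
move=> [x1 x2] [y1 y2].
have m2 (u : R -> R) : measurable_fun setT u -> measurable_fun setT (fun z : R * R => u z.2).
  by move=> mu_; exact: (measurableT_comp mu_ measurable_snd).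
have m1 (u : R -> R) : measurable_fun setT u -> measurable_fun setT (fun z : R * R => u z.1).
  by move=> mu_; exact: (measurableT_comp mu_ measurable_fst).
have ms : measurable_fun setT (fun z : R * R => s * z.2 * z.1).
  apply: measurable_funM; [apply: measurable_funM => //|]; exact: (m2 id)||exact: (m1 id).
have mc : measurable_fun setT (fun z : R * R => cos (s * z.2 * z.1)).
  apply: (measurableT_comp _ ms); apply: continuous_measurable_fun.
  exact: continuous_cos.
have mn : measurable_fun setT (fun z : R * R => sin (s * z.2 * z.1)).
  apply: (measurableT_comp _ ms); apply: continuous_measurable_fun.
  exact: continuous_sin.
have X1 := m2 _ x1; have X2 := m2 _ x2; have Y1 := m1 _ y1; have Y2 := m1 _ y2.
split; under eq_fun do rewrite !ReImE /=.
  by apply: measurable_funB; apply: measurable_funM => //;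
    [apply: measurable_funB|apply: measurable_funD]; exact: measurable_funM.
by apply: measurable_funD; apply: measurable_funM => //;
    [apply: measurable_funB|apply: measurable_funD]; exact: measurable_funM.
Qed.

Lemma integrable_fourier_kernel s x l : integrableC setT x ->
  integrableC setT (fun u => x u * cexpi (s * u * l)).
Proof.
move=> ix; apply: (@integrableCMb _ _ _ _ 1) => //.
  by apply: measC_cexpi; apply: measurable_funM => //; exact: measurable_funM.
by move=> t _; rewrite cabs_cexpi.
Qed.

(** The multiplication formula: both sides are the double integral of x(u) y(l) e^{i s u l}. It does
    the work of Plancherel's identity in what follows. *)
Lemma fourierL1_mult s x y : integrableC setT x -> integrableC setT y ->
  integralC setT (fun l => fourierL1 s setT x l * y l) =
  integralC setT (fun u => x u * fourierL1 s setT y u).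
Proof.
move=> ix iy.
have [mRe mIm] := measurable_fourier_kernel s (integrableC_measC ix) (integrableC_measC iy).
have ipy := integrable_cabs measurableT iy.
have ipx := integrable_cabs measurableT ix.
have b l u : cabs (x u * y l * cexpi (s * u * l)) = cabs (y l) * cabs (x u).
  by rewrite !cabsM cabs_cexpi mulr1 mulrC.
have L : (fun l => fourierL1 s setT x l * y l) =
    (fun l => integralC setT (fun u => x u * y l * cexpi (s * u * l))).
  apply/funext => l; rewrite /fourierL1 -integralCZr//; last exact: integrable_fourier_kernel.
  by apply: eq_integralC => u _; rewrite mulrAC.
have RR : (fun u => x u * fourierL1 s setT y u) =
    (fun u => integralC setT (fun l => x u * y l * cexpi (s * u * l))).
  apply/funext => u; rewrite /fourierL1 -integralCZl//; last exact: integrable_fourier_kernel.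
  by apply: eq_integralC => l _; rewrite mulrA -!mulrA [u * l]mulrC.
rewrite L RR; apply: complex_ext => /=.
  apply: (fubini_bounded mRe ipy ipx) => [t|t|l u]; rewrite ?cabs_ge0//.
  by rewrite -b Re_le_cabs.
apply: (fubini_bounded mIm ipy ipx) => [t|t|l u]; rewrite ?cabs_ge0//.
by rewrite -b Im_le_cabs.
Qed.

(** Dominated convergence with the bound |x|. Besides measurability, continuity later turns
    vanishing almost everywhere on an open set into vanishing at each of its points. *)
Lemma continuous_fourierL1 s x : integrableC setT x ->
  continuous (fun l => complex.Re (fourierL1 s setT x l)) /\
  continuous (fun l => complex.Im (fourierL1 s setT x l)).
Proof.
move=> ix; have mx := integrableC_measC ix.
have inI (l : R) : `]l - 1, l + 1[%classic l.
  by rewrite /= in_itv/= ltrBlDr ltrDl ltr01.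
have cs (t : R) : continuous (fun l => cos (s * t * l)) by exact: continuous_cos_lin.
have sn (t : R) : continuous (fun l => sin (s * t * l)) by exact: continuous_sin_lin.
have cM (c : R) (u : R -> R) : continuous u -> continuous (fun l => c * u l).
  by move=> cu t; apply: cvgM => //; [exact: cvg_cst|exact: cu].
have cR t : continuous (fun l => complex.Re (x t * cexpi (s * t * l))).
  rewrite (_ : (fun l => _) = (fun l => complex.Re (x t) * cos (s * t * l) -
      complex.Im (x t) * sin (s * t * l))); last by apply/funext => l; rewrite ReM.
  by move=> l; apply: cvgB; apply: cM.
have cI t : continuous (fun l => complex.Im (x t * cexpi (s * t * l))).
  rewrite (_ : (fun l => _) = (fun l => complex.Re (x t) * sin (s * t * l) +
      complex.Im (x t) * cos (s * t * l))); last by apply/funext => l; rewrite ImM.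
  by move=> l; apply: cvgD; apply: cM.
split=> l.
  have := @continuity_under_integral _ _ _ mu
    (fun l u => complex.Re (x u * cexpi (s * u * l))) setT measurableT (l - 1) (l + 1)
    _ _ (fun u => cabs (x u)) _ _ l; apply.
  - by move=> t _; have [] := integrable_fourier_kernel s t ix.
  - by apply: aeT => t _ a _; exact: cR.
  - exact: integrable_cabs.
  - move=> t _; apply: aeT => u _; apply: le_trans (Re_le_cabs _) _.
    by rewrite cabsM cabs_cexpi mulr1.
  - exact/mem_set/inI.
have := @continuity_under_integral _ _ _ mu
  (fun l u => complex.Im (x u * cexpi (s * u * l))) setT measurableT (l - 1) (l + 1)
  _ _ (fun u => cabs (x u)) _ _ l; apply.
- by move=> t _; have [] := integrable_fourier_kernel s t ix.
- by apply: aeT => t _ a _; exact: cI.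
- exact: integrable_cabs.
- move=> t _; apply: aeT => u _; apply: le_trans (Im_le_cabs _) _.
  by rewrite cabsM cabs_cexpi mulr1.
- exact/mem_set/inI.
Qed.

Lemma measC_fourierL1 s x : integrableC setT x -> measC setT (fourierL1 s setT x).
Proof.
by move=> ix; have [c1 c2] := continuous_fourierL1 s ix;
  split; exact: continuous_measurable_fun.
Qed.

Lemma cabs_fourierL1 s x : integrableC setT x ->
  forall l, ((cabs (fourierL1 s setT x l))%:E <= \int[mu]_t (cabs (x t))%:E)%E.
Proof.
move=> ix l; apply: le_trans (cabs_integralC measurableT (integrable_fourier_kernel s l ix)) _.
by under eq_integral do rewrite cabsM cabs_cexpi mulr1.
Qed.

Lemma fourierL1_bounded s x : integrableC setT x ->
  exists K : R, forall l, cabs (fourierL1 s setT x l) <= K.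
Proof.
move=> ix; have [_ i] := (integrableCP _ measurableT).1 ix.
exists (fine (\int[mu]_t (cabs (x t))%:E)) => l.
rewrite -lee_fin fineK; first exact: cabs_fourierL1.
by rewrite ge0_fin_numE//; apply: integral_ge0 => t _; rewrite lee_fin cabs_ge0.
Qed.

Lemma fourierL1J s x l : integrableC setT x ->
  conjc (fourierL1 s setT x l) = fourierL1 (- s) setT (fun t => conjc (x t)) l.
Proof.
move=> ix; rewrite /fourierL1 -integralCJ//; last exact: integrable_fourier_kernel.
by apply: eq_integralC => t _; rewrite conjCM cexpiJ !mulNr.
Qed.

Lemma fourierL1B s x y l : integrableC setT x -> integrableC setT y ->
  fourierL1 s setT (fun t => x t - y t) l = fourierL1 s setT x l - fourierL1 s setT y l.
Proof.
move=> ix iy; rewrite /fourierL1 -integralCB//; try exact: integrable_fourier_kernel.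
by apply: eq_integralC => t _; rewrite mulrBl.
Qed.

End FourierL1.

(** * Weighted square norms, Fatou's lemma and completeness *)

Section WeightedL2.
Context {R : realType}.
Local Notation mu := (@lebesgue_measure R).
Local Notation C := R[i].
Implicit Types (x y : R -> C) (w : R -> R).

(** Integrability is left out, so that the constant 1, that is Lebesgue measure, is a weight along
    with the spectral densities. *)
Definition weight w := measurable_fun setT w /\ forall l, 0 <= w l.

Lemma weight1 : weight (fun=> 1 : R).
Proof. by split. Qed.

Lemma L2CP x :
  L2C setT x <-> measC setT x /\ (normw2 (fun=> 1%R) x < +oo)%E.
Proof. by rewrite /L2C /normw2; under [in X in _ <-> X]eq_integral do rewrite mulr1. Qed.

Lemma normw2_1 x : normw2 (fun=> 1) x = (\int[mu]_l (cabs (x l) ^+ 2)%:E)%E.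
Proof. by rewrite /normw2; under eq_integral do rewrite mulr1. Qed.

Lemma cabs2_ge0 w x l : weight w -> 0 <= cabs (x l) ^+ 2 * w l.
Proof. by case=> _ w0; rewrite mulr_ge0// exprn_ge0// cabs_ge0. Qed.

Lemma measurable_normw2 w x : weight w -> measC setT x ->
  measurable_fun setT (fun l => (cabs (x l) ^+ 2 * w l)%:E).
Proof. by move=> [mw _] mx; exact: measurable_cabs2. Qed.

Lemma normw2_ge0 w x : weight w -> (0 <= normw2 w x)%E.
Proof. by move=> ww; apply: integral_ge0 => l _; rewrite lee_fin cabs2_ge0. Qed.

Lemma normw2_le w x y (c : R) : weight w -> measC setT x -> measC setT y ->
  0 <= c ->
  (forall l, cabs (x l) ^+ 2 * w l <= c * (cabs (y l) ^+ 2 * w l)) ->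
  (normw2 w x <= c%:E * normw2 w y)%E.
Proof.
move=> ww mx my c0 xy; rewrite /normw2 -ge0_integralZl//.
- apply: ge0_le_integral => //.
  + by move=> l _; rewrite lee_fin cabs2_ge0.
  + exact: measurable_normw2.
  + by apply: measurable_funeM; exact: measurable_normw2.
  + by move=> l _; rewrite -EFinM lee_fin.
- exact: measurable_normw2.
- by move=> l _; rewrite lee_fin cabs2_ge0.
Qed.

Lemma normw2Z w x (c : C) : weight w -> measC setT x ->
  normw2 w (fun l => c * x l) = ((cabs c ^+ 2)%:E * normw2 w x)%E.
Proof.
move=> ww mx; rewrite /normw2 -ge0_integralZl//.
- by apply: eq_integral => l _; rewrite cabsM exprMn -mulrA EFinM.
- exact: measurable_normw2.
- by move=> l _; rewrite lee_fin cabs2_ge0.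
- by rewrite lee_fin exprn_ge0// cabs_ge0.
Qed.

Lemma normw2N w x : normw2 w (fun l => - x l) = normw2 w x.
Proof. by rewrite /normw2; apply: eq_integral => l _; rewrite cabsN. Qed.

Lemma normw2_distC w x y :
  normw2 w (fun l => x l - y l) = normw2 w (fun l => y l - x l).
Proof. by rewrite -normw2N; congr normw2; apply/funext => l; rewrite opprB. Qed.

Lemma parallelogramC (z v : C) : cabs (z + v) ^+ 2 + cabs (z - v) ^+ 2 =
  2 * cabs z ^+ 2 + 2 * cabs v ^+ 2.
Proof. by rewrite !cabs2E !ReImE; ring. Qed.

Lemma normw2_parallelogram w x y : weight w -> measC setT x -> measC setT y ->
  (normw2 w (fun l => x l + y l)%R + normw2 w (fun l => x l - y l)%R =
   2%:E * normw2 w x + 2%:E * normw2 w y)%E.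
Proof.
move=> ww mx my; have [mw _] := ww; rewrite /normw2.
have m z : measC setT z -> measurable_fun setT (fun l => (cabs (z l) ^+ 2 * w l)%:E).
  by move=> mz; exact: measurable_cabs2.
have p z l : (0 <= (cabs (z l) ^+ 2 * w l)%:E)%E by rewrite lee_fin cabs2_ge0.
rewrite -!ge0_integralZl//; [|exact: m|exact: m].
rewrite -!ge0_integralD//=.
- apply: eq_integral => l _; rewrite -!EFinD; congr EFin.
  by rewrite -mulrDl parallelogramC; ring.
- by move=> l _; rewrite mule_ge0.
- by apply: measurable_funeM; exact: m.
- by move=> l _; rewrite mule_ge0.
- by apply: measurable_funeM; exact: m.
- by move=> l _; exact: (p (fun l => x l + y l)).
- exact: (m _ (measCD mx my)).
- by move=> l _; exact: (p (fun l => x l - y l)).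
- exact: (m _ (measCB mx my)).
Qed.

Lemma normw2D w x y : weight w -> measC setT x -> measC setT y ->
  (normw2 w (fun l => x l + y l)%R <= 2%:E * normw2 w x + 2%:E * normw2 w y)%E.
Proof.
move=> ww mx my; rewrite -normw2_parallelogram//.
by rewrite leeDl// normw2_ge0.
Qed.

Lemma normw2B w x y : weight w -> measC setT x -> measC setT y ->
  (normw2 w (fun l => x l - y l)%R <= 2%:E * normw2 w x + 2%:E * normw2 w y)%E.
Proof.
by move=> ww mx my; rewrite -(normw2N w y); apply: normw2D => //; exact: measCN.
Qed.

Lemma lte_2add (a b : \bar R) : (a < +oo -> b < +oo -> 2%:E * a + 2%:E * b < +oo)%E.
Proof. by move=> ao bo; apply: lte_add_pinfty; rewrite lte_mul_pinfty. Qed.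

Lemma normw2D_lty w x y : weight w -> measC setT x -> measC setT y ->
  (normw2 w x < +oo -> normw2 w y < +oo ->
   normw2 w (fun l => x l + y l)%R < +oo)%E.
Proof.
by move=> ww mx my xo yo; apply: le_lt_trans (normw2D ww mx my) (lte_2add xo yo).
Qed.

Lemma normw2B_lty w x y : weight w -> measC setT x -> measC setT y ->
  (normw2 w x < +oo -> normw2 w y < +oo ->
   normw2 w (fun l => x l - y l)%R < +oo)%E.
Proof.
by move=> ww mx my xo yo; apply: le_lt_trans (normw2B ww mx my) (lte_2add xo yo).
Qed.

Lemma normw2Z_lty w x (c : C) : weight w -> measC setT x ->
  (normw2 w x < +oo -> normw2 w (fun l => c * x l)%R < +oo)%E.
Proof.
move=> ww mx xo; rewrite normw2Z// lte_mul_pinfty// lee_fin.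
by rewrite exprn_ge0// cabs_ge0.
Qed.

(** Almost everywhere for the measure w dl is expressed here and below by the alternative [w l = 0]
    under Lebesgue measure. *)
Lemma ae_eq_normw2 w x y : weight w -> measC setT x -> measC setT y ->
  {ae mu, forall l, w l = 0 \/ x l = y l} -> normw2 w x = normw2 w y.
Proof.
move=> [mw w0] mx my xy; apply: ae_eq_integral => //.
- exact: measurable_cabs2.
- exact: measurable_cabs2.
- by apply: aeS xy => l [-> _|-> //]; rewrite !mulr0.
Qed.

Lemma normw2_eq0 w x : weight w -> measC setT x ->
  normw2 w x = 0%E -> {ae mu, forall l, w l = 0 \/ x l = 0}.
Proof.
move=> ww mx x0; have [mw w0] := ww.
have m := measurable_cabs2 mx mw.
have : (\int[mu]_l `|(cabs (x l) ^+ 2 * w l)%:E| = 0)%E.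
  by rewrite -[RHS]x0; apply: eq_integral => l _; rewrite gee0_abs// lee_fin cabs2_ge0.
move=> /(ae_eq_integral_abs mu measurableT m).1; apply: aeS => l /(_ I) [].
move=> /eqP; rewrite mulf_eq0 => /orP[|/eqP ->]; last by left.
by rewrite expf_eq0/= cabs_eq0 => /eqP ->; right.
Qed.

Lemma normw2_eq0P w x : weight w -> measC setT x ->
  (forall e : R, 0 < e -> (normw2 w x <= e%:E)%E) ->
  {ae mu, forall l, w l = 0 \/ x l = 0}.
Proof.
move=> ww mx xe; apply: normw2_eq0 => //; apply/eqP; rewrite eq_le normw2_ge0// andbT.
by apply/lee_addgt0Pr => e e0; rewrite add0e; exact: xe.
Qed.

Lemma cvg_cabs_sqr (z : nat -> C) (v : C) (c : R) :
  (fun n => cabs (z n - v)) @ \oo --> (0 : R) ->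
  (fun n => cabs (z n) ^+ 2 * c) @ \oo --> cabs v ^+ 2 * c.
Proof.
move=> zv; apply: cvgM; last exact: cvg_cst.
suff h : (fun n => cabs (z n)) @ \oo --> cabs v by rewrite expr2; exact: cvgM.
apply/cvgrPdist_le => e e0; move/cvgrPdist_le : zv => /(_ e e0).
apply: filterS => n; rewrite sub0r normrN ger0_norm ?cabs_ge0// => h.
by rewrite distrC (le_trans (ler_dist_cabs _ _)).
Qed.

(** The sequence is shifted by [N], so that a bound valid only from some index on holds for all
    terms; the lower limit is then identified with [u] off a null set. *)
Lemma fatou_ae (u_ : nat -> R -> R) (u : R -> R) (b : \bar R) :
  (forall n, measurable_fun setT (u_ n)) -> measurable_fun setT u ->
  (forall n l, 0 <= u_ n l) -> {ae mu, forall l, u_ n l @[n --> \oo] --> u l} ->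
  (exists N, forall n, (N <= n)%N -> (\int[mu]_l (u_ n l)%:E <= b)%E) ->
  (\int[mu]_l (u l)%:E <= b)%E.
Proof.
move=> mu_ mu' u0 cu [N ub].
pose F n l := (u_ (n + N)%N l)%:E.
have mF n : measurable_fun setT (F n) by exact/measurable_EFinP.
have F0 n l : setT l -> (0 <= F n l)%E by move=> _; rewrite lee_fin.
have -> : (\int[mu]_l (u l)%:E = \int[mu]_l limn_einf (F ^~ l))%E.
  apply: ae_eq_integral => //; first exact/measurable_EFinP.
    (* The lower limit is measurable as the negative of an upper limit. *)
    rewrite (_ : (fun l => _) = (fun l => - limn_esup (fun n => - F n l))%E).
      apply: measurableT_comp => //; apply: measurable_fun_limn_esup => n.
      by apply: (measurableT_comp _ (mF n)); exact: oppe_measurable.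
    by apply/funext => l; rewrite limn_esupN oppeK.
  apply: aeS cu => l cl _; apply/esym.
  have : F ^~ l @ \oo --> (u l)%:E.
    by apply: cvg_EFin; [exact: nearW|rewrite -(cvg_shiftn N) in cl].
  by move/cvg_limn_einf_sup => [->].
apply: le_trans (fatou mu measurableT mF F0) _.
rewrite limn_einf_lim; apply: lime_le.
  by apply: is_cvg_einfs.
apply: nearW => n; apply: le_trans (ub (n + N)%N _); last exact: leq_addl.
by apply: ereal_inf_lbound; exists n => /=.
Qed.

Lemma normw2_fatou w (y_ : nat -> R -> C) y (b : \bar R) : weight w ->
  (forall n, measC setT (y_ n)) -> measC setT y ->
  {ae mu, forall l, w l = 0 \/ (fun n => cabs (y_ n l - y l)) @ \oo --> (0 : R)} ->
  (exists N, forall n, (N <= n)%N -> (normw2 w (y_ n) <= b)%E) ->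
  (normw2 w y <= b)%E.
Proof.
move=> ww my_ my cvy; apply: fatou_ae.
- by move=> n; apply/measurable_EFinP; exact: measurable_normw2.
- by apply/measurable_EFinP; exact: measurable_normw2.
- by move=> n l; exact: cabs2_ge0.
- apply: aeS cvy => l [wl|/cvg_cabs_sqr]; last exact.
  by rewrite wl mulr0; under eq_fun do rewrite mulr0; exact: cvg_cst.
Qed.

(** Multiplying the n-th term by 4^(n+1) leaves a convergent series, since 4/8 = 1/2, so the
    integrated sum is finite and the sum is finite almost everywhere. Each term being at most the
    sum [K], |d_n|^2 <= (K / w) 4^-n, and the square root is the geometric bound. *)
Lemma geometric_normw2_ae w (d : nat -> R -> C) : weight w ->
  (forall n, measC setT (d n)) ->
  (forall n, (normw2 w (d n) <= ((8^-1) ^+ n.+1)%:E)%E) ->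
  {ae mu, forall l, w l = 0 \/
     exists2 K, 0 <= K & forall n, cabs (d n l) <= K * (2^-1) ^+ n}.
Proof.
move=> ww md dn; have [mw w0] := ww.
pose F n l := ((4 ^+ n.+1 * (cabs (d n l) ^+ 2 * w l))%:E).
have mF n : measurable_fun setT (F n).
  rewrite /F; under eq_fun do rewrite EFinM; apply: measurable_funeM.
  exact: measurable_cabs2.
have F0 n l : (0 <= F n l)%E.
  by rewrite lee_fin mulr_ge0 ?exprn_ge0// cabs2_ge0.
have iF : (\int[mu]_l (\sum_(n <oo) F n l) < +oo)%E.
  rewrite integral_nneseries//.
  apply: (@le_lt_trans _ _ (\sum_(n <oo) (1 / (2 ^ (n + 1))%:R : R)%:E)%E).
    apply: lee_nneseries => [n _ _|n _]; first exact: integral_ge0.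
    rewrite /F; under eq_integral do rewrite EFinM.
    rewrite ge0_integralZl//=; last 2 first.
      - exact: measurable_normw2.
      - by move=> l _; rewrite lee_fin cabs2_ge0.
    apply: (@le_trans _ _ ((4 ^+ n.+1)%:E * ((8^-1) ^+ n.+1)%:E)%E).
      by rewrite lee_pmul2l ?lte_fin ?exprn_gt0//; exact: dn.
    rewrite -EFinM lee_fin -exprMn addn1 natrX div1r -exprVn lerXn2r ?nnegrE//; lra.
  have /cvg_lim -> // := @cvg_geometric_eseries_half R 1 0.
  by rewrite ltry.
have mS : measurable_fun setT (fun l => \sum_(n <oo) F n l)%E.
  by apply: ge0_emeasurable_sum => // n l _.
have S0 l : (0 <= \sum_(n <oo) F n l)%E by exact: nneseries_ge0.
have : mu.-integrable setT (fun l => \sum_(n <oo) F n l)%E.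
  apply/integrableP; split => //.
  by under eq_integral do rewrite gee0_abs//.
move=> /(integrable_ae measurableT); apply: aeS => l /(_ I).
rewrite ge0_fin_numE// => Sl.
have [wl0|wl0] := eqVneq (w l) 0; [by left|right].
have wl : 0 < w l by rewrite lt_neqAle eq_sym wl0 w0.
pose K := fine (\sum_(n <oo) F n l)%E.
have K0 : 0 <= K by exact: fine_ge0.
have FK n : 4 ^+ n.+1 * (cabs (d n l) ^+ 2 * w l) <= K.
  rewrite -lee_fin /K fineK ?ge0_fin_numE//.
  have h := @nneseries_lim_ge R (F ^~ l) xpredT 0%N n.+1 (fun n _ _ => F0 n l).
  apply: le_trans h; rewrite big_nat_recr//=.
  by rewrite leeDr// sume_ge0.
exists (Num.sqrt (K / w l)); first exact: sqrtr_ge0.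
move=> n; rewrite -ler_sqr ?nnegrE ?mulr_ge0 ?sqrtr_ge0 ?cabs_ge0 ?exprn_ge0//.
rewrite exprMn sqr_sqrtr ?divr_ge0// -exprM mulnC exprM.
rewrite mulrAC ler_pdivlMr//.
have -> : ((2^-1) ^+ 2 : R) = 4^-1 by lra.
rewrite exprVn ler_pdivlMr ?exprn_gt0// mulrC.
apply: le_trans (FK n); rewrite [4 ^+ n.+1]exprS ler_wpM2r ?cabs2_ge0//.
by rewrite ler_peMl ?exprn_ge0//; lra.
Qed.

Lemma geometric_cvg (u : nat -> R) (K : R) :
  (forall n, `|u n.+1 - u n| <= K * (2^-1) ^+ n) -> cvgn u.
Proof.
move=> uK.
have : cvgn (series (telescope u)).
  apply: normed_cvg; apply: (@series_le_cvg _ _ (geometric K (2^-1))).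
  - by move=> n; exact: normr_ge0.
  - by move=> n /=; apply: le_trans (uK n); exact: normr_ge0.
  - by move=> n; exact: uK.
  - by apply: is_cvg_geometric_series; rewrite ger0_norm//; lra.
move=> ct; rewrite (_ : u = (fun n => u 0%N + series (telescope u) n)).
  by apply: is_cvgD => //; exact: is_cvg_cst.
by apply/funext => n; rewrite -eq_sum_telescope.
Qed.

Lemma le_geometric_cvg0 (u : nat -> R) (K : R) : (forall n, 0 <= u n) ->
  (forall n, u n <= K * (2^-1) ^+ n) -> u @ \oo --> (0 : R).
Proof.
move=> u0 uK; apply: (@squeeze_cvgr _ _ _ _ (cst 0) (geometric K (2^-1))).
- by apply: nearW => n; rewrite u0 uK.
- exact: cvg_cst.
- by apply: cvg_geometric; rewrite ger0_norm//; lra.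
Qed.

(** The upper limit is measurable whether or not the sequence converges, so a limit function can be
    defined on the whole line and is correct wherever the limit exists. *)
Lemma measurable_limn (u : nat -> R -> R) : (forall n, measurable_fun setT (u n)) ->
  measurable_fun setT (fun l => fine (limn_esup (fun n => (u n l)%:E))).
Proof.
move=> mu_; apply: (measurableT_comp (fine_measurable measurableT)).
by apply: measurable_fun_limn_esup => n; exact/measurable_EFinP.
Qed.

Lemma limn_esup_cvg (u : nat -> R) : cvgn u ->
  u @ \oo --> fine (limn_esup (fun n => (u n)%:E)).
Proof.
move=> cu; have : (fun n => (u n)%:E) @ \oo --> (limn u)%:E.
  by apply: cvg_EFin; first exact: nearW.
by move/cvg_limn_einf_sup => [_ ->].
Qed.

(** Riesz-Fischer: a subsequence whose successive distances decrease geometrically converges almost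
    everywhere, and Fatou's lemma carries the Cauchy estimate over to its limit. *)
Lemma weighted_L2_complete w (x_ : nat -> R -> C) : weight w ->
  (forall n, measC setT (x_ n)) ->
  (forall e : R, 0 < e -> exists N, forall n m, (N <= n)%N -> (N <= m)%N ->
     (normw2 w (fun l => x_ n l - x_ m l)%R <= e%:E)%E) ->
  exists2 x, measC setT x & forall e : R, 0 < e ->
    exists N, forall n, (N <= n)%N -> (normw2 w (fun l => x_ n l - x l)%R <= e%:E)%E.
Proof.
move=> ww mx cx.
have /choice[N_ HN] (k : nat) : exists N, forall n m, (N <= n)%N -> (N <= m)%N ->
    (normw2 w (fun l => x_ n l - x_ m l)%R <= ((8^-1 : R) ^+ k.+1)%:E)%E.
  by apply: cx; rewrite exprn_gt0.
(* Partial sums of the thresholds are nondecreasing and dominate each threshold; the [k] added in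
   [z] makes the indices tend to infinity. *)
pose phi k := (\sum_(j < k.+1) N_ j)%N.
have phiS k : (phi k <= phi k.+1)%N by rewrite /phi [leqRHS]big_ord_recr/= leq_addr.
have Nphi k : (N_ k <= phi k)%N by rewrite /phi big_ord_recr/= leq_addl.
have phi_mono k : (k <= phi k + k)%N by exact: leq_addl.
pose z k := x_ (phi k + k)%N.
have mz k : measC setT (z k) by exact: mx.
pose d k l := z k.+1 l - z k l.
have md k : measC setT (d k) by exact: measCB.
have nd k : (normw2 w (d k) <= ((8^-1 : R) ^+ k.+1)%:E)%E.
  apply: HN.
    by rewrite (leq_trans (Nphi k))// (leq_trans (phiS k))// leq_addr.
  by rewrite (leq_trans (Nphi k))// leq_addr.
pose x l := fine (limn_esup (fun n => (complex.Re (z n l))%:E)) +i*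
            fine (limn_esup (fun n => (complex.Im (z n l))%:E)).
have mxx : measC setT x.
  by split => /=; apply: measurable_limn => n; have [] := mz n.
have ae_cvg : {ae mu, forall l, w l = 0 \/ (fun k => cabs (z k l - x l)) @ \oo --> (0 : R)}.
  apply: aeS (geometric_normw2_ae ww md nd) => l [|[K K0 dK]]; [by left|right].
  have cRe : cvgn (fun n => complex.Re (z n l)).
    apply: (@geometric_cvg _ K) => n; apply: le_trans (dK n).
    by rewrite (le_trans _ (Re_le_cabs _))// /d !ReImE.
  have cIm : cvgn (fun n => complex.Im (z n l)).
    apply: (@geometric_cvg _ K) => n; apply: le_trans (dK n).
    by rewrite (le_trans _ (Im_le_cabs _))// /d !ReImE.
  have lRe := limn_esup_cvg cRe; have lIm := limn_esup_cvg cIm.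
  apply: (@squeeze_cvgr _ _ _ _ (cst 0) (fun n =>
    `|complex.Re (z n l) - complex.Re (x l)| + `|complex.Im (z n l) - complex.Im (x l)|)).
  - by apply: nearW => n; rewrite cabs_ge0/= (le_trans (cabs_le_ReIm _))// !ReImE.
  - exact: cvg_cst.
  - rewrite -[X in _ --> X](addr0 0).
    by apply: cvgD; rewrite -(normr0 R); apply: cvg_norm; apply/subr_cvg0.
exists x => // e e0; have [N HNe] := cx _ e0; exists N => n Nn.
apply: (@normw2_fatou _ (fun k l => x_ n l - z k l)) => //.
- by move=> k; exact: measCB.
- exact: measCB.
- apply: aeS ae_cvg => l [|cl]; [by left|right].
  apply: cvg_trans cl; apply: near_eq_cvg; apply: nearW => k.
  by rewrite -cabsN; congr cabs; ring.
- exists N => k Nk; apply: HNe => //.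
  by rewrite (leq_trans Nk)// leq_addl.
Qed.

End WeightedL2.

(** * The Abel factor and its transform, the Poisson kernel *)

Section PoissonKernel.
Context {R : realType}.
Local Notation mu := (@lebesgue_measure R).
Local Notation C := R[i].
Implicit Types (x : R -> C) (y d s t : R).

Lemma FTC_segment (F f : R -> R) (a b : R) : a <= b -> continuous f ->
  (forall t : R, is_derive t (1 : R) F (f t)) ->
  (\int[mu]_(t in `[a, b]) (f t)%:E = (F b - F a)%:E)%E.
Proof.
rewrite le_eqVlt => /predU1P[->|ab] cf dF.
  by rewrite set_itv1 integral_set1 subrr.
have cF : continuous F.
  move=> t; apply/differentiable_continuous/derivable1_diffP.
  exact: (@ex_derive _ _ _ _ _ _ _ (dF t)).
rewrite (@continuous_FTC2 _ f F)// ?EFinB//.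
- exact: continuous_subspaceT.
- split.
  + by move=> t _; exact: (@ex_derive _ _ _ _ _ _ _ (dF t)).
  + by apply: cvg_at_right_filter; exact: cF.
  + by apply: cvg_at_left_filter; exact: cF.
- by move=> t _; rewrite derive1E; exact: (@derive_val _ _ _ _ _ _ _ (dF t)).
Qed.

(** The windows over which [is_fourierL2] takes its partial integrals. *)
Definition trunc (n : nat) : set R := `[- n%:R, n%:R]%classic.

Lemma trunc_nd : nondecreasing_seq trunc.
Proof.
move=> m n mn; apply/subsetPset => t; rewrite /trunc /= !in_itv/= => /andP[a b].
by rewrite (le_trans _ a) ?lerN2 ?ler_nat//= (le_trans b)// ler_nat.
Qed.

Lemma trunc_cover : \bigcup_n trunc n = setT.
Proof.
apply/seteqP; split => // t _; exists (Num.bound `|t|) => //.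
rewrite /trunc /= in_itv/= -ler_norml; exact: ltW (archi_boundP (normr_ge0 t)).
Qed.

Lemma ge0_integral_trunc_le (f : R -> \bar R) (b : \bar R) :
  measurable_fun setT f -> (forall t, 0 <= f t)%E ->
  (forall n, \int[mu]_(t in trunc n) f t <= b)%E -> (\int[mu]_t f t <= b)%E.
Proof.
move=> mf f0 fb.
have h : (\int[mu]_(t in trunc n) f t @[n --> \oo] --> \int[mu]_(t in \bigcup_n trunc n) f t)%E.
  apply: ge0_nondecreasing_set_cvg_integral => //.
  - exact: trunc_nd.
  - by move=> i; exact: measurable_itv.
  - by move=> i; exact: measurable_funTS.
rewrite trunc_cover in h; rewrite -(cvg_lim _ h)//.
by apply: lime_le; [exact: cvgP h|exact: nearW].
Qed.

Lemma near_trunc (t : R) : \forall n \near \oo, trunc n t.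
Proof.
have : (\bigcup_n trunc n) t by rewrite trunc_cover.
case=> N _ tN; exists N => // n /= Nn.
by have /subsetPset := trunc_nd Nn; exact.
Qed.

Lemma cvg_Rintegral_trunc (f : R -> R) : mu.-integrable setT (EFin \o f) ->
  \int[mu]_(t in trunc n) f t @[n --> \oo] --> \int[mu]_t f t.
Proof.
move=> fi; have /measurable_int mf := fi.
have mfn n : measurable_fun setT ((EFin \o f) \_ (trunc n)).
  apply/(measurable_restrictT _ (measurable_itv _)).
  by apply: (measurable_funS _ _ mf).
have cv : {ae mu, forall t, setT t ->
    ((EFin \o f) \_ (trunc n)) t @[n --> \oo] --> (EFin \o f) t}.
  apply: aeT => t _; apply: cvg_near_cst; apply: filterS (near_trunc t) => n tn.
  by rewrite patchE mem_set.
have dom : {ae mu, forall t n, setT t ->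
    (`|((EFin \o f) \_ (trunc n)) t| <= (abse \o (EFin \o f)) t)%E}.
  apply: aeT => t n _; rewrite patchE; case: ifP => // _.
  by rewrite abse0; exact: abse_ge0.
have [_ _ h] := @dominated_convergence _ _ _ mu setT measurableT
  (fun n => (EFin \o f) \_ (trunc n)) (EFin \o f) (abse \o (EFin \o f))
  mfn mf cv (integrable_abse fi) dom.
rewrite /Rintegral; apply: fine_cvg; rewrite fineK; last exact: integrable_fin_num.
by under eq_fun do rewrite integral_mkcond.
Qed.

Lemma is_derive_lin (c t : R) : is_derive t (1 : R) (fun t => c * t) c.
Proof. by apply: is_derive_eq; rewrite [_ *: _]mulr1. Qed.

(** [dexp] and [dexps] are y^2 + d^2 times the elementary antiderivatives of e^{-y t} cos(d t) and
    e^{-y t} sin(d t). *)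
Definition dexp y d t := expR (- y * t) * (d * sin (d * t) - y * cos (d * t)).
Definition dexps y d t := - expR (- y * t) * (y * sin (d * t) + d * cos (d * t)).

Lemma is_derive_dexp y d t : is_derive t (1 : R) (dexp y d)
  ((y ^+ 2 + d ^+ 2) * (expR (- y * t) * cos (d * t))).
Proof.
have h1 := is_derive_lin (- y) t; have h2 := is_derive_lin d t.
have h3 := @is_derive1_comp _ expR (fun t => - y * t) t _ _ (is_derive_expR _) h1.
have h4 := @is_derive1_comp _ sin (fun t => d * t) t _ _ (is_derive_sin _) h2.
have h5 := @is_derive1_comp _ cos (fun t => d * t) t _ _ (is_derive_cos _) h2.
have h6 := is_deriveM h3 (is_deriveB (is_deriveZ d h4) (is_deriveZ y h5)).
by apply: (is_derive_eq h6); rewrite !fctE /= /GRing.scale /=; ring.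
Qed.

Lemma is_derive_dexps y d t : is_derive t (1 : R) (dexps y d)
  ((y ^+ 2 + d ^+ 2) * (expR (- y * t) * sin (d * t))).
Proof.
have h1 := is_derive_lin (- y) t; have h2 := is_derive_lin d t.
have h3 := @is_derive1_comp _ expR (fun t => - y * t) t _ _ (is_derive_expR _) h1.
have h4 := @is_derive1_comp _ sin (fun t => d * t) t _ _ (is_derive_sin _) h2.
have h5 := @is_derive1_comp _ cos (fun t => d * t) t _ _ (is_derive_cos _) h2.
have h6 := is_deriveM (is_deriveN h3) (is_deriveD (is_deriveZ y h4) (is_deriveZ d h5)).
by apply: (is_derive_eq h6); rewrite !fctE /= /GRing.scale /=; ring.
Qed.

Lemma continuous_expR_lin (c : R) : continuous (fun t => expR (c * t)).
Proof.
move=> t; apply: (@continuous_comp _ _ _ (fun t => c * t) expR).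
  exact: mulrl_continuous.
exact: continuous_expR.
Qed.

Lemma integral_expR_trig y d a b : a <= b -> 0 < y ^+ 2 + d ^+ 2 ->
  \int[mu]_(t in `[a, b]) (expR (- y * t) * cos (d * t)) =
    (dexp y d b - dexp y d a) / (y ^+ 2 + d ^+ 2) /\
  \int[mu]_(t in `[a, b]) (expR (- y * t) * sin (d * t)) =
    (dexps y d b - dexps y d a) / (y ^+ 2 + d ^+ 2).
Proof.
move=> ab yd; pose c := (y ^+ 2 + d ^+ 2)^-1.
have cc : c * (y ^+ 2 + d ^+ 2) = 1 by rewrite mulVf// gt_eqF.
have cM (u v : R -> R) : continuous u -> continuous v -> continuous (fun t => u t * v t).
  by move=> cu cv t; apply: cvgM; [exact: cu|exact: cv].
have cE := continuous_expR_lin (c := - y).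
split.
  have D t : is_derive t (1 : R) (fun t => c * dexp y d t) (expR (- y * t) * cos (d * t)).
    apply: (is_derive_eq (is_deriveZ c (is_derive_dexp y d t))).
    by rewrite /GRing.scale/= -[RHS]mul1r -cc; ring.
  rewrite /Rintegral (FTC_segment ab (cM _ _ (@cE) (continuous_cos_lin (s := d))) D)/=.
  by rewrite -mulrBr mulrC.
have D t : is_derive t (1 : R) (fun t => c * dexps y d t) (expR (- y * t) * sin (d * t)).
  apply: (is_derive_eq (is_deriveZ c (is_derive_dexps y d t))).
  by rewrite /GRing.scale/= -[RHS]mul1r -cc; ring.
rewrite /Rintegral (FTC_segment ab (cM _ _ (@cE) (continuous_sin_lin (s := d))) D)/=.
by rewrite -mulrBr mulrC.
Qed.

Definition decay y t := expR (- y * `|t|).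

Lemma continuous_decay y : continuous (decay y).
Proof.
move=> t; apply: (@continuous_comp _ _ _ (fun t : R => `|t|) (fun r => expR (- y * r))).
  exact: norm_continuous.
exact: continuous_expR_lin.
Qed.

Lemma decay_gt0 y t : 0 < decay y t.
Proof. exact: expR_gt0. Qed.

Lemma decay_le1 y t : 0 <= y -> decay y t <= 1.
Proof. by move=> y0; rewrite /decay -expR0 ler_expR mulNr oppr_le0 mulr_ge0. Qed.

Lemma measurable_decay y : measurable_fun setT (decay y).
Proof. by apply: continuous_measurable_fun; exact: continuous_decay. Qed.

Lemma measurable_trunc n : measurable (trunc n).
Proof. exact: measurable_itv. Qed.

Lemma integrable_trunc (f : R -> R) n : continuous f ->
  mu.-integrable (trunc n) (EFin \o f).
Proof.
move=> cf; apply: continuous_compact_integrable; first exact: segment_compact.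
exact: continuous_subspaceT.
Qed.

Lemma Rintegral_trunc_split (f g h : R -> R) n : continuous f ->
  (forall t, 0 <= t -> f t = g t) -> (forall t, t <= 0 -> f t = h t) ->
  \int[mu]_(t in trunc n) f t =
  \int[mu]_(t in `[- n%:R, 0]) h t + \int[mu]_(t in `[0, n%:R]) g t.
Proof.
move=> cf fg fh.
have fi := integrable_trunc n cf.
have := @Rintegral_itvB _ f (BLeft (- n%:R)) (BRight n%:R) 0 fi.
rewrite !bnd_simp oppr_le0 !ler0n => /(_ isT isT) E.
rewrite -[LHS](subrK (\int[mu]_(t in `[- n%:R, 0]) f t)) E addrC.
rewrite Rintegral_itv_obnd_cbnd; last first.
  apply: integrableS fi => //; first exact: measurable_itv.
  by apply: subset_itv; rewrite /= ?bnd_simp ?oppr_le0 ?ler0n.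
congr (_ + _); apply: eq_Rintegral => t; rewrite inE/= in_itv/= => /andP[a b].
  by rewrite fh.
by rewrite fg.
Qed.

(** On the negative half-line |t| = - t replaces y by - y in the antiderivative. The term 2 y
    collects the two boundary values at 0; for the sine these cancel. *)
Lemma integral_decay_trunc y d n : 0 < y ->
  \int[mu]_(t in trunc n) (decay y t * cos (d * t)) =
    (2 * y + dexp y d n%:R - dexp (- y) d (- n%:R)) / (y ^+ 2 + d ^+ 2) /\
  \int[mu]_(t in trunc n) (decay y t * sin (d * t)) =
    (dexps y d n%:R - dexps (- y) d (- n%:R)) / (y ^+ 2 + d ^+ 2).
Proof.
move=> y0.
have yd : 0 < y ^+ 2 + d ^+ 2 by rewrite ltr_pwDl ?exprn_gt0// sqr_ge0.
have cM (u v : R -> R) : continuous u -> continuous v -> continuous (fun t => u t * v t).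
  by move=> cu cv t; apply: cvgM; [exact: cu|exact: cv].
have n0 : - n%:R <= 0 :> R by rewrite oppr_le0.
have n1 : 0 <= n%:R :> R by [].
have [c1 s1] := integral_expR_trig n1 yd.
have yd' : 0 < (- y) ^+ 2 + d ^+ 2 by rewrite sqrrN.
have [c2 s2] := integral_expR_trig n0 yd'.
rewrite sqrrN in c2 s2; split.
- rewrite (@Rintegral_trunc_split _ (fun t => expR (- y * t) * cos (d * t))
    (fun t => expR (- - y * t) * cos (d * t))).
  + rewrite c1 c2 -mulrDl; congr (_ / _).
    by rewrite /dexp !mulr0 expR0 sin0 cos0; ring.
  + by apply: cM; [exact: continuous_decay|exact: continuous_cos_lin].
  + by move=> t t0; rewrite /decay ger0_norm.
  + by move=> t t0; rewrite /decay ler0_norm// mulrNN opprK.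
- rewrite (@Rintegral_trunc_split _ (fun t => expR (- y * t) * sin (d * t))
    (fun t => expR (- - y * t) * sin (d * t))).
  + rewrite s1 s2 -mulrDl; congr (_ / _).
    by rewrite /dexps !mulr0 expR0 sin0 cos0; ring.
  + by apply: cM; [exact: continuous_decay|exact: continuous_sin_lin].
  + by move=> t t0; rewrite /decay ger0_norm.
  + by move=> t t0; rewrite /decay ler0_norm// mulrNN opprK.
Qed.

Lemma integrable_decay y : 0 < y -> mu.-integrable setT (EFin \o decay y).
Proof.
move=> y0; apply/integrableP; split; first by apply/measurable_EFinP; exact: measurable_decay.
apply: (@le_lt_trans _ _ (2 / y)%:E); last exact: ltry.
under eq_integral do rewrite /= ger0_norm ?ltW ?decay_gt0//.
apply: ge0_integral_trunc_le.
- by apply/measurable_EFinP; exact: measurable_decay.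
- by move=> t; rewrite lee_fin ltW// decay_gt0.
- move=> n; have fi := integrable_trunc n (@continuous_decay y).
  have [E _] := integral_decay_trunc 0 n y0.
  have -> : (\int[mu]_(t in trunc n) (decay y t)%:E)%E =
      (\int[mu]_(t in trunc n) decay y t)%:E.
    by apply: EFin_Rintegral => //; exact: measurable_trunc.
  have -> : \int[mu]_(t in trunc n) decay y t =
      \int[mu]_(t in trunc n) (decay y t * cos (0 * t)).
    by apply: eq_Rintegral => t _; rewrite mul0r cos0 mulr1.
  (* At frequency 0 the boundary terms at the ends of the window are nonpositive, which leaves 2 y /
     y^2. *)
  rewrite E lee_fin expr0n addr0 ler_pdivrMr ?exprn_gt0//.
  rewrite expr2 mulrA divfK ?gt_eqF// /dexp !mul0r cos0.
  have h1 : 0 <= expR (- y * n%:R) * y by rewrite mulr_ge0 ?expR_ge0// ltW.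
  have h2 : 0 <= expR (- - y * - n%:R) * y by rewrite mulr_ge0 ?expR_ge0// ltW.
  lra.
Qed.

Lemma cvg_expR_nat y : 0 < y -> expR (- y * n%:R) @[n --> \oo] --> (0 : R).
Proof.
move=> y0; rewrite (_ : (fun n => _) = (fun n => (expR (- y)) ^+ n)).
  apply: cvg_expr; rewrite ger0_norm ?expR_ge0//.
  by rewrite -expR0 ltr_expR oppr_lt0.
by apply/funext => n; rewrite -expRM_natl mulrC.
Qed.

(** 2 pi times the Poisson kernel of the half-plane at height y. *)
Definition poisson y d := 2 * y / (y ^+ 2 + d ^+ 2).

Lemma norm_dexp_le y d t : `|dexp y d t| <= expR (- y * t) * (`|d| + `|y|) /\
  `|dexps y d t| <= expR (- y * t) * (`|d| + `|y|).
Proof.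
have s1 : `|sin (d * t)| <= 1 by rewrite ler_norml sin_geN1 sin_le1.
have c1 : `|cos (d * t)| <= 1 by rewrite ler_norml cos_geN1 cos_le1.
have b (u v : R) : `|v| <= 1 -> `|u * v| <= `|u|.
  by move=> v1; rewrite normrM ler_piMr.
split; rewrite /dexp /dexps normrM ?normrN (ger0_norm (expR_ge0 _)) ler_wpM2l ?expR_ge0//.
  by rewrite (le_trans (ler_normB _ _))// lerD// b.
by rewrite (le_trans (ler_normD _ _))// addrC lerD// b.
Qed.

(** The boundary terms of the truncated integrals die out exponentially. The condition [s ^+ 2 = 1]
    says that [s] is 1 or -1, so that the transform and its inverse share their lemmas; here only (s
    d)^2 enters. *)
Lemma fourierL1_decay s y d : 0 < y -> s ^+ 2 = 1 ->
  fourierL1 s setT (fun t => (decay y t)%:C) d = (poisson y d)%:C.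
Proof.
move=> y0 s1.
pose e := s * d.
have ed : e ^+ 2 = d ^+ 2 by rewrite exprMn s1 mul1r.
have std t : s * t * d = e * t by rewrite /e; ring.
have cM (u v : R -> R) : continuous u -> continuous v -> continuous (fun t => u t * v t).
  by move=> cu cv t; apply: cvgM; [exact: cu|exact: cv].
have intb (g : R -> R) : continuous g -> (forall t, `|g t| <= 1) ->
    mu.-integrable setT (EFin \o (fun t => decay y t * g t)).
  move=> cg g1; apply: (@le_integrable _ _ _ mu setT measurableT _ _ _ _ (integrable_decay y0)).
    apply/measurable_EFinP; apply: continuous_measurable_fun.
    by apply: cM => //; exact: continuous_decay.
  move=> t _; rewrite /= lee_fin normrM ler_piMr//.
have cle1 t : `|cos (e * t)| <= 1 by rewrite ler_norml cos_geN1 cos_le1.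
have sle1 t : `|sin (e * t)| <= 1 by rewrite ler_norml sin_geN1 sin_le1.
have i1 := intb _ (continuous_cos_lin (s := e)) cle1.
have i2 := intb _ (continuous_sin_lin (s := e)) sle1.
have h1 := cvg_Rintegral_trunc i1.
have h2 := cvg_Rintegral_trunc i2.
have z (u : nat -> R) : (forall n, `|u n| <= expR (- y * n%:R) * (`|e| + `|y|)) ->
    u @ \oo --> (0 : R).
  move=> ub; apply: norm_cvg0.
  apply: (@squeeze_cvgr _ _ _ _ (cst 0) (fun n => expR (- y * n%:R) * (`|e| + `|y|))).
  - by apply: nearW => n; rewrite normr_ge0 ub.
  - exact: cvg_cst.
  - rewrite -[X in _ --> X](mul0r (`|e| + `|y|)); apply: cvgM; last exact: cvg_cst.
    exact: cvg_expR_nat.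
have z1 : dexp y e n%:R @[n --> \oo] --> (0 : R).
  by apply: z => n; have [] := norm_dexp_le y e n%:R.
have z2 : dexps y e n%:R @[n --> \oo] --> (0 : R).
  by apply: z => n; have [] := norm_dexp_le y e n%:R.
have z3 : dexp (- y) e (- n%:R) @[n --> \oo] --> (0 : R).
  by apply: z => n; have [] := norm_dexp_le (- y) e (- n%:R); rewrite normrN opprK mulrN mulNr.
have z4 : dexps (- y) e (- n%:R) @[n --> \oo] --> (0 : R).
  by apply: z => n; have [_] := norm_dexp_le (- y) e (- n%:R); rewrite normrN opprK mulrN mulNr.
apply: complex_ext.
- rewrite /= (_ : Rintegral _ _ _ = \int[mu]_t (decay y t * cos (e * t))); last first.
    by apply: eq_Rintegral => t _ /=; rewrite std mul0r subr0.
  rewrite -(cvg_lim _ h1)//; apply: cvg_lim => //.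
  under eq_fun do rewrite (integral_decay_trunc e _ y0).1.
  rewrite /poisson ed; apply: cvgM; last exact: cvg_cst.
  rewrite -[X in _ --> X]subr0 -[X in _ --> X - _]addr0.
  by apply: cvgB => //; apply: cvgD => //; exact: cvg_cst.
- rewrite /= (_ : Rintegral _ _ _ = \int[mu]_t (decay y t * sin (e * t))); last first.
    by apply: eq_Rintegral => t _ /=; rewrite std mul0r addr0.
  rewrite -(cvg_lim _ h2)//; apply: cvg_lim => //.
  under eq_fun do rewrite (integral_decay_trunc e _ y0).2.
  have H : (dexps y e n%:R - dexps (- y) e (- n%:R)) / (y ^+ 2 + e ^+ 2) @[n --> \oo]
      --> (0 - 0) / (y ^+ 2 + e ^+ 2).
    by apply: cvgM; [exact: cvgB|exact: cvg_cst].
  by rewrite subrr mul0r in H; exact: H.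
Qed.

Lemma poisson_ge0 y d : 0 < y -> 0 <= poisson y d.
Proof. by move=> y0; rewrite divr_ge0 ?mulr_ge0 ?addr_ge0 ?sqr_ge0// ltW. Qed.

Lemma is_derive_atan_lin y (v t : R) : 0 < y ->
  is_derive t (1 : R) (fun t => 2 * atan (y^-1 * (t - v))) (poisson y (t - v)).
Proof.
move=> y0.
have h1 : is_derive t (1 : R) (fun t => y^-1 * (t - v)) y^-1.
  by apply: is_derive_eq; rewrite /GRing.scale/= subr0 mulr1.
have h2 := @is_derive1_comp _ atan (fun t => y^-1 * (t - v)) t _ _ (is_derive1_atan _) h1.
apply: (is_derive_eq (is_deriveZ 2 h2)).
rewrite /GRing.scale/= /poisson; field.
by rewrite !gt_eqF ?ltr_pwDl ?exprn_gt0 ?sqr_ge0.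
Qed.

Lemma poissonN y d : poisson y (- d) = poisson y d.
Proof. by rewrite /poisson sqrrN. Qed.

Lemma continuous_poisson y (v : R) : 0 < y -> continuous (fun t => poisson y (t - v)).
Proof.
move=> y0 t; apply: cvgM; first exact: cvg_cst.
apply: cvgV; first by rewrite gt_eqF// ltr_pwDl ?exprn_gt0 ?sqr_ge0.
apply: cvgD; first exact: cvg_cst.
by rewrite expr2; apply: cvgM; apply: cvgB => //; exact: cvg_cst.
Qed.

Lemma integral_poisson_segment y (v a b : R) : 0 < y -> a <= b ->
  (\int[mu]_(t in `[a, b]) (poisson y (t - v))%:E =
   (2 * atan (y^-1 * (b - v)) - 2 * atan (y^-1 * (a - v)))%:E)%E.
Proof.
move=> y0 ab; apply: (@FTC_segment (fun t => 2 * atan (y^-1 * (t - v)))) => //.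
  exact: continuous_poisson.
by move=> t; exact: is_derive_atan_lin.
Qed.

Lemma measurable_poisson y (v : R) : 0 < y ->
  measurable_fun setT (fun t => poisson y (t - v)).
Proof. by move=> y0; apply: continuous_measurable_fun; exact: continuous_poisson. Qed.

Lemma integral_poisson_le y (v : R) : 0 < y ->
  (\int[mu]_t (poisson y (t - v))%:E <= (2 * pi)%:E)%E.
Proof.
move=> y0; apply: ge0_integral_trunc_le.
- by apply/measurable_EFinP; exact: measurable_poisson.
- by move=> t; rewrite lee_fin poisson_ge0.
- move=> n; rewrite integral_poisson_segment//; last first.
    by rewrite (@le_trans _ _ 0)// oppr_le0.
  rewrite lee_fin; have := atan_ltpi2 (y^-1 * (n%:R - v)).
  have := atan_gtNpi2 (y^-1 * (- n%:R - v)); lra.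
Qed.

End PoissonKernel.

(** * Schur's test for the Poisson kernel *)

Section SchurTest.
Context {R : realType}.
Local Notation mu := (@lebesgue_measure R).
Local Notation C := R[i].
Implicit Types (x : R -> C) (y s : R).

Lemma measC_decay y : measC setT (fun t => (decay y t)%:C : C).
Proof. by apply: measC_real; exact: measurable_decay. Qed.

Lemma cabs_decay y t : cabs (decay y t)%:C = decay y t.
Proof. by rewrite cabs_real ger0_norm// ltW// decay_gt0. Qed.

Lemma integrableC_decay y : 0 < y -> integrableC setT (fun t => (decay y t)%:C : C).
Proof.
move=> y0; apply: (integrableC_le _ _ (integrable_decay y0)) => //.
  exact: measC_decay.
by move=> t _; rewrite cabs_decay.
Qed.

(** Modulation translates the transform, which centres the Poisson kernel at [u]. *)
Lemma fourierL1_modulated_decay s y (u v : R) : 0 < y -> s ^+ 2 = 1 ->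
  fourierL1 (- s) setT (fun t => (decay y t)%:C * cexpi (s * u * t)) v =
  (poisson y (u - v))%:C.
Proof.
move=> y0 s1; rewrite -(fourierL1_decay (u - v) y0 s1) /fourierL1.
apply: eq_integralC => t _; rewrite -mulrA -cexpiD; congr (_ * cexpi _); ring.
Qed.

(* Inserting the weight [exp (- y |l|)], whose transform is the positive Poisson
   kernel of total mass [2 pi], turns [|F x|^2] into a double integral that Schur's
   test bounds by [2 pi |x|^2]. *)
Lemma integral_poisson_schur x y : 0 < y -> measC setT x ->
  (\int[mu]_u \int[mu]_v (cabs (x u) * cabs (x v) * poisson y (u - v))%:E <=
   (2 * pi)%:E * normw2 (fun=> 1%R) x)%E.
Proof.
move=> y0 mx.
have mc := measurable_cabs mx.
have mpy : measurable_fun setT (poisson y).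
  by have := measurable_poisson 0 y0; under eq_fun do rewrite subr0.
have mp : measurable_fun setT (fun z : R * R => poisson y (z.1 - z.2)).
  apply: (measurableT_comp mpy); apply: measurable_funB.
    exact: measurable_fst.
  exact: measurable_snd.
have mc1 : measurable_fun setT (fun z : R * R => cabs (x z.1)).
  exact: (measurableT_comp mc measurable_fst).
have mc2 : measurable_fun setT (fun z : R * R => cabs (x z.2)).
  exact: (measurableT_comp mc measurable_snd).
have p0 d : 0 <= poisson y d by exact: poisson_ge0.
pose G1 (z : R * R) := (cabs (x z.1) ^+ 2 * poisson y (z.1 - z.2))%:E.
pose G2 (z : R * R) := (cabs (x z.2) ^+ 2 * poisson y (z.1 - z.2))%:E.
have mG1 : measurable_fun setT G1.
  by apply/measurable_EFinP; apply: measurable_funM => //; exact: measurable_funX.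
have mG2 : measurable_fun setT G2.
  by apply/measurable_EFinP; apply: measurable_funM => //; exact: measurable_funX.
have G10 z : (0 <= G1 z)%E by rewrite lee_fin mulr_ge0// exprn_ge0// cabs_ge0.
have G20 z : (0 <= G2 z)%E by rewrite lee_fin mulr_ge0// exprn_ge0// cabs_ge0.
pose N := normw2 (fun=> 1) x.
have N0 : (0 <= N)%E by exact: normw2_ge0 weight1.
(* Integrating the kernel first, over the variable absent from the square, costs a factor of at most
   2 pi. *)
have half (q : R -> R -> \bar R) : (forall u, measurable_fun setT (q u)) ->
    (forall u v, q u v = (cabs (x u) ^+ 2 * poisson y (v - u))%:E) ->
    (\int[mu]_u \int[mu]_v q u v <= (2 * pi)%:E * N)%E.
  move=> mq qE; rewrite /N normw2_1 -ge0_integralZl//; first last.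
  - by rewrite lee_fin mulr_ge0// pi_ge0.
  - by move=> u _; rewrite lee_fin exprn_ge0// cabs_ge0.
  - by apply/measurable_EFinP; exact: measurable_funX.
  have E : (fun u => \int[mu]_v q u v)%E =
      (fun u => (cabs (x u) ^+ 2)%:E * \int[mu]_v (poisson y (v - u))%:E)%E.
    apply/funext => u; rewrite -ge0_integralZl//.
    - by apply: eq_integral => v _; rewrite qE EFinM.
    - by apply/measurable_EFinP; exact: measurable_poisson.
    - by move=> v _; rewrite lee_fin.
    - by rewrite lee_fin exprn_ge0// cabs_ge0.
  apply: ge0_le_integral => //.
  - by move=> u _; apply: integral_ge0 => v _; rewrite qE lee_fin mulr_ge0// exprn_ge0// cabs_ge0.
  - have := @measurable_fun_fubini_tonelli_F _ _ _ _ _ mu G1 mG1 G10.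
    congr (measurable_fun _ _); apply/funext => u; apply: eq_integral => v _.
    by rewrite qE /G1 -opprB poissonN.
  - apply: measurable_funeM; apply/measurable_EFinP; exact: measurable_funX.
  - move=> u _; have /(congr1 (fun F => F u)) /= -> := E.
    by rewrite muleC lee_wpmul2r ?lee_fin ?exprn_ge0 ?cabs_ge0//; exact: integral_poisson_le.
have I1 : (\int[mu \x mu]_z G1 z <= (2 * pi)%:E * N)%E.
  rewrite (@fubini_tonelli1 _ _ _ _ _ mu mu G1)//; apply: half.
    by move=> u; apply: (measurableT_comp mG1 (pair1_measurable u)).
  by move=> u v; rewrite /fubini_F /G1 -opprB poissonN.
have I2 : (\int[mu \x mu]_z G2 z <= (2 * pi)%:E * N)%E.
  rewrite (@fubini_tonelli2 _ _ _ _ _ mu mu G2)//; apply: half.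
    by move=> u; apply: (measurableT_comp mG2 (pair2_measurable u)).
  by move=> u v; rewrite /G2.
pose H (z : R * R) := (cabs (x z.1) * cabs (x z.2) * poisson y (z.1 - z.2))%:E.
have mH : measurable_fun setT H.
  by apply/measurable_EFinP; apply: measurable_funM => //; exact: measurable_funM.
have H0 z : (0 <= H z)%E by rewrite lee_fin; apply: mulr_ge0 => //; rewrite mulr_ge0 ?cabs_ge0.
have -> : (\int[mu]_u \int[mu]_v (cabs (x u) * cabs (x v) * poisson y (u - v))%:E =
   \int[mu \x mu]_z H z)%E by rewrite (@fubini_tonelli1 _ _ _ _ _ mu mu H).
(* By a b <= (a^2 + b^2) / 2 the product of moduli splits into two squares, each paired with the
   kernel. *)
apply: (@le_trans _ _ (\int[mu \x mu]_z (2^-1%:E * (G1 z + G2 z)))%E).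
  apply: ge0_le_integral => //.
  - by apply: measurable_funeM; exact: emeasurable_funD.
  - move=> z _; rewrite -EFinD -EFinM lee_fin -mulrDl mulrA ler_wpM2r//.
    by have := sqr_ge0 (cabs (x z.1) - cabs (x z.2)); rewrite sqrrB; lra.
rewrite ge0_integralZl//=; last 2 first.
- exact: emeasurable_funD.
- by move=> z _; rewrite adde_ge0.
rewrite ge0_integralD//; apply: (@le_trans _ _ (2^-1%:E * (2%:E * ((2 * pi)%:E * N)))%E).
  rewrite lee_pmul2l//; apply: le_trans (leeD I1 I2) _.
  by rewrite -[(2%:E)%E]/((1 + 1)%:E)%E EFinD ge0_muleDl// !mul1e.
by rewrite muleA -EFinM mulVf// mul1e.
Qed.

End SchurTest.

(** * The inequality half of Plancherel's theorem *)

Section BesselInequality.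
Context {R : realType}.
Local Notation mu := (@lebesgue_measure R).
Local Notation C := R[i].
Implicit Types (x : R -> C) (y s t : R).

(** The parameter is halved because the square of this factor is then the factor of parameter
    1/(n+1), the form in which it enters a square norm. *)
Lemma cvg_decay t : decay (n.+1%:R^-1 / 2) t @[n --> \oo] --> (1 : R).
Proof.
have h : - (n.+1%:R^-1 / 2) * `|t| @[n --> \oo] --> - (0 / 2) * `|t|.
  apply: cvgM; last exact: cvg_cst.
  by apply: cvgN; apply: cvgM; [exact: cvg_harmonic|exact: cvg_cst].
have := cvg_comp _ _ h (@continuous_expR R (- (0 / 2) * `|t|)).
by rewrite mul0r oppr0 mul0r expR0.
Qed.

(** The Abel means of the inversion integral are Poisson integrals: the multiplication formula moves
    the transform from [x] to the modulated Abel factor. *)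
Lemma abel_fourierL1 s y x t : 0 < y -> s ^+ 2 = 1 -> integrableC setT x ->
  fourierL1 (- s) setT (fun l => (decay y l)%:C * fourierL1 s setT x l) t =
  integralC setT (fun v => x v * (poisson y (t - v))%:C).
Proof.
move=> y0 s1 ix.
have iK : integrableC setT (fun l => (decay y l)%:C * cexpi (- s * t * l)).
  apply: (@integrableCMb _ _ _ _ 1) => //; first exact: integrableC_decay.
    exact: measC_cexpil.
  by move=> l _; rewrite cabs_cexpi.
transitivity (integralC setT
    (fun l => fourierL1 s setT x l * ((decay y l)%:C * cexpi (- s * t * l)))).
  by apply: eq_integralC => l _; rewrite -!mulrA mulrCA; congr (_ * (_ * cexpi _)); ring.
rewrite fourierL1_mult//; apply: eq_integralC => v _; congr (_ * _).
have := @fourierL1_modulated_decay R (- s) y t v y0.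
by rewrite sqrrN opprK; exact.
Qed.

(** With the Abel weight inserted, the multiplication formula writes the integral of |x^|^2 as a
    pairing of [x] with a Poisson integral of its conjugate. Schur's test bounds this independently
    of y, and Fatou's lemma removes the weight. The right side may be infinite. *)
Lemma bessel_fourierL1 s x : s ^+ 2 = 1 -> integrableC setT x ->
  (normw2 (fun=> 1%R) (fourierL1 s setT x) <= (2 * pi)%:E * normw2 (fun=> 1%R) x)%E.
Proof.
move=> s1 ix; have mx := integrableC_measC ix.
set F := fourierL1 s setT x.
have mF : measC setT F by exact: measC_fourierL1.
have [M FM] := fourierL1_bounded s ix.
have weighted y : 0 < y ->
    (\int[mu]_l (decay y l * cabs (F l) ^+ 2)%:E <= (2 * pi)%:E * normw2 (fun=> 1%R) x)%E.
  move=> y0; pose ph l := (decay y l)%:C * fourierL1 (- s) setT (fun v => conjc (x v)) l.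
  have FJ l : fourierL1 (- s) setT (fun v => conjc (x v)) l = conjc (F l).
    by rewrite /F fourierL1J.
  have iph : integrableC setT ph.
    apply: (@integrableCMb _ _ _ _ M) => //; first exact: integrableC_decay.
      by apply: measC_fourierL1; exact: integrableCJ.
    by move=> l _; rewrite FJ cabsJ.
  have iFF : integrableC setT (fun l => F l * ph l).
    under eq_fun do rewrite mulrC.
    by apply: (@integrableCMb _ _ _ _ M).
  have E l : complex.Re (F l * ph l) = decay y l * cabs (F l) ^+ 2.
    by rewrite /ph FJ mulrCA mulJ_cabs -rmorphM.
  have -> : (\int[mu]_l (decay y l * cabs (F l) ^+ 2)%:E =
      (complex.Re (integralC setT (fun l => F l * ph l)))%:E)%E.
    rewrite /= -EFin_Rintegral//; last by case: iFF.
    by apply: eq_integral => l _; rewrite -E.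
  apply: le_trans (integral_poisson_schur y0 mx).
  apply: (@le_trans _ _ (cabs (integralC setT (fun l => F l * ph l)))%:E).
    by rewrite lee_fin (le_trans (ler_norm _))// Re_le_cabs.
  rewrite fourierL1_mult//.
  have [Mp phM] := fourierL1_bounded s iph.
  have ixp : integrableC setT (fun u => x u * fourierL1 s setT ph u).
    by apply: (@integrableCMb _ _ _ _ Mp) => //; exact: measC_fourierL1.
  apply: le_trans (cabs_integralC measurableT ixp) _.
  have mpy : measurable_fun setT (@poisson R y).
    by have := measurable_poisson 0 y0; under eq_fun do rewrite subr0.
  have mp (u : R) : measurable_fun setT (fun v : R => poisson y (u - v)).
    by apply: (measurableT_comp mpy); exact: measurable_funB.
  have pb d : cabs (poisson y d)%:C <= 2 / y.
    rewrite cabs_real ger0_norm ?poisson_ge0// /poisson ler_pdivrMr ?ltr_pwDl ?exprn_gt0 ?sqr_ge0//.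
    rewrite mulrDr expr2 mulrA divfK ?gt_eqF// lerDl mulr_ge0 ?sqr_ge0// divr_ge0 // ltW//.
  apply: ge0_le_integral => //.
  - by move=> u _; rewrite lee_fin cabs_ge0.
  - by apply: measurable_cabsE; apply: measCM => //; exact: measC_fourierL1.
  - have mc := measurable_cabs mx.
    apply: (@measurable_fun_fubini_tonelli_F _ _ _ _ _ mu
      (fun z => (cabs (x z.1) * cabs (x z.2) * poisson y (z.1 - z.2))%:E)).
      apply/measurable_EFinP; apply: measurable_funM.
        apply: measurable_funM; first exact: (measurableT_comp mc measurable_fst).
        exact: (measurableT_comp mc measurable_snd).
      apply: (measurableT_comp mpy); apply: measurable_funB.
        exact: measurable_fst.
      exact: measurable_snd.
    move=> z; rewrite lee_fin; apply: mulr_ge0; first by rewrite mulr_ge0 ?cabs_ge0.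
    exact: poisson_ge0.
  - move=> u _.
    have ixJ := integrableCJ measurableT ix.
    have ipu : integrableC setT (fun v => conjc (x v) * (poisson y (u - v))%:C).
      by apply: (@integrableCMb _ _ _ _ (2 / y)) => //; exact: measC_real.
    have := @abel_fourierL1 (- s) y (fun v => conjc (x v)) u y0.
    rewrite sqrrN opprK => /(_ s1 ixJ); rewrite -/ph => ->.
    rewrite -integralCZl//.
    apply: le_trans (cabs_integralC measurableT (integrableCZl (x u) measurableT ipu)) _.
    apply: ge0_le_integral => //.
    + by move=> v _; rewrite lee_fin cabs_ge0.
    + by apply: measurable_cabsE; apply: measCM; [exact: measC_cst|exact: integrableC_measC].
    + apply/measurable_EFinP; apply: measurable_funM; last exact: mp.
      by apply: measurable_funM; [exact: measurable_cst|exact: (measurable_cabs mx)].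
    + move=> v _; rewrite lee_fin !cabsM cabsJ mulrA cabs_real ger0_norm//.
      exact: poisson_ge0.
pose D n l := (decay (n.+1%:R^-1 / 2) l)%:C * F l.
apply: (@normw2_fatou _ _ D) => //.
- by move=> n; apply: measCM => //; exact: measC_decay.
- apply: aeT => l; right.
  apply: (@squeeze_cvgr _ _ _ _ (cst 0) (fun n => `|decay (n.+1%:R^-1 / 2) l - 1| * cabs (F l))).
  + apply: nearW => n; apply/andP; split; first exact: cabs_ge0.
    rewrite /D.
    have -> : (decay (n.+1%:R^-1 / 2) l)%:C * F l - F l =
      (decay (n.+1%:R^-1 / 2) l - 1)%:C * F l by rewrite rmorphB mulrBl mul1r.
    by rewrite cabsM cabs_real.
  + exact: cvg_cst.
  + rewrite -[X in _ --> X](mul0r (cabs (F l))); apply: cvgM; last exact: cvg_cst.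
    rewrite -(normr0 R); apply: cvg_norm; apply/subr_cvg0.
    exact: cvg_decay.
- exists 0%N => n _; apply: le_trans (weighted n.+1%:R^-1 _); last by [].
  rewrite normw2_1 le_eqVlt; apply/orP; left; apply/eqP; apply: eq_integral => l _.
  rewrite /D cabsM cabs_decay exprMn; congr (_ * _)%:E.
  by rewrite /decay expr2 -expRD; congr expR; field.
Qed.

End BesselInequality.

(** * The weighted pairing, the Cauchy-Schwarz inequality and mean convergence *)

Section Pairing.
Context {R : realType}.
Local Notation mu := (@lebesgue_measure R).
Local Notation C := R[i].
Implicit Types (x y : R -> C) (w : R -> R) (s t : R).

(** Tolerances are divided by b + 1 in place of b, which avoids a separate case b = 0. *)
Lemma ler_div1M (e b : R) : 0 <= e -> 0 <= b -> e / (b + 1) * b <= e.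
Proof.
by move=> e0 b0; rewrite mulrAC ler_pdivrMr ?ltr_wpDl// mulrDr mulr1 lerDl.
Qed.

Definition L2w w x := measC setT x /\ (normw2 w x < +oo)%E.

Definition cvgw2 w (x_ : nat -> R -> C) x := forall e : R, 0 < e ->
  exists N, forall n, (N <= n)%N -> (normw2 w (fun l => x_ n l - x l)%R <= e%:E)%E.

(** Bilinear, so that with weight 1 it is the pairing of the multiplication formula; the conjugate
    is written out where an inner product is meant. *)
Definition pairw w x y := integralC setT (fun l => x l * y l * (w l)%:C).

Lemma L2w_fin w x : weight w -> L2w w x -> normw2 w x = (fine (normw2 w x))%:E.
Proof. by move=> ww [_ xo]; rewrite fineK// ge0_fin_numE// normw2_ge0. Qed.

Lemma L2wD w x y : weight w -> L2w w x -> L2w w y -> L2w w (fun l => x l + y l).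
Proof.
by move=> ww [mx xo] [my yo]; split; [exact: measCD|exact: normw2D_lty].
Qed.

Lemma L2wB w x y : weight w -> L2w w x -> L2w w y -> L2w w (fun l => x l - y l).
Proof.
by move=> ww [mx xo] [my yo]; split; [exact: measCB|exact: normw2B_lty].
Qed.

Lemma L2wZ w x (c : C) : weight w -> L2w w x -> L2w w (fun l => c * x l).
Proof.
move=> ww [mx xo]; split; last exact: normw2Z_lty.
by apply: measCM => //; exact: measC_cst.
Qed.

Lemma L2wN w x : L2w w x -> L2w w (fun l => - x l).
Proof. by move=> [mx xo]; split; [exact: measCN|rewrite normw2N]. Qed.

Lemma L2wJ w x : L2w w x -> L2w w (fun l => conjc (x l)).
Proof.
move=> [mx xo]; split; first exact: measCJ.
by rewrite /normw2; under eq_integral do rewrite cabsJ.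
Qed.

Lemma L2w0 w : weight w -> L2w w (fun=> 0).
Proof.
move=> ww; split; first exact: measC_cst.
by rewrite /normw2; under eq_integral do rewrite cabs0 expr0n mul0r; rewrite integral0 ltry.
Qed.

Lemma integrable_cabs2 w x : weight w -> L2w w x ->
  mu.-integrable setT (EFin \o (fun l => cabs (x l) ^+ 2 * w l)).
Proof.
move=> ww [mx xo]; apply/integrableP; split; first exact: measurable_normw2.
by under eq_integral do rewrite /= ger0_norm ?cabs2_ge0//.
Qed.

Lemma cabs_pair_le (z v : C) (c : R) : 0 <= c ->
  cabs (z * v * c%:C) <= cabs z ^+ 2 * c + cabs v ^+ 2 * c.
Proof.
move=> c0; rewrite !cabsM cabs_real (ger0_norm c0) -mulrDl ler_wpM2r//.
by have := sqr_ge0 (cabs z - cabs v); have := sqr_ge0 (cabs z + cabs v); rewrite sqrrB sqrrD; lra.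
Qed.

Lemma integrable_pairw w x y : weight w -> L2w w x -> L2w w y ->
  integrableC setT (fun l => x l * y l * (w l)%:C).
Proof.
move=> ww lx ly; have [mx _] := lx; have [my _] := ly; have [mw w0] := ww.
apply: (@integrableC_le _ _ _ (fun l => cabs (x l) ^+ 2 * w l + cabs (y l) ^+ 2 * w l)) => //.
- by apply: measCM; [exact: measCM|exact: measC_real].
- by have := integrableD measurableT (integrable_cabs2 ww lx) (integrable_cabs2 ww ly).
- by move=> l _; exact: cabs_pair_le.
Qed.

(** Integrating 2 |x y| <= r |x|^2 + |y|^2 / r gives 2 c <= r a + b / r for all r > 0, and r = c / a
    yields c^2 <= a b. *)
Lemma cauchy_schwarz w x y : weight w -> L2w w x -> L2w w y ->
  cabs (pairw w x y) ^+ 2 <= fine (normw2 w x) * fine (normw2 w y).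
Proof.
move=> ww lx ly; set a := fine _; set b := fine (normw2 w y); set c := cabs _.
have a0 : 0 <= a by apply: fine_ge0; exact: normw2_ge0.
have b0 : 0 <= b by apply: fine_ge0; exact: normw2_ge0.
have c0 : 0 <= c by exact: cabs_ge0.
have [mx _] := lx; have [my _] := ly; have [mw w0] := ww.
have key (r : R) : 0 < r -> 2 * c <= r * a + r^-1 * b.
  move=> r0; rewrite -lee_fin.
  apply: (@le_trans _ _ (\int[mu]_l (2%:E * (cabs (x l * y l * (w l)%:C))%:E))%E).
    rewrite ge0_integralZl//.
    - by rewrite EFinM lee_wpmul2l// cabs_integralC//; exact: integrable_pairw.
    - apply: measurable_cabsE; apply: measCM; first exact: measCM.
      exact: measC_real.
    - by move=> l _; rewrite lee_fin cabs_ge0.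
  rewrite (EFinD (r * a)) (EFinM r) (EFinM r^-1) /a /b -!L2w_fin// /normw2 -!ge0_integralZl//.
  all: try exact: measurable_normw2.
  all: try by move=> l _; rewrite lee_fin cabs2_ge0.
  all: try by rewrite lee_fin ?invr_ge0 ltW.
  rewrite -ge0_integralD//.
  all: try by apply: measurable_funeM; exact: measurable_normw2.
  all: try by move=> l _; rewrite -EFinM lee_fin mulr_ge0 ?cabs2_ge0// ?invr_ge0 ltW.
  apply: ge0_le_integral => //.
  - by move=> l _; rewrite -EFinM lee_fin mulr_ge0 ?cabs_ge0.
  - apply: measurable_funeM; apply: measurable_cabsE; apply: measCM; first exact: measCM.
    exact: measC_real.
  - by apply: emeasurable_funD; apply: measurable_funeM; exact: measurable_normw2.
  move=> l _; rewrite -!EFinM -EFinD lee_fin !cabsM cabs_real (ger0_norm (w0 l)).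
  rewrite !mulrA -mulrDl ler_wpM2r//.
  have E : r * cabs (x l) ^+ 2 + r^-1 * cabs (y l) ^+ 2 - 2 * cabs (x l) * cabs (y l) =
      r * (cabs (x l) - r^-1 * cabs (y l)) ^+ 2 by field; rewrite gt_eqF.
  have : 0 <= r * (cabs (x l) - r^-1 * cabs (y l)) ^+ 2 by rewrite mulr_ge0 ?sqr_ge0// ltW.
  by rewrite -E subr_ge0 !expr2 !mulrA.
have [c00|c00] := eqVneq c 0; first by rewrite c00 expr0n mulr_ge0.
have cp : 0 < c by rewrite lt_neqAle eq_sym c00.
have [a00|a00] := eqVneq a 0.
  (* For a = 0 this r leaves 2 c <= c b / (b + 1) <= c, against c > 0. *)
  have := key ((b + 1) / c) (divr_gt0 (ltr_wpDl b0 ltr01) cp).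
  rewrite a00 mulr0 add0r invf_div mulrAC -mulrA => h.
  have : c * (b / (b + 1)) <= c by rewrite ler_piMr// ler_pdivrMr ?mul1r ?ler_wpDr// ltr_wpDl.
  by move: h; lra.
have ap : 0 < a by rewrite lt_neqAle eq_sym a00.
have := key (c / a) (divr_gt0 cp ap); rewrite divfK// invf_div => h.
have : c <= a / c * b by lra.
by rewrite mulrAC ler_pdivlMr// -expr2.
Qed.

Lemma pairwC w x y : pairw w x y = pairw w y x.
Proof. by apply: eq_integralC => l _; rewrite [x l * _]mulrC. Qed.

Lemma pairwBl w x x' y : weight w -> L2w w x -> L2w w x' -> L2w w y ->
  pairw w (fun l => x l - x' l) y = pairw w x y - pairw w x' y.
Proof.
move=> ww lx lx' ly; rewrite -integralCB//; [|exact: integrable_pairw..].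
by apply: eq_integralC => l _; rewrite !mulrBl.
Qed.

Lemma pairwDl w x x' y : weight w -> L2w w x -> L2w w x' -> L2w w y ->
  pairw w (fun l => x l + x' l) y = pairw w x y + pairw w x' y.
Proof.
move=> ww lx lx' ly; rewrite -integralCD//; [|exact: integrable_pairw..].
by apply: eq_integralC => l _; rewrite !mulrDl.
Qed.

Lemma pairwZl w x y (c : C) : weight w -> L2w w x -> L2w w y ->
  pairw w (fun l => c * x l) y = c * pairw w x y.
Proof.
move=> ww lx ly; rewrite -integralCZl//; last exact: integrable_pairw.
by apply: eq_integralC => l _; rewrite !mulrA.
Qed.

Lemma pairw_eq0 w x y : weight w -> L2w w x -> L2w w y ->
  (forall e : R, 0 < e -> exists x', [/\ L2w w x',
     (normw2 w (fun l => x l - x' l)%R <= e%:E)%E & pairw w x' y = 0]) ->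
  pairw w x y = 0.
Proof.
move=> ww lx ly H; apply/eqP; rewrite -cabs_eq0 -sqrf_eq0 eq_le sqr_ge0 andbT.
set b := fine (normw2 w y).
have b0 : 0 <= b by apply: fine_ge0; exact: normw2_ge0.
apply/ler_addgt0Pr => e e0; rewrite add0r.
have [x' [lx' xe x'y]] := H (e / (b + 1)) (divr_gt0 e0 (ltr_wpDl b0 ltr01)).
have -> : pairw w x y = pairw w (fun l => x l - x' l) y by rewrite pairwBl// x'y subr0.
apply: le_trans (cauchy_schwarz ww (L2wB ww lx lx') ly) _.
apply: (@le_trans _ _ (e / (b + 1) * b)).
  by rewrite ler_wpM2r// -lee_fin -L2w_fin//; exact: L2wB.
exact: ler_div1M (ltW e0) b0.
Qed.

Lemma pairw_cvg w (x_ : nat -> R -> C) x y : weight w -> (forall n, L2w w (x_ n)) ->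
  L2w w x -> L2w w y -> cvgw2 w x_ x ->
  (fun n => cabs (pairw w (x_ n) y - pairw w x y)) @ \oo --> (0 : R).
Proof.
move=> ww lx_ lx ly cx; apply/cvgrPdist_le => e e0.
set b := fine (normw2 w y).
have b0 : 0 <= b by apply: fine_ge0; exact: normw2_ge0.
have b1 : 0 < b + 1 by exact: ltr_wpDl.
have [N HN] := cx (e ^+ 2 / (b + 1)) (divr_gt0 (exprn_gt0 _ e0) b1).
exists N => // n Nn; rewrite sub0r normrN (ger0_norm (cabs_ge0 _)).
rewrite -ler_sqr ?nnegrE ?cabs_ge0 ?(ltW e0)// -pairwBl//.
apply: le_trans (cauchy_schwarz ww (L2wB ww (lx_ n) lx) ly) _.
apply: (@le_trans _ _ (e ^+ 2 / (b + 1) * b)).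
  by rewrite ler_wpM2r// -lee_fin -L2w_fin//; [exact: HN|exact: L2wB].
exact: ler_div1M (exprn_ge0 _ (ltW e0)) b0.
Qed.

Lemma cvgw2_cauchy w (x_ : nat -> R -> C) x : weight w ->
  (forall n, measC setT (x_ n)) -> measC setT x ->
  cvgw2 w x_ x -> forall e : R, 0 < e -> exists N, forall n m, (N <= n)%N -> (N <= m)%N ->
     (normw2 w (fun l => x_ n l - x_ m l)%R <= e%:E)%E.
Proof.
move=> ww mx_ mx cx e e0; have [N HN] := cx (e / 4) (divr_gt0 e0 (ltr0n R 4)).
exists N => n m Nn Nm.
have -> : (fun l => x_ n l - x_ m l) = (fun l => (x_ n l - x l) - (x_ m l - x l)).
  by apply/funext => l; ring.
apply: le_trans (normw2B ww (measCB (mx_ n) mx) (measCB (mx_ m) mx)) _.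
apply: (@le_trans _ _ (2%:E * (e / 4)%:E + 2%:E * (e / 4)%:E)%E).
  by apply: leeD; rewrite lee_pmul2l//; exact: HN.
by rewrite -!EFinM -EFinD lee_fin; lra.
Qed.

Lemma cvgw2_lim_L2 w (x_ : nat -> R -> C) x : weight w ->
  (forall n, L2w w (x_ n)) -> measC setT x ->
  cvgw2 w x_ x -> L2w w x.
Proof.
move=> ww lx_ mx /(_ _ ltr01)[N /(_ _ (leqnn N)) h]; split => //.
have -> : x = (fun l => x_ N l - (x_ N l - x l)) by apply/funext => l; ring.
have [mN lN] := lx_ N; apply: normw2B_lty => //; first exact: measCB.
by apply: le_lt_trans h _; rewrite ltry.
Qed.

Lemma cvgw2B w (x_ : nat -> R -> C) x (y_ : nat -> R -> C) y :
  weight w -> (forall n, measC setT (x_ n)) -> measC setT x ->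
  (forall n, measC setT (y_ n)) -> measC setT y ->
  cvgw2 w x_ x -> cvgw2 w y_ y ->
  cvgw2 w (fun n l => x_ n l - y_ n l) (fun l => x l - y l).
Proof.
move=> ww mx_ mx my_ my cx cy e e0; have e4 := divr_gt0 e0 (ltr0n R 4).
have [N1 H1] := cx _ e4; have [N2 H2] := cy _ e4.
exists (maxn N1 N2) => n; rewrite geq_max => /andP[n1 n2].
have -> : (fun l => x_ n l - y_ n l - (x l - y l)) =
    (fun l => (x_ n l - x l) - (y_ n l - y l)) by apply/funext => l; ring.
apply: le_trans (normw2B ww (measCB (mx_ n) mx) (measCB (my_ n) my)) _.
apply: (@le_trans _ _ (2%:E * (e / 4)%:E + 2%:E * (e / 4)%:E)%E).
  by apply: leeD; rewrite lee_pmul2l//; [exact: H1|exact: H2].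
by rewrite -!EFinM -EFinD lee_fin; lra.
Qed.

End Pairing.

(** * The Fourier transform in L_2 as a limit in the mean *)

Section FourierL2.
Context {R : realType}.
Local Notation mu := (@lebesgue_measure R).
Local Notation C := R[i].
Local Notation w1 := (fun=> 1%R : R).
Implicit Types (x y : R -> C) (w : R -> R) (s t : R) (D : set R).

Let W1 : weight w1 := weight1.

Lemma cvge0P (u : nat -> \bar R) : (forall n, 0 <= u n)%E ->
  u @ \oo --> 0%E <->
  (forall e : R, 0 < e -> exists N, forall n, (N <= n)%N -> (u n <= e%:E)%E).
Proof.
move=> u0; split=> [/fine_cvgP[[N1 _ fu] /cvgrPdist_le cu] e e0|H].
  have [N2 _ H] := cu _ e0; exists (maxn N1 N2) => n; rewrite geq_max => /andP[n1 n2].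
  have := H n n2; rewrite /= sub0r normrN ger0_norm ?fine_ge0// => h.
  by rewrite -[leLHS]fineK ?lee_fin//; exact: (fu n n1).
apply/fine_cvgP; split.
  have [N HN] := H _ ltr01; exists N => // n Nn.
  by rewrite ge0_fin_numE// (le_lt_trans (HN n Nn))// ltry.
apply/cvgrPdist_le => e e0; have [N HN] := H _ e0; exists N => // n Nn /=.
rewrite sub0r normrN ger0_norm ?fine_ge0// -lee_fin fineK ?HN//.
by rewrite ge0_fin_numE// (le_lt_trans (HN n Nn))// ltry.
Qed.

Lemma cvgw2P w (x_ : nat -> R -> C) x : weight w ->
  (fun n => normw2 w (fun l => x_ n l - x l)) @ \oo --> 0%E <-> cvgw2 w x_ x.
Proof. by move=> ww; apply: cvge0P => n; exact: normw2_ge0. Qed.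

Lemma cvgw2_dominated w (x_ : nat -> R -> C) x : weight w ->
  (forall n, measC setT (x_ n)) -> L2w w x ->
  (forall n l, cabs (x_ n l - x l) <= cabs (x l)) ->
  (forall l, (fun n => cabs (x_ n l - x l)) @ \oo --> (0 : R)) -> cvgw2 w x_ x.
Proof.
move=> ww mx_ lx dx cx; have [mx xo] := lx; have [mw w0] := ww.
apply/cvgw2P => //.
have md n : measurable_fun setT (fun l => (cabs (x_ n l - x l) ^+ 2 * w l)%:E).
  by apply: measurable_normw2 => //; exact: measCB.
have cv : {ae mu, forall l, setT l ->
    (cabs (x_ n l - x l) ^+ 2 * w l)%:E @[n --> \oo] --> (cst 0%E) l}.
  apply: aeT => l _; apply: cvg_EFin; first exact: nearW.
  have := @cvg_cabs_sqr R (fun n => x_ n l - x l) 0 (w l).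
  rewrite cabs0 expr0n mul0r; apply.
  by rewrite (_ : (fun n => _) = (fun n => cabs (x_ n l - x l)))//;
    apply/funext => n; rewrite subr0.
have dom : {ae mu, forall l n, setT l ->
    (`|(cabs (x_ n l - x l) ^+ 2 * w l)%:E| <= (cabs (x l) ^+ 2 * w l)%:E)%E}.
  apply: aeT => l n _; rewrite gee0_abs ?lee_fin ?mulr_ge0 ?exprn_ge0 ?cabs_ge0//.
  by rewrite ler_wpM2r// lerXn2r ?nnegrE ?cabs_ge0.
have [_ _] := @dominated_convergence _ _ _ mu setT measurableT
  (fun n l => (cabs (x_ n l - x l) ^+ 2 * w l)%:E) (cst 0%E)
  (fun l => (cabs (x l) ^+ 2 * w l)%:E) md (measurable_cst _) cv
  (integrable_cabs2 ww lx) dom.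
by rewrite integral0.
Qed.

Lemma extend0Ml D x y t : extend0 D (fun u => x u * y u) t = extend0 D x t * y t.
Proof. by rewrite /extend0; case: asboolP => // _; rewrite mul0r. Qed.

Lemma extend0B D x y t :
  extend0 D (fun u => x u - y u) t = extend0 D x t - extend0 D y t.
Proof. by rewrite /extend0; case: asboolP => // _; rewrite subr0. Qed.

Lemma extend0I D (E : set R) x t : extend0 (D `&` E) x t = extend0 E (extend0 D x) t.
Proof.
rewrite /extend0; case: asboolP => [[Dt Et]|DE]; first by rewrite !asboolT.
by case: asboolP => // Et; case: asboolP => // Dt; case: DE.
Qed.

Lemma cabs_extend0 D x t : cabs (extend0 D x t) <= cabs (x t).
Proof. by rewrite /extend0; case: asboolP => // _; rewrite cabs0 cabs_ge0. Qed.

Lemma fourierL1_extend0 s D x l : fourierL1 s D x l = fourierL1 s setT (extend0 D x) l.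
Proof.
rewrite /fourierL1 integralC_extend0; apply: eq_integralC => t _.
by rewrite extend0Ml.
Qed.

Lemma extend0_setT x : extend0 setT x = x.
Proof. by apply/funext => t; rewrite extend0_in. Qed.

Lemma L2w_le w x y : weight w -> L2w w x -> measC setT y ->
  (forall l, cabs (y l) <= cabs (x l)) -> L2w w y.
Proof.
move=> ww [mx xo] my yx; split => //; apply: le_lt_trans xo.
have := @normw2_le R w y x 1 ww my mx ler01; rewrite mul1e; apply => l.
by rewrite mul1r ler_wpM2r ?lerXn2r ?nnegrE ?cabs_ge0//; case: ww.
Qed.

Lemma measC_extend0T D x : measurable D -> measC setT x -> measC setT (extend0 D x).
Proof.
move=> mD [mx1 mx2]; apply: (measC_extend0 _ mD).1.
by split; exact: measurable_funTS.
Qed.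

Lemma L2w_extend0 w D x : weight w -> measurable D -> L2w w x -> L2w w (extend0 D x).
Proof.
move=> ww mD lx; apply: (L2w_le ww lx); last by move=> l; exact: cabs_extend0.
by apply: measC_extend0T => //; case: lx.
Qed.

Lemma cvgw2_trunc w x : weight w -> L2w w x ->
  cvgw2 w (fun n => extend0 (trunc n) x) x.
Proof.
move=> ww lx; apply: cvgw2_dominated => //.
- move=> n; apply: measC_extend0T; first exact: measurable_trunc.
  by case: lx.
- move=> n l; rewrite /extend0; case: asboolP => _.
    by rewrite subrr cabs0 cabs_ge0.
  by rewrite sub0r cabsN.
- move=> l; apply: cvg_near_cst; apply: filterS (near_trunc l) => n ln.
  by rewrite extend0_in// subrr cabs0.
Qed.

(** On a bounded interval 1 + |x|^2 is integrable and dominates |x|. *)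
Lemma integrable_L2_trunc n x : L2w w1 x -> integrableC setT (extend0 (trunc n) x).
Proof.
move=> lx; have [[m1 m2] _] := lx.
apply: (integrableC_extend0 _ (measurable_trunc n)).1.
apply: (@integrableC_le _ _ _ (fun t => 1 + cabs (x t) ^+ 2 * 1)).
- exact: measurable_trunc.
- by split; exact: measurable_funTS.
- have i1 : mu.-integrable (trunc n) (EFin \o (fun=> 1 : R)).
    by apply: integrable_trunc => t; exact: cvg_cst.
  have i2 : mu.-integrable (trunc n) (EFin \o (fun t => cabs (x t) ^+ 2 * 1)).
    apply: (integrableS _ _ _ (integrable_cabs2 W1 lx)) => //.
    exact: measurable_itv.
  exact: (@integrableD _ _ _ mu _ (measurable_trunc n) _ _ i1 i2).
- move=> t _; rewrite mulr1.
  have := sqr_ge0 (cabs (x t) - 1); rewrite sqrrB mulr1 expr1n.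
  by have := cabs_ge0 (x t); lra.
Qed.

(** A relation, because the limit in the mean is determined only up to a null set; any
    representative may take the place of [X]. *)
Definition fourier2 s x (X : R -> C) := L2w w1 X /\
  cvgw2 w1 (fun n => fourierL1 s setT (extend0 (trunc n) x)) X.

Lemma L2w_fourierL1 s x : s ^+ 2 = 1 -> integrableC setT x -> L2w w1 x ->
  L2w w1 (fourierL1 s setT x).
Proof.
move=> s1 ix [mx xo]; split; first exact: measC_fourierL1.
apply: le_lt_trans (bessel_fourierL1 s1 ix) _.
by rewrite lte_mul_pinfty// lee_fin mulr_ge0// pi_ge0.
Qed.

Lemma L2w_fourier_trunc s x n : s ^+ 2 = 1 -> L2w w1 x ->
  L2w w1 (fourierL1 s setT (extend0 (trunc n) x)).
Proof.
move=> s1 lx; apply: L2w_fourierL1 => //; first exact: integrable_L2_trunc.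
by apply: L2w_extend0 => //; exact: measurable_trunc.
Qed.

Lemma pi2_gt0 : 0 < 2 * pi :> R.
Proof. by rewrite mulr_gt0// pi_gt0. Qed.

Lemma normw2_fourier_trunc_dist s x y n m : s ^+ 2 = 1 -> L2w w1 x -> L2w w1 y ->
  (normw2 w1 (fun l => fourierL1 s setT (extend0 (trunc n) x) l -
                       fourierL1 s setT (extend0 (trunc m) y) l)%R <=
  (2 * pi)%:E * normw2 w1 (fun t => extend0 (trunc n) x t - extend0 (trunc m) y t)%R)%E.
Proof.
move=> s1 lx ly.
have i1 := integrable_L2_trunc n lx; have i2 := integrable_L2_trunc m ly.
rewrite (_ : (fun l => _) = fourierL1 s setT
    (fun t => extend0 (trunc n) x t - extend0 (trunc m) y t)).
  by apply: bessel_fourierL1 => //; exact: integrableCB.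
by apply/funext => l; rewrite fourierL1B.
Qed.

(** The truncations of [x] form a Cauchy sequence, hence by the Bessel inequality so do their
    transforms; completeness gives the limit. *)
Lemma fourier2_exists s x : s ^+ 2 = 1 -> L2w w1 x -> exists X, fourier2 s x X.
Proof.
move=> s1 lx; pose F n := fourierL1 s setT (extend0 (trunc n) x).
have mF n : measC setT (F n) by have [] := L2w_fourier_trunc n s1 lx.
have mx n : measC setT (extend0 (trunc n) x).
  by have [] := L2w_extend0 W1 (measurable_trunc n) lx.
have [e e0|X mX cX] := weighted_L2_complete W1 mF.
  have h := cvgw2_cauchy W1 mx lx.1 (cvgw2_trunc W1 lx).
  have [N HN] := h _ (divr_gt0 e0 pi2_gt0); exists N => n m Nn Nm.
  apply: le_trans (normw2_fourier_trunc_dist n m s1 lx lx) _.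
  apply: (@le_trans _ _ ((2 * pi)%:E * (e / (2 * pi))%:E)%E).
    by rewrite lee_pmul2l ?lte_fin ?pi2_gt0//; exact: HN.
  by rewrite -EFinM mulrCA divff ?mulr1// gt_eqF// pi2_gt0.
exists X; split => //; apply: (cvgw2_lim_L2 W1 _ mX cX) => n.
exact: L2w_fourier_trunc.
Qed.

Lemma fourier2_L1 s x : s ^+ 2 = 1 -> integrableC setT x -> L2w w1 x ->
  fourier2 s x (fourierL1 s setT x).
Proof.
move=> s1 ix lx; split; first exact: L2w_fourierL1.
move=> e e0; have [N HN] := cvgw2_trunc W1 lx (divr_gt0 e0 pi2_gt0).
exists N => n Nn.
have i1 := integrable_L2_trunc n lx.
rewrite (_ : (fun l => _) = fourierL1 s setT (fun t => extend0 (trunc n) x t - x t)).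
  apply: le_trans (bessel_fourierL1 s1 (integrableCB measurableT i1 ix)) _.
  apply: (@le_trans _ _ ((2 * pi)%:E * (e / (2 * pi))%:E)%E).
    by rewrite lee_pmul2l ?lte_fin ?pi2_gt0//; exact: HN.
  by rewrite -EFinM mulrCA divff ?mulr1// gt_eqF// pi2_gt0.
by apply/funext => l; rewrite fourierL1B.
Qed.

Lemma fourier2B s x X y Y : s ^+ 2 = 1 -> L2w w1 x -> L2w w1 y ->
  fourier2 s x X -> fourier2 s y Y ->
  fourier2 s (fun t => x t - y t) (fun l => X l - Y l).
Proof.
move=> s1 lx ly [lX cX] [lY cY]; split; first exact: L2wB.
have mF n := (L2w_fourier_trunc n s1 lx).1.
have mG n := (L2w_fourier_trunc n s1 ly).1.
rewrite (_ : (fun n => _) = (fun n l => fourierL1 s setT (extend0 (trunc n) x) l -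
    fourierL1 s setT (extend0 (trunc n) y) l)).
  exact: cvgw2B lX.1 _ lY.1 cX cY.
apply/funext => n; apply/funext => l; rewrite -fourierL1B; try exact: integrable_L2_trunc.
by congr fourierL1; apply/funext => t; rewrite extend0B.
Qed.

(** The constant is twice that of the Bessel inequality, the loss coming from |u - v|^2 <= 2 |u|^2 +
    2 |v|^2; any finite constant gives the continuity of the transform that is drawn from it. *)
Lemma fourier2_bound s x X : s ^+ 2 = 1 -> L2w w1 x -> fourier2 s x X ->
  (normw2 w1 X <= (4 * pi)%:E * normw2 w1 x)%E.
Proof.
move=> s1 lx [lX cX]; apply/lee_addgt0Pr => e e0.
have [N /(_ _ (leqnn N)) HN] := cX _ (divr_gt0 e0 (ltr0n R 2)).
pose F := fourierL1 s setT (extend0 (trunc N) x).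
have lF : L2w w1 F by exact: L2w_fourier_trunc.
have -> : X = (fun l => F l - (F l - X l)) by apply/funext => l; ring.
apply: le_trans (normw2B W1 lF.1 (measCB lF.1 lX.1)) _; apply: leeD.
  apply: (@le_trans _ _ (2%:E * ((2 * pi)%:E * normw2 w1 x))%E).
    rewrite lee_pmul2l//.
    apply: le_trans (bessel_fourierL1 s1 (integrable_L2_trunc N lx)) _.
    rewrite lee_pmul2l ?lte_fin ?pi2_gt0//.
    have := @normw2_le R w1 (extend0 (trunc N) x) x 1 W1 _ lx.1 ler01.
    rewrite mul1e; apply.
      by have [] := L2w_extend0 W1 (measurable_trunc N) lx.
    by move=> l; rewrite mul1r !mulr1 lerXn2r ?nnegrE ?cabs_ge0// cabs_extend0.
  by rewrite muleA -EFinM mulrA -natrM.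
apply: (@le_trans _ _ (2%:E * (e / 2)%:E)%E).
  by rewrite lee_pmul2l//; exact: HN.
by rewrite -EFinM mulrC divfK.
Qed.

Lemma fourier2_cvg s (x_ X_ : nat -> R -> C) x X : s ^+ 2 = 1 ->
  (forall n, L2w w1 (x_ n)) -> L2w w1 x ->
  (forall n, fourier2 s (x_ n) (X_ n)) -> fourier2 s x X ->
  cvgw2 w1 x_ x -> cvgw2 w1 X_ X.
Proof.
move=> s1 lx_ lx fx_ fx cx e e0.
have p4 : 0 < 4 * pi :> R by rewrite mulr_gt0// pi_gt0.
have [N HN] := cx _ (divr_gt0 e0 p4); exists N => n Nn.
apply: le_trans (fourier2_bound s1 (L2wB W1 (lx_ n) lx) (fourier2B s1 (lx_ n) lx (fx_ n) fx)) _.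
apply: (@le_trans _ _ ((4 * pi)%:E * (e / (4 * pi))%:E)%E).
  by rewrite lee_pmul2l ?lte_fin//; exact: HN.
by rewrite -EFinM mulrCA divff ?mulr1// gt_eqF.
Qed.

Lemma pairw1 x y : pairw w1 x y = integralC setT (fun l => x l * y l).
Proof. by apply: eq_integralC => l _; rewrite mulr1. Qed.

Lemma cvgr0_unique (z : nat -> C) (u v : C) :
  (fun n => cabs (z n - u)) @ \oo --> (0 : R) ->
  (fun n => cabs (z n - v)) @ \oo --> (0 : R) -> u = v.
Proof.
move=> zu zv; apply/eqP; rewrite -subr_eq0 -cabs_eq0 eq_le cabs_ge0 andbT.
have h : (fun n => cabs (z n - u) + cabs (z n - v)) @ \oo --> (0 + 0 : R) by exact: cvgD.
rewrite addr0 in h; rewrite -(cvg_lim _ h)//; apply: limr_ge.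
  exact: cvgP h.
apply: nearW => n; rewrite -[cabs (z n - u)]cabsN.
by apply: le_trans (cabsD _ _); rewrite le_eqVlt; apply/orP; left; apply/eqP; congr cabs; ring.
Qed.

(** The formula holds for truncations of both functions. The truncation of [y] is removed with that
    of [x] fixed, then that of [x], so that each limit is taken in one argument of the pairing. *)
Lemma fourier2_mult s x X y Y : s ^+ 2 = 1 -> L2w w1 x -> L2w w1 y ->
  fourier2 s x X -> fourier2 s y Y -> pairw w1 X y = pairw w1 x Y.
Proof.
move=> s1 lx ly [lX cX] [lY cY].
pose xn n := extend0 (trunc n) x; pose yn n := extend0 (trunc n) y.
pose Xn n := fourierL1 s setT (xn n); pose Yn n := fourierL1 s setT (yn n).
have lxn n : L2w w1 (xn n) by apply: L2w_extend0 => //; exact: measurable_trunc.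
have lyn n : L2w w1 (yn n) by apply: L2w_extend0 => //; exact: measurable_trunc.
have lXn n : L2w w1 (Xn n) by exact: L2w_fourier_trunc.
have lYn n : L2w w1 (Yn n) by exact: L2w_fourier_trunc.
have E n m : pairw w1 (Xn n) (yn m) = pairw w1 (xn n) (Yn m).
  rewrite !pairw1; apply: fourierL1_mult; exact: integrable_L2_trunc.
have E2 n : pairw w1 (Xn n) y = pairw w1 (xn n) Y.
  apply: (@cvgr0_unique (fun m => pairw w1 (Xn n) (yn m))).
    under eq_fun do rewrite ![pairw w1 (Xn n) _]pairwC.
    apply: pairw_cvg => //; exact: cvgw2_trunc.
  under eq_fun do rewrite E ![pairw w1 (xn n) _]pairwC.
  exact: pairw_cvg.
apply: (@cvgr0_unique (fun n => pairw w1 (Xn n) y)).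
  exact: pairw_cvg.
under eq_fun do rewrite E2.
by apply: pairw_cvg => //; exact: cvgw2_trunc.
Qed.

End FourierL2.

(** * Fourier inversion in L_2 *)

Section FourierInversion.
Context {R : realType}.
Local Notation mu := (@lebesgue_measure R).
Local Notation C := R[i].
Local Notation w1 := (fun=> 1%R : R).
Implicit Types (x y : R -> C) (s t a b : R).

Let W1 : weight w1 := weight1.

(** Lebesgue differentiation: the primitive of [u] restricted to a window is constantly 0, and
    almost everywhere its derivative is the restricted function. *)
Lemma ae_eq0_integral_segment (u : R -> R) :
  (forall n, mu.-integrable (trunc n) (EFin \o u)) ->
  (forall a b, a <= b -> \int[mu]_(t in `[a, b]) u t = 0) ->
  {ae mu, forall t, u t = 0}.
Proof.
move=> iu u0.
have H n : {ae mu, forall t, trunc n t -> u t = 0}.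
  pose v := u \_ (trunc n).
  have iv : mu.-integrable setT (EFin \o v).
    have := (@integrable_mkcond _ _ _ mu _ _ (measurable_trunc n)).1 (iu n).
    by congr (mu.-integrable _ _); apply/funext => t; rewrite /v /= !patchE; case: ifP.
  have F0 (r : R) : \int[mu]_(t in `]-oo, r]) v t = 0.
    rewrite -Rintegral_mkcondr.
    have [rn|rn] := ltP r (- n%:R).
      rewrite (_ : _ `&` _ = set0) ?Rintegral_set0//.
      apply/seteqP; split => // t []; rewrite /trunc /= !in_itv/= => tr /andP[nt _].
      by move: (le_lt_trans tr rn); rewrite ltNge nt.
    rewrite (_ : _ `&` _ = `[- n%:R, Num.min r n%:R]%classic).
      by apply: u0; rewrite le_min rn/= (@le_trans _ _ 0)// oppr_le0.
    apply/seteqP; split => t; rewrite /trunc /= !in_itv/= le_min.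
      by move=> [-> /andP[-> ->]].
    by move=> /andP[-> /andP[-> ->]].
  have iv' (r : R) : mu.-integrable `]-oo, r] (EFin \o v).
    by apply: integrableS iv => //; exact: measurable_itv.
  have := FTC1Ny iv' (open_integrable_locally openT iv).
  apply: aeS => t [_]; have -> : (fun r => \int[mu]_(z in `]-oo, r]) v z) = cst 0.
    by apply/funext => r; exact: F0.
  by rewrite derive1_cst => /esym; rewrite /v patchE => + tn; rewrite mem_set.
have : {ae mu, forall t n, trunc n t -> u t = 0} by apply/ae_foralln.
apply: aeS => t h; have : (\bigcup_n trunc n) t by rewrite trunc_cover.
by case=> n _; exact: h.
Qed.

Definition boxC a b : R -> C := extend0 `[a, b] (fun=> 1).

Lemma integrable_boxC a b : integrableC setT (boxC a b).
Proof.
apply: (integrableC_extend0 _ (measurable_itv _)).1.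
by split; apply: continuous_compact_integrable; try exact: segment_compact;
  apply: continuous_subspaceT => t; exact: cvg_cst.
Qed.

Lemma cabs_boxC a b t : cabs (boxC a b t) ^+ 2 = cabs (boxC a b t).
Proof.
rewrite /boxC /extend0; case: asboolP => _; last by rewrite cabs0 expr0n.
by rewrite cabs_real normr1 expr1n.
Qed.

Lemma L2w_boxC a b : L2w w1 (boxC a b).
Proof.
have [mb bo] := (integrableCP _ measurableT).1 (integrable_boxC a b).
split => //; rewrite normw2_1.
by under eq_integral do rewrite cabs_boxC.
Qed.

Lemma pairw_boxC x a b : L2w w1 x -> pairw w1 x (boxC a b) = integralC `[a, b] x.
Proof.
move=> lx; rewrite pairw1 [RHS]integralC_extend0; apply: eq_integralC => t _.
by rewrite /boxC /extend0; case: asboolP => _; rewrite ?mulr1 ?mulr0.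
Qed.

Lemma ae_eq_pairw_boxC x y : L2w w1 x -> L2w w1 y ->
  (forall a b, a <= b -> pairw w1 x (boxC a b) = pairw w1 y (boxC a b)) ->
  {ae mu, forall t, x t = y t}.
Proof.
move=> lx ly xy; pose d t := x t - y t.
have ld : L2w w1 d by exact: L2wB.
have [mRe mIm] := ld.1.
have id n : integrableC (trunc n) d.
  by apply: (integrableC_extend0 _ (measurable_trunc n)).2; exact: integrable_L2_trunc.
have d0 a b : a <= b -> integralC `[a, b] d = 0.
  by move=> ab; rewrite -pairw_boxC// pairwBl// ?xy ?subrr//; exact: L2w_boxC.
have hRe : {ae mu, forall t, complex.Re (d t) = 0}.
  apply: ae_eq0_integral_segment => [n|a b ab]; first by have [] := id n.
  by have := congr1 (@complex.Re R) (d0 a b ab).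
have hIm : {ae mu, forall t, complex.Im (d t) = 0}.
  apply: ae_eq0_integral_segment => [n|a b ab]; first by have [] := id n.
  by have := congr1 (@complex.Im R) (d0 a b ab).
apply: aeS (ae_and hRe hIm) => t [h1 h2]; apply/eqP; rewrite -subr_eq0; apply/eqP.
exact: complex_ext.
Qed.

Lemma cvg_atan_pos (r : R) : 0 < r ->
  atan ((n.+1%:R^-1 / 2)^-1 * r) @[n --> \oo] --> pi / 2.
Proof.
move=> r0.
have h : (n.+1%:R^-1 / 2)^-1 * r @[n --> \oo] --> +oo%R.
  apply/cvgryPge => A.
  exists (Num.bound `|A / r|) => // n /= An.
  rewrite invf_div invrK -ler_pdivrMr// (le_trans (ler_norm _))//.
  apply: (@le_trans _ _ n%:R).
    apply/ltW/(lt_le_trans (archi_boundP (normr_ge0 _))).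
    by rewrite ler_nat.
  by rewrite -natrM ler_nat (leq_trans (leqnSn n)) ?leq_pmull ?leq_pmulr.
exact: cvg_comp h (@cvgy_atan R).
Qed.

Lemma cvg_atan_neg (r : R) : r < 0 ->
  atan ((n.+1%:R^-1 / 2)^-1 * r) @[n --> \oo] --> - (pi / 2).
Proof.
move=> r0; have := cvg_atan_pos (r := - r); rewrite oppr_gt0 => /(_ r0)/cvgN.
by apply: cvg_trans; apply: near_eq_cvg; apply: nearW => n; rewrite !fctE mulrN atanN opprK.
Qed.

Definition abel_scale (n : nat) : R := n.+1%:R^-1 / 2.

Lemma abel_scale_gt0 n : 0 < abel_scale n.
Proof. by rewrite /abel_scale divr_gt0// invr_gt0. Qed.

Lemma cvgw2_decay w x : weight w -> L2w w x ->
  cvgw2 w (fun n l => (decay (abel_scale n) l)%:C * x l) x.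
Proof.
move=> ww lx.
have E n l : cabs ((decay (abel_scale n) l)%:C * x l - x l) =
    `|decay (abel_scale n) l - 1| * cabs (x l).
  have -> : (decay (abel_scale n) l)%:C * x l - x l =
      (decay (abel_scale n) l - 1)%:C * x l by rewrite rmorphB mulrBl mul1r.
  by rewrite cabsM cabs_real.
apply: cvgw2_dominated => //.
- by move=> n; apply: measCM; [exact: measC_decay|case: lx].
- move=> n l; rewrite E ler_piMl ?cabs_ge0// distrC ger0_norm.
    by rewrite gerBl ltW// decay_gt0.
  by rewrite subr_ge0 decay_le1// ltW// abel_scale_gt0.
- move=> l; under eq_fun do rewrite E.
  have H : `|decay (abel_scale n) l - 1| * cabs (x l) @[n --> \oo] --> `|0 : R| * cabs (x l).
    apply: cvgM; last exact: cvg_cst.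
    by apply: cvg_norm; apply/subr_cvg0; exact: cvg_decay.
  by rewrite normr0 mul0r in H; exact: H.
Qed.

(** For an indicator the Abel means of the inversion integral are differences of arctangents, with
    limit 2 pi inside the interval and 0 outside; the endpoints are a null set. The same means
    converge to [K] in the mean, and Fatou's lemma identifies the two limits. *)
Lemma fourier2_boxC s a b (K : R -> C) : a <= b -> s ^+ 2 = 1 ->
  fourier2 (- s) (fourierL1 s setT (boxC a b)) K ->
  {ae mu, forall t, K t = (2 * pi)%:C * boxC a b t}.
Proof.
move=> ab s1 fK.
have ib := integrable_boxC a b; have lb := L2w_boxC a b.
set Ph := fourierL1 s setT (boxC a b) in fK.
have lPh : L2w w1 Ph by exact: L2w_fourierL1.
have [M PhM] := fourierL1_bounded s ib.
pose Pn n l := (decay (abel_scale n) l)%:C * Ph l.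
have iPn n : integrableC setT (Pn n).
  apply: (@integrableCMb _ _ _ _ M) => //; last by case: lPh.
  exact/integrableC_decay/abel_scale_gt0.
have lPn n : L2w w1 (Pn n).
  apply: (L2w_le W1 lPh); first by case: (iPn n) => *; exact: (integrableC_measC (iPn n)).
  move=> l; rewrite cabsM cabs_decay ler_piMl ?cabs_ge0// decay_le1// ltW//.
  exact: abel_scale_gt0.
have s1' : (- s) ^+ 2 = 1 by rewrite sqrrN.
pose Kn n := fourierL1 (- s) setT (Pn n).
have fKn n : fourier2 (- s) (Pn n) (Kn n) by exact: fourier2_L1.
have cK : cvgw2 w1 Kn K := fourier2_cvg s1' lPn lPh fKn fK (cvgw2_decay W1 lPh).
have KnE n t : Kn n t = (2 * atan ((abel_scale n)^-1 * (b - t)) -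
    2 * atan ((abel_scale n)^-1 * (a - t)))%:C.
  have y0 := abel_scale_gt0 n.
  rewrite /Kn /Pn abel_fourierL1//.
  have -> : integralC setT (fun v => boxC a b v * (poisson (abel_scale n) (t - v))%:C) =
      integralC `[a, b] (fun v => (poisson (abel_scale n) (v - t))%:C).
    rewrite [RHS]integralC_extend0; apply: eq_integralC => v _.
    rewrite /boxC /extend0 -[t - v]opprB poissonN.
    by case: asboolP => _; rewrite ?mul1r ?mul0r.
  apply: complex_ext => /=; last by rewrite /Rintegral integral0.
  by rewrite /Rintegral integral_poisson_segment.
have cvK t : t != a -> t != b ->
    (fun n => cabs (Kn n t - (2 * pi)%:C * boxC a b t)) @ \oo --> (0 : R).
  move=> ta tb.
  have R0 (r : R) : (2 * atan ((abel_scale n)^-1 * (b - t)) -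
      2 * atan ((abel_scale n)^-1 * (a - t))) @[n --> \oo] --> r ->
      (2 * pi)%:C * boxC a b t = r%:C ->
      (fun n => cabs (Kn n t - (2 * pi)%:C * boxC a b t)) @ \oo --> (0 : R).
    move=> cr ->; under eq_fun do rewrite KnE -rmorphB cabs_real.
    by rewrite -(normr0 R); apply: cvg_norm; apply/subr_cvg0.
  have cB (u v : nat -> R) (p q : R) : u @ \oo --> p -> v @ \oo --> q ->
      (fun n => 2 * u n - 2 * v n) @ \oo --> 2 * p - 2 * q.
    by move=> up vq; apply: cvgB; apply: cvgM => //; exact: cvg_cst.
  have [alt|tlea] := ltP a t.
    have [tlb|blet] := ltP t b.
      apply: (R0 (2 * (pi / 2) - 2 * - (pi / 2))).
        by apply: cB; [apply: cvg_atan_pos|apply: cvg_atan_neg]; rewrite ?subr_gt0 ?subr_lt0.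
      rewrite /boxC extend0_in ?mulr1; last by rewrite /= in_itv/= !ltW.
      by congr (_%:C); field.
    have {}blet : b < t by rewrite lt_neqAle eq_sym tb.
    apply: (R0 (2 * - (pi / 2) - 2 * - (pi / 2))).
      by apply: cB; apply: cvg_atan_neg; rewrite ?subr_lt0.
    rewrite /boxC extend0_out ?mulr0 ?subrr// /= in_itv/= => /andP[_].
    by rewrite leNgt blet.
  have {}tlea : t < a by rewrite lt_neqAle ta.
  apply: (R0 (2 * (pi / 2) - 2 * (pi / 2))).
    by apply: cB; apply: cvg_atan_pos; rewrite subr_gt0// (lt_le_trans tlea).
  rewrite /boxC extend0_out ?mulr0 ?subrr// /= in_itv/= => /andP[].
  by rewrite leNgt tlea.
have mK := fK.1.1.
have m2b : measC setT (fun t => (2 * pi)%:C * boxC a b t).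
  by apply: measCM; [exact: measC_cst|case: lb].
suff : {ae mu, forall t, w1 t = 0 \/ K t - (2 * pi)%:C * boxC a b t = 0}.
  by apply: aeS => t [/eqP|/eqP]; [rewrite oner_eq0|rewrite subr_eq0 => /eqP].
have mKn n : measC setT (Kn n) by case: (fKn n) => -[].
apply: normw2_eq0P => //; first exact: measCB.
move=> e e0; have [N0 HN] := cK _ e0.
rewrite normw2_distC.
have ae_ab : {ae mu, forall t, t != a /\ t != b}.
  have aeN (c : R) : {ae mu, forall t : R, t != c}.
    exists [set c]; split => //; first exact: lebesgue_measure_set1.
    by move=> t /= /negP; rewrite negbK => /eqP.
  exact: ae_and (aeN a) (aeN b).
have := @normw2_fatou R w1 (fun n t => K t - Kn n t)
  (fun t => K t - (2 * pi)%:C * boxC a b t).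
rewrite normw2_distC; apply => //.
- by move=> n; exact: measCB.
- exact: measCB.
- apply: aeS ae_ab => t [ta tb]; right.
  apply: cvg_trans (cvK t ta tb); apply: near_eq_cvg; apply: nearW => n.
  by rewrite -cabsN; congr cabs; ring.
- by exists N0 => n Nn; rewrite normw2_distC; exact: HN.
Qed.

(** By duality: two uses of the multiplication formula move both transforms from [x] onto the
    indicator of an interval, where inversion is explicit. *)
Lemma fourier2_inversion s x X K : s ^+ 2 = 1 -> L2w w1 x ->
  fourier2 s x X -> fourier2 (- s) X K ->
  {ae mu, forall t, K t = (2 * pi)%:C * x t}.
Proof.
move=> s1 lx fX fK.
have s1' : (- s) ^+ 2 = 1 by rewrite sqrrN.
have lX := fX.1; have lK := fK.1.
apply: ae_eq_pairw_boxC => //; first exact: L2wZ.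
move=> a b ab; have lb := L2w_boxC a b; have ib := integrable_boxC a b.
have fb := fourier2_L1 s1' ib lb.
rewrite (fourier2_mult s1' lX lb fK fb).
have [Psi fPsi] := fourier2_exists s1 fb.1.
rewrite (fourier2_mult s1 lx fb.1 fX fPsi).
rewrite pairwZl// pairwC [pairw w1 x _]pairwC -pairwZl// !pairw1.
have lPsi := fPsi.1.
apply: ae_eq_integralC => //.
- by apply: measCM; [case: lPsi|case: lx].
- apply: measCM; last by case: lx.
  by apply: measCM; [exact: measC_cst|case: lb].
have fPsi' : fourier2 (- - s) (fourierL1 (- s) setT (boxC a b)) Psi by rewrite opprK.
by apply: aeS (fourier2_boxC ab s1' fPsi') => t -> _.
Qed.

End FourierInversion.

(** * The error as a quadratic form, and the observed subspace *)

Section MeanSquareError.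
Context {R : realType}.
Local Notation mu := (@lebesgue_measure R).
Local Notation C := R[i].
Implicit Types (x y h k A : R -> C) (w f g : R -> R) (Ob : set R) (t : R).

Lemma spectral_weight f : spectral_density f -> weight f.
Proof. by move=> [f0 /measurable_int/measurable_EFinP mf]; split. Qed.

Lemma weight_pairsum f g : weight f -> weight g -> weight (pairsum f g).
Proof.
move=> [mf f0] [mg g0]; split; first exact: measurable_funD.
by move=> l; rewrite addr_ge0.
Qed.

Lemma normw2_pairsum f g x : weight f -> weight g -> measC setT x ->
  (normw2 (pairsum f g) x = normw2 f x + normw2 g x)%E.
Proof.
move=> wf wg mx; rewrite /normw2 -ge0_integralD//.
- by apply: eq_integral => l _; rewrite mulrDr EFinD.
- by move=> l _; rewrite lee_fin cabs2_ge0.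
- exact: measurable_normw2.
- by move=> l _; rewrite lee_fin cabs2_ge0.
- exact: measurable_normw2.
Qed.

Lemma L2w_pairsum f g x : weight f -> weight g ->
  L2w (pairsum f g) x <-> L2w f x /\ L2w g x.
Proof.
move=> wf wg; rewrite /L2w; split=> [[mx]|[[mx fo] [_ go]]].
  rewrite normw2_pairsum// => xo; split; split => //.
    by apply: le_lt_trans xo; rewrite leeDl// normw2_ge0.
  by apply: le_lt_trans xo; rewrite leeDr// normw2_ge0.
by split => //; rewrite normw2_pairsum//; exact: lte_add_pinfty.
Qed.

(** Since [fine] sends +oo to 0, this is the norm only for functions in [L2w], a membership carried
    along below. *)
Definition nrm w x : R := fine (normw2 w x).

Lemma nrm_ge0 w x : weight w -> 0 <= nrm w x.
Proof. by move=> ww; apply: fine_ge0; exact: normw2_ge0. Qed.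

Lemma nrm_pairsum f g x : weight f -> weight g -> L2w (pairsum f g) x ->
  nrm (pairsum f g) x = nrm f x + nrm g x.
Proof.
move=> wf wg lx; have [[mx fo] [_ go]] := (L2w_pairsum x wf wg).1 lx.
by rewrite /nrm normw2_pairsum// fineD// ge0_fin_numE// normw2_ge0.
Qed.

Lemma nrmE w x : weight w -> L2w w x -> normw2 w x = (nrm w x)%:E.
Proof. exact: L2w_fin. Qed.

Lemma nrm_Rintegral w x : nrm w x = \int[mu]_l (cabs (x l) ^+ 2 * w l).
Proof. by []. Qed.

Lemma Re_pairw_Rintegral w x y : weight w -> L2w w x -> L2w w y ->
  complex.Re (pairw w x y) = \int[mu]_l (complex.Re (x l * y l * (w l)%:C)).
Proof. by []. Qed.

Lemma nrmD w x y : weight w -> L2w w x -> L2w w y ->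
  nrm w (fun l => x l + y l) =
  nrm w x + 2 * complex.Re (pairw w x (fun l => conjc (y l))) + nrm w y.
Proof.
move=> ww lx ly; have lyJ := L2wJ ly.
have [iRe _] := integrable_pairw ww lx lyJ.
have iRe2 : mu.-integrable setT (EFin \o (fun l => 2 * complex.Re (x l * conjc (y l) * (w l)%:C))).
  by have := @integrableZl _ _ _ mu setT measurableT 2 _ iRe; exact: eq_integrable.
have ix := integrable_cabs2 ww lx; have iy := integrable_cabs2 ww ly.
rewrite !nrm_Rintegral (Re_pairw_Rintegral ww)// -RintegralZl//.
rewrite -RintegralD//.
rewrite -RintegralD//; last first.
  by have := @integrableD _ _ _ mu setT measurableT _ _ ix iRe2; exact: eq_integrable.
by apply: eq_Rintegral => l _; rewrite !cabs2E !ReImE /=; ring.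
Qed.

Lemma nrmZ w x (c : C) : weight w -> L2w w x ->
  nrm w (fun l => c * x l) = cabs c ^+ 2 * nrm w x.
Proof.
move=> ww lx; rewrite /nrm normw2Z//; last by case: lx.
by rewrite (L2w_fin ww lx) -EFinM.
Qed.

Lemma nrmN w x : nrm w (fun l => - x l) = nrm w x.
Proof. by rewrite /nrm normw2N. Qed.

Lemma nrmB_eq w x y : weight w -> L2w w x -> L2w w y ->
  nrm w (fun l => x l - y l) =
  nrm w x - 2 * complex.Re (pairw w x (fun l => conjc (y l))) + nrm w y.
Proof.
move=> ww lx ly; rewrite nrmD//; last exact: L2wN.
rewrite nrmN; congr (_ + _); rewrite -mulrN; congr (_ + 2 * _).
rewrite -ReN; congr complex.Re.
have -> : (fun l => conjc (- y l)) = (fun l => (-1) * conjc (y l)).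
  by apply/funext => l; rewrite conjCN mulN1r.
by rewrite pairwC pairwZl// ?mulN1r 1?pairwC//; exact: L2wJ.
Qed.

(** 2 pi times the mean-square error, as a real number. *)
Definition qf A h f g : R := nrm f (fun l => A l - h l) + nrm g h.

Lemma mseE A h f g : weight f -> weight g -> L2w f (fun l => A l - h l) -> L2w g h ->
  mse A h f g = ((2 * pi)^-1 * qf A h f g)%:E.
Proof.
move=> wf wg lA lh; rewrite /mse (nrmE wf lA) (nrmE wg lh) -!EFinM -EFinD.
by rewrite -mulrDr.
Qed.

(** The inner product of the estimation error with [k]. Its real part is - 1/2 times the derivative
    of [qf] at [h] in the direction [k], so its vanishing is the normal equation. *)
Definition orth A h f g k : C :=
  pairw f (fun l => A l - h l) (fun l => conjc (k l)) -
  pairw g h (fun l => conjc (k l)).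

Lemma qfD A h k f g : weight f -> weight g -> L2w f A ->
  L2w (pairsum f g) h -> L2w (pairsum f g) k ->
  qf A (fun l => h l + k l) f g =
  qf A h f g - 2 * complex.Re (orth A h f g k) + nrm (pairsum f g) k.
Proof.
move=> wf wg lA lh lk.
have [lhf lhg] := (L2w_pairsum h wf wg).1 lh.
have [lkf lkg] := (L2w_pairsum k wf wg).1 lk.
rewrite nrm_pairsum// /qf.
have -> : (fun l => A l - (h l + k l)) = (fun l => A l - h l - k l).
  by apply/funext => l; ring.
rewrite nrmB_eq//; last exact: L2wB.
rewrite (nrmD wg lhg lkg) /orth ReD ReN; ring.
Qed.

(** Moving [h] by r E k, with E the linear term, changes the form by - 2 r |E|^2 + r^2 |E|^2 |k|^2,
    which is negative at r = 1 / (|k|^2 + 1) unless E = 0. *)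
Lemma orth_eq0_of_min A h f g k : weight f -> weight g -> L2w f A ->
  L2w (pairsum f g) h -> L2w (pairsum f g) k ->
  (forall c : C, qf A h f g <= qf A (fun l => h l + c * k l) f g) ->
  orth A h f g k = 0.
Proof.
move=> wf wg lA lh lk hmin.
have wF := weight_pairsum wf wg.
have [lhf lhg] := (L2w_pairsum h wf wg).1 lh.
have [lkf lkg] := (L2w_pairsum k wf wg).1 lk.
set E := orth _ _ _ _ _.
have key (r : R) : 0 < r -> 0 <= - (2 * r * cabs E ^+ 2) + r ^+ 2 * cabs E ^+ 2 * nrm (pairsum f g) k.
  move=> r0; have := hmin (r%:C * E); rewrite qfD//; last exact: L2wZ.
  rewrite nrmZ// cabsM cabs_real (gtr0_norm r0) exprMn.
  suff -> : orth A h f g (fun l => r%:C * E * k l) = (r * cabs E ^+ 2)%:C.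
    by rewrite /=; lra.
  have -> : orth A h f g (fun l => r%:C * E * k l) = r%:C * conjc E * E.
    rewrite {3}/E /orth.
    have -> : (fun l => conjc (r%:C * E * k l)) = (fun l => r%:C * conjc E * conjc (k l)).
      by apply/funext => l; rewrite !conjCM conjc_real.
    rewrite ![pairw _ _ (fun l => _ * conjc (k l))]pairwC !pairwZl//; try exact: L2wJ.
      by rewrite ![pairw _ (fun l => conjc (k l)) _]pairwC mulrBr.
    exact: L2wB.
  by rewrite -mulrA [conjc E * E]mulrC mulJ_cabs -rmorphM.
apply/eqP; rewrite -cabs_eq0 -sqrf_eq0.
apply/negPn/negP => E0.
have Ep : 0 < cabs E ^+ 2 by rewrite lt_neqAle eq_sym E0 sqr_ge0.
have n0 := nrm_ge0 k wF.
have n1 : 0 < nrm (pairsum f g) k + 1 by exact: ltr_wpDl.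
have := key (nrm (pairsum f g) k + 1)^-1; rewrite invr_gt0 => /(_ n1).
set r := (_)^-1; have r0 : 0 < r by rewrite invr_gt0.
have rn : r * (nrm (pairsum f g) k + 1) = 1 by rewrite mulVf// gt_eqF.
have -> : - (2 * r * cabs E ^+ 2) + r ^+ 2 * cabs E ^+ 2 * nrm (pairsum f g) k =
   - (r * cabs E ^+ 2 * (2 - r * nrm (pairsum f g) k)) by ring.
have rn1 : r * nrm (pairsum f g) k <= 1 by rewrite -rn ler_wpM2l ?(ltW r0)// lerDl.
rewrite oppr_ge0 leNgt => /negP; apply.
by apply: mulr_gt0; [exact: mulr_gt0|lra].
Qed.

Definition trigpoly Ob (p : R -> C) := exists (n : nat) (c : 'I_n -> C) (t : 'I_n -> R),
  (forall i, Ob (t i)) /\ p = (fun l => \sum_(i < n) c i * cexpi (t i * l)).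

Lemma L2sP Ob w h : L2s Ob w h <-> L2w w h /\
  forall e : R, 0 < e -> exists2 p, trigpoly Ob p & (normw2 w (fun l => h l - p l)%R < e%:E)%E.
Proof.
split=> [[mh ho H]|[[mh ho] H]]; split => // e /H.
  by move=> [n [c [t [Ot he]]]]; eexists; [exists n, c, t|exact: he].
by move=> [p [n [c [t [Ot ->]]]] he]; exists n, c, t.
Qed.

Lemma trigpoly0 Ob : trigpoly Ob (fun=> 0).
Proof.
exists 0%N, (fun=> 0), (fun=> 0); split=> [[]//|].
by apply/funext => l; rewrite big_ord0.
Qed.

Lemma trigpoly_exp Ob t : Ob t -> trigpoly Ob (fun l => cexpi (t * l)).
Proof.
move=> Ot; exists 1%N, (fun=> 1), (fun=> t); split=> //.
by apply/funext => l; rewrite big_ord1 mul1r.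
Qed.

Lemma trigpolyD Ob p q : trigpoly Ob p -> trigpoly Ob q -> trigpoly Ob (fun l => p l + q l).
Proof.
move=> [n [c [t [Ot ->]]]] [m [d [u [Ou ->]]]].
exists (n + m)%N, (fun i : 'I_(n + m) => match fintype.split i with inl j => c j | inr j => d j end),
  (fun i : 'I_(n + m) => match fintype.split i with inl j => t j | inr j => u j end); split.
  by move=> i; case: fintype.split.
apply/funext => l; rewrite big_split_ord/=; congr (_ + _); apply: eq_bigr => i _.
  by rewrite -[lshift m i]/(unsplit (inl i)) unsplitK.
by rewrite -[rshift n i]/(unsplit (inr i)) unsplitK.
Qed.

Lemma trigpolyZ Ob p (c : C) : trigpoly Ob p -> trigpoly Ob (fun l => c * p l).
Proof.
move=> [n [d [t [Ot ->]]]]; exists n, (fun i => c * d i), t; split => //.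
by apply/funext => l; rewrite mulr_sumr; apply: eq_bigr => i _; rewrite mulrA.
Qed.

Lemma measC_trigpoly Ob p : trigpoly Ob p -> measC setT p.
Proof.
move=> [n [c [t [_ ->]]]]; elim: n c t => [|n IH] c t.
  by under eq_fun do rewrite big_ord0; exact: measC_cst.
under eq_fun do rewrite big_ord_recl.
apply: measCD; last exact: IH.
by apply: measCM; [exact: measC_cst|exact: measC_cexpil].
Qed.

Lemma L2w_bounded w x (K : R) : spectral_density w -> measC setT x ->
  (forall l, cabs (x l) <= K) -> L2w w x.
Proof.
move=> sw mx xK; have ww := spectral_weight sw; split => //.
have K0 : 0 <= K by exact: le_trans (cabs_ge0 _) (xK 0).
have [w0 iw] := sw.
apply: (@le_lt_trans _ _ ((K ^+ 2)%:E * \int[mu]_l (w l)%:E)%E).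
  rewrite -ge0_integralZl//.
  - apply: ge0_le_integral => //.
    + by move=> l _; rewrite lee_fin cabs2_ge0.
    + exact: measurable_normw2.
    + by apply: measurable_funeM; have /measurable_int := iw.
    + by move=> l _; rewrite -EFinM lee_fin ler_wpM2r// lerXn2r ?nnegrE ?cabs_ge0.
  - by have /measurable_int := iw.
  - by move=> l _; rewrite lee_fin.
  - by rewrite lee_fin exprn_ge0.
rewrite lte_mul_pinfty ?lee_fin ?exprn_ge0//.
by have := integrable_lty measurableT iw.
Qed.

Lemma L2w_exp w t : spectral_density w -> L2w w (fun l => cexpi (t * l)).
Proof.
move=> sw; apply: (L2w_bounded (K := 1) sw); first exact: measC_cexpil.
by move=> l; rewrite cabs_cexpi.
Qed.

Lemma L2w_trigpoly Ob w p : spectral_density w -> trigpoly Ob p -> L2w w p.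
Proof.
move=> sw [n [c [t [_ ->]]]]; have ww := spectral_weight sw.
elim: n c t => [|n IH] c t.
  by under eq_fun do rewrite big_ord0; exact: L2w0.
under eq_fun do rewrite big_ord_recl.
by apply: L2wD => //; apply: L2wZ => //; exact: L2w_exp.
Qed.

Lemma L2s_trigpoly Ob w p : spectral_density w -> trigpoly Ob p -> L2s Ob w p.
Proof.
move=> sw tp; have lp := L2w_trigpoly sw tp.
apply/L2sP; split => // e e0; exists p => //.
rewrite /normw2; under eq_integral do rewrite subrr cabs0 expr0n mul0r.
by rewrite integral0 lte_fin.
Qed.

Lemma L2s_closed Ob w h : spectral_density w -> measC setT h ->
  (forall e : R, 0 < e -> exists2 k, L2s Ob w k & (normw2 w (fun l => h l - k l)%R <= e%:E)%E) ->
  L2s Ob w h.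
Proof.
move=> sw mh H; have ww := spectral_weight sw; apply/L2sP; split.
  have [k /L2sP[lk _] hk] := H 1 ltr01; split => //.
  have -> : h = (fun l => (h l - k l) + k l) by apply/funext => l; rewrite subrK.
  apply: normw2D_lty => //; [exact: measCB mh lk.1|..]; try by case: lk.
  by apply: le_lt_trans hk _; rewrite ltry.
(* The two errors add up to at most 2 e/8 + 2 e/8 = e/2, strictly below e as the definition of the
   span asks. *)
move=> e e0; have e8 := divr_gt0 e0 (ltr0n R 8).
have [k /L2sP[lk Hk] hk] := H _ e8; have [p tp kp] := Hk _ e8.
exists p => //.
have mk := lk.1; have mp := measC_trigpoly tp.
have -> : (fun l => h l - p l) = (fun l => (h l - k l) + (k l - p l)).
  by apply/funext => l; ring.
apply: le_lt_trans (normw2D ww (measCB mh mk) (measCB mk mp)) _.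
apply: (@le_lt_trans _ _ (2%:E * (e / 8)%:E + 2%:E * (e / 8)%:E)%E).
  by apply: leeD; rewrite lee_pmul2l// ltW.
by rewrite -!EFinM -EFinD lte_fin; lra.
Qed.

Lemma L2s_L2w Ob w h : L2s Ob w h -> L2w w h.
Proof. by case. Qed.

Lemma L2sD Ob w h k : spectral_density w -> L2s Ob w h -> L2s Ob w k ->
  L2s Ob w (fun l => h l + k l).
Proof.
move=> sw /L2sP[lh Hh] /L2sP[lk Hk]; have ww := spectral_weight sw.
apply: L2s_closed => //; first by have [] := L2wD ww lh lk.
move=> e e0; have e4 := divr_gt0 e0 (ltr0n R 4).
have [p tp hp] := Hh _ e4; have [q tq kq] := Hk _ e4.
exists (fun l => p l + q l); first by apply: L2s_trigpoly => //; exact: trigpolyD.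
have mp := measC_trigpoly tp; have mq := measC_trigpoly tq.
have -> : (fun l => h l + k l - (p l + q l)) = (fun l => (h l - p l) + (k l - q l)).
  by apply/funext => l; ring.
apply: le_trans (normw2D ww (measCB lh.1 mp) (measCB lk.1 mq)) _.
apply: (@le_trans _ _ (2%:E * (e / 4)%:E + 2%:E * (e / 4)%:E)%E).
  by apply: leeD; rewrite lee_pmul2l// ltW.
by rewrite -!EFinM -EFinD lee_fin; lra.
Qed.

Lemma L2sZ Ob w h (c : C) : spectral_density w -> L2s Ob w h -> L2s Ob w (fun l => c * h l).
Proof.
move=> sw /L2sP[lh Hh]; have ww := spectral_weight sw.
apply: L2s_closed => //; first by have [] := L2wZ c ww lh.
have c1 : 0 < cabs c ^+ 2 + 1 by rewrite ltr_wpDl// exprn_ge0// cabs_ge0.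
move=> e e0; have [p tp hp] := Hh _ (divr_gt0 e0 c1).
exists (fun l => c * p l); first by apply: L2s_trigpoly => //; exact: trigpolyZ.
have mp := measC_trigpoly tp.
have -> : (fun l => c * h l - c * p l) = (fun l => c * (h l - p l)).
  by apply/funext => l; rewrite mulrBr.
rewrite normw2Z//; last exact: measCB lh.1 mp.
apply: (@le_trans _ _ ((cabs c ^+ 2)%:E * (e / (cabs c ^+ 2 + 1))%:E)%E).
  by rewrite lee_wpmul2l ?lee_fin ?exprn_ge0 ?cabs_ge0// ltW.
rewrite -EFinM lee_fin mulrC; apply: ler_div1M (ltW e0) _.
by rewrite exprn_ge0 ?cabs_ge0.
Qed.

Lemma pairw_L2s_eq0 Ob w h y : spectral_density w -> L2s Ob w h -> L2w w y ->
  (forall t, Ob t -> pairw w (fun l => cexpi (t * l)) y = 0) -> pairw w h y = 0.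
Proof.
move=> sw /L2sP[lh Hh] ly y0; have ww := spectral_weight sw.
have tp0 p : trigpoly Ob p -> pairw w p y = 0.
  move=> [n [c [t [Ot ->]]]].
  elim: n c t Ot => [|n IH] c t Ot.
    have -> : (fun l => \sum_(i < 0) c i * cexpi (t i * l)) = (fun l => 0 * cexpi (0 * l)).
      by apply/funext => l; rewrite big_ord0 mul0r.
    by rewrite pairwZl ?mul0r//; exact: L2w_exp.
  have -> : (fun l => \sum_(i < n.+1) c i * cexpi (t i * l)) =
      (fun l => c ord0 * cexpi (t ord0 * l) +
        \sum_(i < n) c (lift ord0 i) * cexpi (t (lift ord0 i) * l)).
    by apply/funext => l; rewrite big_ord_recl.
  have lE u := L2w_exp u sw.
  rewrite pairwDl//; first last.
  - apply: (L2w_trigpoly sw (Ob := Ob)).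
    by exists n, (fun i => c (lift ord0 i)), (fun i => t (lift ord0 i)).
  - exact: L2wZ.
  by rewrite pairwZl// y0 // mulr0 add0r; exact: IH.
apply: pairw_eq0 => // e e0; have [p tp hp] := Hh _ e0.
by exists p; split; [exact: L2w_trigpoly tp|exact: ltW|exact: tp0].
Qed.

End MeanSquareError.

(** * Normal equations and existence of the optimal estimate *)

Section Minimizer.
Context {R : realType}.
Local Notation mu := (@lebesgue_measure R).
Local Notation C := R[i].
Implicit Types (x y h k A : R -> C) (w f g : R -> R) (Ob : set R) (t : R).

Lemma orthZ A h f g k (c : C) : weight f -> weight g -> L2w f A ->
  L2w (pairsum f g) h -> L2w (pairsum f g) k ->
  orth A h f g (fun l => c * k l) = conjc c * orth A h f g k.
Proof.
move=> wf wg lA lh lk.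
have [lhf lhg] := (L2w_pairsum h wf wg).1 lh.
have [lkf lkg] := (L2w_pairsum k wf wg).1 lk.
rewrite /orth.
have -> : (fun l => conjc (c * k l)) = (fun l => conjc c * conjc (k l)).
  by apply/funext => l; rewrite conjCM.
have lkfJ := L2wJ lkf; have lkgJ := L2wJ lkg; have lAh := L2wB wf lA lhf.
rewrite ![pairw _ _ (fun l => _ * conjc (k l))]pairwC !pairwZl//.
by rewrite ![pairw _ (fun l => conjc (k l)) _]pairwC mulrBr.
Qed.

Lemma qf_ge0 A h f g : weight f -> weight g -> 0 <= qf A h f g.
Proof. by move=> wf wg; rewrite addr_ge0// nrm_ge0. Qed.

(** The parallelogram identity of the error, from its expansions around [h] along k - h and along
    half of it. *)
Lemma qf_midpoint A h k f g : weight f -> weight g -> L2w f A ->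
  L2w (pairsum f g) h -> L2w (pairsum f g) k ->
  4 * qf A (fun l => h l + (2^-1)%:C * (k l - h l)) f g +
    nrm (pairsum f g) (fun l => k l - h l) = 2 * qf A h f g + 2 * qf A k f g.
Proof.
move=> wf wg lA lh lk; have wF := weight_pairsum wf wg.
have ld := L2wB wF lk lh.
have {3}-> : k = (fun l => h l + (k l - h l)) by apply/funext => l; ring.
rewrite !qfD//; last exact: L2wZ.
rewrite orthZ// nrmZ// cabs_real (@ger0_norm _ 2^-1)// conjc_real ReM /=.
by lra.
Qed.

Lemma cvgw2_pairsuml f g (x_ : nat -> R -> C) x : weight f -> weight g ->
  (forall n, measC setT (x_ n)) -> measC setT x ->
  cvgw2 (pairsum f g) x_ x -> cvgw2 f x_ x /\ cvgw2 g x_ x.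
Proof.
move=> wf wg mx_ mx cx; split => e e0; have [N HN] := cx e e0; exists N => n Nn;
  apply: le_trans (HN n Nn); rewrite normw2_pairsum//; try exact: measCB.
  by rewrite leeDl// normw2_ge0.
by rewrite leeDr// normw2_ge0.
Qed.

Lemma cvgw2J w (x_ : nat -> R -> C) x : cvgw2 w x_ x ->
  cvgw2 w (fun n l => conjc (x_ n l)) (fun l => conjc (x l)).
Proof.
move=> cx e e0; have [N HN] := cx e e0; exists N => n Nn.
apply: le_trans (HN n Nn); rewrite /normw2 le_eqVlt; apply/orP; left; apply/eqP.
by apply: eq_integral => l _; rewrite -conjCN -conjCD cabsJ.
Qed.

Lemma orth_cvg A h f g (h_ : nat -> R -> C) : weight f -> weight g -> L2w f A ->
  L2w (pairsum f g) h -> (forall n, L2w (pairsum f g) (h_ n)) ->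
  cvgw2 (pairsum f g) h_ h ->
  (fun n => cabs (orth A h f g (fun l => h_ n l - h l))) @ \oo --> (0 : R).
Proof.
move=> wf wg lA lh lh_ ch; have wF := weight_pairsum wf wg.
have [lhf lhg] := (L2w_pairsum h wf wg).1 lh.
have l2 n := (L2w_pairsum (h_ n) wf wg).1 (lh_ n).
have lAh := L2wB wf lA lhf.
have [cf cg] := cvgw2_pairsuml wf wg (fun n => (lh_ n).1) lh.1 ch.
have pf := pairw_cvg wf (fun n => L2wJ (l2 n).1) (L2wJ lhf) lAh (cvgw2J cf).
have pg := pairw_cvg wg (fun n => L2wJ (l2 n).2) (L2wJ lhg) lhg (cvgw2J cg).
set p := (fun n => _) in pf; set q := (fun n => _) in pg.
have cpq : (fun n => p n + q n) @ \oo --> (0 : R).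
  by rewrite -[X in _ --> X](addr0 (0 : R)); exact: cvgD.
apply: (@squeeze_cvgr _ _ _ _ (cst 0) (fun n => p n + q n)) => //; last exact: cvg_cst.
  apply: nearW => n; apply/andP; split; first exact: cabs_ge0.
  rewrite /orth.
  have -> : (fun l => conjc (h_ n l - h l)) = (fun l => conjc (h_ n l) - conjc (h l)).
    by apply/funext => l; rewrite conjCD conjCN.
  rewrite ![pairw _ _ (fun l => conjc _ - _)]pairwC.
  have [l2f l2g] := l2 n.
  rewrite !pairwBl//; try exact: L2wJ.
  by apply: le_trans (cabsD _ _) _; rewrite cabsN.
Qed.

Lemma orth_optimal Ob A h f g : spectral_density f -> spectral_density g -> L2w f A ->
  L2s Ob (pairsum f g) h ->
  (forall k, L2s Ob (pairsum f g) k -> orth A h f g k = 0) ->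
  is_optimal Ob A f g h.
Proof.
move=> sf sg lA sh orth0; have wf := spectral_weight sf; have wg := spectral_weight sg.
have sF : spectral_density (pairsum f g).
  have [f0 fi] := sf; have [g0 gi] := sg.
  split=> [l|]; first by rewrite addr_ge0.
  by have := integrableD measurableT fi gi; exact: eq_integrable.
split => // h' sh'.
have lh := L2s_L2w sh; have lh' := L2s_L2w sh'.
have wF := weight_pairsum wf wg.
have [lhf lhg] := (L2w_pairsum h wf wg).1 lh.
have [lhf' lhg'] := (L2w_pairsum h' wf wg).1 lh'.
rewrite !mseE//; [|exact: L2wB..].
rewrite lee_fin ler_pM2l ?invr_gt0 ?mulr_gt0 ?pi_gt0//.
have E : h' = (fun l => h l + (h' l - h l)) by apply/funext => l; ring.
rewrite [in leRHS]E.
have ld := L2wB wF lh' lh.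
rewrite (qfD wf wg lA lh ld) orth0; last first.
  have := L2sD sF sh' (L2sZ (-1) sF sh).
  by congr (L2s _ _ _); apply/funext => l; rewrite mulN1r.
by rewrite /= mulr0 subr0 lerDl nrm_ge0.
Qed.

Lemma spectral_pairsum f g : spectral_density f -> spectral_density g ->
  spectral_density (pairsum f g).
Proof.
move=> [f0 fi] [g0 gi].
split=> [l|]; first by rewrite addr_ge0.
by have := integrableD measurableT fi gi; exact: eq_integrable.
Qed.

Lemma optimal_orth Ob A h f g k : spectral_density f -> spectral_density g -> L2w f A ->
  is_optimal Ob A f g h -> L2s Ob (pairsum f g) k -> orth A h f g k = 0.
Proof.
move=> sf sg lA [sh hmin] sk; have wf := spectral_weight sf; have wg := spectral_weight sg.
have sF := spectral_pairsum sf sg; have wF := spectral_weight sF.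
have lh := L2s_L2w sh; have lk := L2s_L2w sk.
apply: orth_eq0_of_min => // c.
have sh' := L2sD sF sh (L2sZ c sF sk).
have := hmin _ sh'; have lh' := L2s_L2w sh'.
have [lhf lhg] := (L2w_pairsum h wf wg).1 lh.
have [lhf' lhg'] := (L2w_pairsum _ wf wg).1 lh'.
rewrite !mseE//; [|exact: L2wB..].
by rewrite lee_fin ler_pM2l ?invr_gt0 ?mulr_gt0 ?pi_gt0.
Qed.

(* Any minimizing sequence is Cauchy by the parallelogram identity. *)
Lemma optimal_exists Ob A f g : spectral_density f -> spectral_density g ->
  L2w f A -> exists h, is_optimal Ob A f g h.
Proof.
move=> sf sg lA; have wf := spectral_weight sf; have wg := spectral_weight sg.
have sF := spectral_pairsum sf sg; have wF := spectral_weight sF.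
pose S := [set qf A h f g | h in L2s Ob (pairsum f g)].
pose d := inf S.
have S0 : has_inf S.
  split; first by exists (qf A (fun=> 0) f g), (fun=> 0) => //; exact: L2s_trigpoly (trigpoly0 _).
  by exists 0 => _ [h _ <-]; exact: qf_ge0.
have dle h : L2s Ob (pairsum f g) h -> d <= qf A h f g.
  by move=> sh; apply: (ge_inf S0.2); exists h.
have /choice[h_ Hh] (n : nat) : exists h, L2s Ob (pairsum f g) h /\ qf A h f g <= d + n.+1%:R^-1.
  have n0 : 0 < n.+1%:R^-1 :> R by rewrite invr_gt0.
  have [_ [h sh <-] hd] := inf_adherent n0 S0.
  by exists h; split => //; exact: ltW.
have sh_ n : L2s Ob (pairsum f g) (h_ n) := (Hh n).1.
have lh_ n := L2s_L2w (sh_ n).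
have small (e : R) : 0 < e -> exists N, forall n, (N <= n)%N -> n.+1%:R^-1 <= e.
  move=> e0; have /cvgrPdist_le/(_ _ e0)[N _ HN] := @cvg_harmonic R.
  by exists N => n /HN; rewrite /= sub0r normrN ger0_norm.
have [e e0|h mh ch] := weighted_L2_complete wF (fun n => (lh_ n).1).
  have [N HN] := small _ (divr_gt0 e0 (ltr0n R 4)); exists N => n m Nn Nm.
  rewrite (nrmE wF (L2wB wF (lh_ n) (lh_ m))) lee_fin.
  have := qf_midpoint wf wg lA (lh_ m) (lh_ n).
  set mid := (fun l => h_ m l + _).
  have smid : L2s Ob (pairsum f g) mid.
    have s1 := L2sZ (2^-1)%:C sF (L2sD sF (sh_ n) (L2sZ (-1) sF (sh_ m))).
    have := L2sD sF (sh_ m) s1; congr (L2s _ _ _); apply/funext => l.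
    by rewrite /mid mulN1r.
  have := dle _ smid; have := (Hh n).2; have := (Hh m).2.
  have := HN _ Nn; have := HN _ Nm.
  by move: (m.+1%:R^-1) (n.+1%:R^-1) => u v; lra.
have sh : L2s Ob (pairsum f g) h.
  apply: L2s_closed => // e e0; have [N HN] := ch e e0.
  by exists (h_ N) => //; rewrite normw2_distC; exact: HN.
have lh := L2s_L2w sh.
exists h; split => // h' sh'; have lh' := L2s_L2w sh'.
have [lhf lhg] := (L2w_pairsum h wf wg).1 lh.
have [lhf' lhg'] := (L2w_pairsum h' wf wg).1 lh'.
rewrite !mseE//; [|exact: L2wB..].
rewrite lee_fin ler_pM2l ?invr_gt0 ?mulr_gt0 ?pi_gt0//.
apply: le_trans (dle _ sh'); apply/ler_addgt0Pr => e e0.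
have e4 := divr_gt0 e0 (ltr0n R 4).
(* In the expansion of the error of [h_ n] around [h] the quadratic term is nonnegative and the
   linear term tends to 0, so the error of [h] exceeds the infimum by at most 2 e/4 + e/4. *)
have /cvgrPdist_le/(_ _ e4)[N1 _ H1] := orth_cvg wf wg lA lh lh_ ch.
have [N2 H2] := small _ e4.
pose n := maxn N1 N2.
have := H1 n (leq_maxl _ _); rewrite sub0r normrN (ger0_norm (cabs_ge0 _)) => h1.
have h2 := H2 n (leq_maxr _ _).
have h3 := (Hh n).2; have ld := L2wB wF (lh_ n) lh.
have E : h_ n = (fun l => h l + (h_ n l - h l)) by apply/funext => l; ring.
rewrite E (qfD wf wg lA lh ld) in h3.
have h4 := nrm_ge0 (fun l => h_ n l - h l) wF.
have := Re_le_cabs (orth A h f g (fun l => h_ n l - h l)).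
rewrite ler_norml => /andP[h5 h6].
by move: h2 h3; move: (n.+1%:R^-1) => u h2 h3; lra.
Qed.

End Minimizer.

(** * Functions with spectrum off T, and bounded ones among them *)

Section SpectralSubspace.
Context {R : realType}.
Local Notation mu := (@lebesgue_measure R).
Local Notation C := R[i].
Local Notation w1 := (fun=> 1%R : R).
Implicit Types (x y h k A : R -> C) (w f g : R -> R) (T Ob D : set R) (s t : R).

Let W1 : weight w1 := weight1.

Lemma L2C_extend0 D x : measurable D -> L2C D x -> L2w w1 (extend0 D x).
Proof.
move=> mD [mx xo]; split; first exact: (measC_extend0 _ mD).1.
rewrite normw2_1; rewrite integral_mkcond in xo.
apply: le_lt_trans xo; rewrite le_eqVlt; apply/orP; left; apply/eqP.
apply: eq_integral => t _; rewrite patchE; have [Dt|Dt] := pselect (D t).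
  by rewrite extend0_in// mem_set.
by rewrite extend0_out// memNset// cabs0 expr0n.
Qed.

Lemma is_fourierL2P s D x (X : R -> C) : is_fourierL2 s D x X <-> fourier2 s (extend0 D x) X.
Proof.
rewrite /is_fourierL2 /fourier2 L2CP.
have E n : (\int[mu]_l (cabs (X l - fourierL1 s (D `&` `[- n%:R, n%:R]%classic) x l) ^+ 2)%:E)%E =
    normw2 w1 (fun l => fourierL1 s setT (extend0 (trunc n) (extend0 D x)) l - X l).
  rewrite normw2_distC normw2_1; apply: eq_integral => l _.
  rewrite fourierL1_extend0 (_ : extend0 _ x = extend0 (trunc n) (extend0 D x))//.
  by apply/funext => t; exact: extend0I.
have -> : (fun n : nat => \int[mu]_l (cabs (X l -
    fourierL1 s (D `&` `[- n%:R, n%:R]%classic) x l) ^+ 2)%:E)%E =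
    (fun n => normw2 w1 (fun l => fourierL1 s setT (extend0 (trunc n) (extend0 D x)) l - X l)).
  by apply/funext => n; rewrite E.
by split=> -[lX /(cvgw2P _ _ W1) cX].
Qed.

Lemma fourier_fourier2 s D x : s ^+ 2 = 1 -> measurable D -> L2C D x ->
  fourier2 s (extend0 D x) (fourier s D x).
Proof.
move=> s1 mD lx; have lx' := L2C_extend0 mD lx.
rewrite /fourier; case: asboolP => [ix|_].
  rewrite (_ : fourierL1 s D x = fourierL1 s setT (extend0 D x)).
    by apply: fourier2_L1 => //; exact: (integrableC_extend0 _ mD).1.
  by apply/funext => l; rewrite fourierL1_extend0.
have [X fX] := fourier2_exists s1 lx'.
have /xgetPex : exists X, [set X | is_fourierL2 s D x X] X.
  by exists X; apply/is_fourierL2P.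
by move=> /(_ (fun=> 0)) /is_fourierL2P.
Qed.

Lemma extend0J D x t : extend0 D (fun u => conjc (x u)) t = conjc (extend0 D x t).
Proof. by rewrite /extend0; case: asboolP => // _; rewrite conjc0. Qed.

Lemma fourier2J s x (X : R -> C) : s ^+ 2 = 1 -> L2w w1 x -> fourier2 s x X ->
  fourier2 (- s) (fun t => conjc (x t)) (fun l => conjc (X l)).
Proof.
move=> s1 lx [lX cX]; split; first exact: L2wJ.
rewrite (_ : (fun n => _) = (fun n l => conjc (fourierL1 s setT (extend0 (trunc n) x) l))).
  exact: cvgw2J.
apply/funext => n; apply/funext => l; rewrite fourierL1J; last exact: integrable_L2_trunc.
by congr fourierL1; apply/funext => t; rewrite extend0J.
Qed.

(** The space W. If one representative of the transform vanishes almost everywhere on [T], all of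
    them do. *)
Definition spectrum_off T h := L2w w1 h /\
  exists2 Y, fourier2 (-1) h Y & {ae mu, forall t, T t -> Y t = 0}.

Lemma sqrN1 : (-1) ^+ 2 = 1 :> R.
Proof. by rewrite sqrrN expr1n. Qed.

(** The multiplication formula turns the pairing into the integral of the transform of [h], zero on
    [T], against the conjugate of a function that is zero off [T]. *)
Lemma pairw_spectrum_off T h c (X : R -> C) : measurable T -> spectrum_off T h ->
  L2C T c -> fourier2 1 (extend0 T c) X -> pairw w1 h (fun l => conjc (X l)) = 0.
Proof.
move=> mT [lh [Y fY Y0]] lc fX.
have le := L2C_extend0 mT lc.
have fJ := fourier2J (expr1n _ 2) le fX.
rewrite -(fourier2_mult sqrN1 lh (L2wJ le) fY fJ).
rewrite pairw1 (@ae_eq_integralC _ setT _ (fun=> 0))//.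
- by apply: complex_ext; rewrite /= /Rintegral integral0.
- by apply: measCM; [case: fY => -[]|exact: (L2wJ le).1].
- apply: aeS Y0 => t Y0 _; have [Tt|Tt] := pselect (T t).
    by rewrite Y0// mul0r.
  by rewrite extend0_out// conjc0 mulr0.
Qed.

Lemma spectrum_offB T h k : spectrum_off T h -> spectrum_off T k ->
  spectrum_off T (fun l => h l - k l).
Proof.
move=> [lh [Y fY Y0]] [lk [Z fZ Z0]]; split; first exact: L2wB.
exists (fun l => Y l - Z l); first exact: fourier2B sqrN1 _ _ _ _.
by apply: aeS (ae_and Y0 Z0) => t [y0 z0] Tt; rewrite y0// z0// subrr.
Qed.

Lemma L2w_ae_bounded w x (K : R) : spectral_density w -> measC setT x ->
  {ae mu, forall l, cabs (x l) <= K} -> L2w w x.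
Proof.
move=> sw mx xK; have ww := spectral_weight sw.
pose y l := if cabs (x l) <= K then x l else 0.
have E : y = extend0 [set l | cabs (x l) <= K] x.
  by apply/funext => l; rewrite /y /extend0; case: asboolP => [/= ->//|/negP/negbTE ->].
have my : measC setT y.
  rewrite E; apply: measC_extend0T => //.
  have := measurable_fun_ler (measurable_cabs mx) (measurable_cst K).
  move=> /(_ measurableT [set true] Logic.I).
  by rewrite setTI; congr measurable; apply/seteqP; split.
have ly : L2w w y.
  apply: (@L2w_bounded _ w y `|K|) => // l; rewrite /y; case: ifP => [h|_].
    by rewrite (le_trans h)// ler_norm.
  by rewrite cabs0.
split => //; rewrite (ae_eq_normw2 (y := y) ww)//; first by case: ly.
by apply: aeS xK => l h; right; rewrite /y h.
Qed.

Lemma L2w_decay s (y : R) t : 0 < y ->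
  L2w w1 (fun l => (decay y l)%:C * cexpi (s * t * l)).
Proof.
move=> y0.
have md : measC setT (fun l => (decay y l)%:C * cexpi (s * t * l)).
  by apply: measCM; [exact: measC_decay|exact: measC_cexpil].
split => //; rewrite normw2_1.
have := integrable_lty measurableT (integrable_decay y0); apply: le_lt_trans.
apply: ge0_le_integral => //.
- by move=> l _; rewrite lee_fin exprn_ge0// cabs_ge0.
- by apply/measurable_EFinP; apply: measurable_funX; exact: measurable_cabs.
- by apply/measurable_EFinP; exact: measurable_decay.
- move=> l _; rewrite lee_fin cabsM cabs_cexpi mulr1 cabs_decay expr2.
  by rewrite ler_piMr ?decay_le1 ?ltW ?decay_gt0.
Qed.

(** Dominated convergence is applied to the moduli |x_n - x|, under the bound p + |x|. *)
Lemma integralC_dominated0 (x_ : nat -> R -> C) x (p : R -> R) :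
  (forall n, measC setT (x_ n)) -> measC setT x -> mu.-integrable setT (EFin \o p) ->
  {ae mu, forall l, forall n, cabs (x_ n l) <= p l} ->
  {ae mu, forall l, (fun n => cabs (x_ n l - x l)) @ \oo --> (0 : R)} ->
  integrableC setT x ->
  (forall n, integrableC setT (x_ n) /\ integralC setT (x_ n) = 0) ->
  integralC setT x = 0.
Proof.
move=> mx_ mx ip xp cx ix ix_.
have ip2 : mu.-integrable setT (EFin \o (fun l => p l + cabs (x l))).
  have := @integrableD _ _ _ mu _ measurableT _ _ ip (integrable_cabs measurableT ix).
  exact: eq_integrable.
have md n : measurable_fun setT (fun l => (cabs (x_ n l - x l))%:E).
  by apply: measurable_cabsE; exact: measCB.
have cv : {ae mu, forall l, setT l -> (cabs (x_ n l - x l))%:E @[n --> \oo] --> (cst 0%E) l}.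
  by apply: aeS cx => l cl _; apply: cvg_EFin; first exact: nearW.
have dom : {ae mu, forall l n, setT l ->
    (`|(cabs (x_ n l - x l)%R)%:E| <= (EFin \o (fun l : R => (p l + cabs (x l))%R)) l)%E}.
  apply: aeS xp => l xp n _; rewrite /= lee_fin ger0_norm ?cabs_ge0//.
  by apply: le_trans (cabsD _ _) _; rewrite cabsN lerD2r.
have [_ _] := @dominated_convergence _ _ _ mu setT measurableT
  (fun n l => (cabs (x_ n l - x l))%:E) (cst 0%E) _ md (measurable_cst _) cv ip2 dom.
rewrite integral0 => h.
apply/eqP; rewrite -cabs_eq0 eq_le cabs_ge0 andbT -lee_fin.
change ((cabs (integralC setT x))%:E <= 0)%E.
rewrite -[leRHS](cvg_lim _ h)//; apply: lime_ge; first exact: cvgP h.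
apply: nearW => n; have [ixn xn0] := ix_ n.
have -> : cabs (integralC setT x) = cabs (integralC setT (fun l => x_ n l - x l)).
  by rewrite integralCB// xn0 sub0r cabsN.
by apply: cabs_integralC => //; exact: integrableCB.
Qed.

(* The Abel means [h_n] of the Fourier integral of [h] are bounded by [K], being
   Poisson averages of [h], so they converge to [h] in the weak-* sense even though
   the transform of [h] need not be integrable. *)
Lemma integral_bounded_spectrum0 T Ob h (G : R -> C) (K : R) :
  (forall t, T t \/ Ob t) -> spectrum_off T h -> {ae mu, forall l, cabs (h l) <= K} ->
  integrableC setT G -> (forall t, Ob t -> fourierL1 (-1) setT G t = 0) ->
  integralC setT (fun l => conjc (h l) * G l) = 0.
Proof.
move=> TO [lh [Y fY Y0]] hK iG G0.
have lY := fY.1; have mh := lh.1; have mG := integrableC_measC iG.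
have s1 : 1 ^+ 2 = 1 :> R by rewrite expr1n.
pose q n t := (decay (abel_scale n) t)%:C * Y t.
have y0 n := @abel_scale_gt0 R n.
have ld n : L2w w1 (fun t => (decay (abel_scale n) t)%:C : C).
  have := L2w_decay 0 0 (y0 n).
  congr (L2w _ _); apply/funext => t; by rewrite !mul0r cexpi0 mulr1.
have iq n : integrableC setT (q n).
  have := integrable_pairw W1 (ld n) lY.
  by congr (integrableC _ _); apply/funext => t; rewrite mulr1.
have lq n : L2w w1 (q n).
  apply: (L2w_le W1 lY); first exact: integrableC_measC.
  move=> t; rewrite cabsM cabs_decay ler_piMl ?cabs_ge0// decay_le1// ltW//.
pose H n := fourierL1 1 setT (q n).
have fH n : fourier2 1 (q n) (H n) by exact: fourier2_L1.
have [K' fK'] := fourier2_exists s1 lY.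
have cH : cvgw2 w1 H K' := fourier2_cvg s1 lq lY fH fK' (cvgw2_decay W1 lY).
have K'E : {ae mu, forall l, K' l = (2 * pi)%:C * h l}.
  have fK2 : fourier2 (- -1) Y K' by rewrite opprK.
  exact: (fourier2_inversion sqrN1 lh fY fK2).
have mH n : measC setT (H n) by case: (fH n) => -[].
have HE n l : H n l = integralC setT (fun v => h v * (poisson (abel_scale n) (l - v))%:C).
  have lde := L2w_decay 1 l (y0 n).
  have ide : integrableC setT (fun t => (decay (abel_scale n) t)%:C * cexpi (1 * l * t)).
    apply: (@integrableCMb _ _ _ _ 1) => //; first exact: integrableC_decay.
      exact: measC_cexpil.
    by move=> t _; rewrite cabs_cexpi.
  have := fourier2_mult sqrN1 lh lde fY (fourier2_L1 sqrN1 ide lde).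
  rewrite !pairw1 => E.
  transitivity (integralC setT (fun t => Y t * ((decay (abel_scale n) t)%:C * cexpi (1 * l * t)))).
    rewrite /H /fourierL1; apply: eq_integralC => t _; rewrite /q -mulrA mulrCA.
    by congr (_ * (_ * cexpi _)); rewrite !mul1r mulrC.
  rewrite E; apply: eq_integralC => v _.
  by rewrite (@fourierL1_modulated_decay _ 1).
(* The bound on [h] holds only almost everywhere; a negative [K] would make the whole line a null
   set, while [0, 1] has measure 1. *)
have K0 : 0 <= K.
  apply: contrapT => /negP; rewrite -ltNge => Kn.
  have : {ae mu, forall l : R, False}.
    by apply: aeS hK => l h1; have := le_lt_trans h1 Kn; rewrite ltNge cabs_ge0.
  case=> Z [mZ Z0 ZT]; have : (mu setT <= 0)%E.
    by rewrite -Z0 le_measure ?inE//; move=> t _; apply: ZT.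
  have := @lebesgue_measure_itv R `[0, 1]; rewrite /= lte_fin ltr01 => h01.
  move=> hT; have : (mu `[0%R, 1%R] <= 0)%E by apply: le_trans hT; rewrite le_measure ?inE.
  by rewrite h01 -EFinB subr0 lee_fin ler10.
have HK n l : cabs (H n l) <= 2 * pi * K.
  rewrite HE -lee_fin.
  have pC : (fun v : R => poisson (abel_scale n) (l - v)) = (fun v => poisson (abel_scale n) (v - l)).
    by apply/funext => v; rewrite -opprB poissonN.
  have mp : measurable_fun setT (fun v : R => poisson (abel_scale n) (l - v)).
    by rewrite pC; exact: measurable_poisson.
  have lp : L2w w1 (fun v => (poisson (abel_scale n) (l - v))%:C : C).
    have E : (fun v => (poisson (abel_scale n) (l - v))%:C) =
        fourierL1 (-1) setT (fun t => (decay (abel_scale n) t)%:C * cexpi (1 * l * t)).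
      by apply/funext => v; rewrite (@fourierL1_modulated_decay _ 1).
    rewrite E; apply: L2w_fourierL1; [exact: sqrN1| |exact: L2w_decay].
    apply: (@integrableCMb _ _ _ _ 1) => //; first exact: integrableC_decay.
      exact: measC_cexpil.
    by move=> t _; rewrite cabs_cexpi.
  have ihp : integrableC setT (fun v => h v * (poisson (abel_scale n) (l - v))%:C).
    have := integrable_pairw W1 lh lp.
    by congr (integrableC _ _); apply/funext => t; rewrite mulr1.
  apply: le_trans (cabs_integralC measurableT ihp) _.
  apply: (@le_trans _ _ (\int[mu]_v (K%:E * (poisson (abel_scale n) (l - v))%:E))%E).
    apply: ae_ge0_le_integral => //.
    - by move=> v _; rewrite lee_fin cabs_ge0.
    - by apply: measurable_cabsE; exact: integrableC_measC ihp.
    - by move=> v _; rewrite -EFinM lee_fin mulr_ge0// poisson_ge0.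
    - by apply: measurable_funeM; exact/measurable_EFinP.
    - apply: aeS hK => v hv _; rewrite -EFinM lee_fin cabsM cabs_real.
      by rewrite ger0_norm ?poisson_ge0// ler_wpM2r ?poisson_ge0.
  rewrite ge0_integralZl//; last 2 first.
  - exact/measurable_EFinP.
  - by move=> v _; rewrite lee_fin poisson_ge0.
  rewrite [leRHS]EFinM muleC lee_wpmul2r ?lee_fin//.
  have := integral_poisson_le l (y0 n).
  by under eq_integral do rewrite -opprB poissonN.
(* Means chosen with geometrically small errors converge almost everywhere, as dominated convergence
   requires. *)
have /choice[phi Hphi] (n : nat) : exists N,
    (normw2 w1 (fun l => H N l - K' l)%R <= ((8^-1 : R) ^+ n.+1)%:E)%E.
  have e0 : 0 < (8^-1 : R) ^+ n.+1 by rewrite exprn_gt0.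
  by have [N HN] := cH _ e0; exists N; exact: HN.
have mK' : measC setT K' by case: fK' => -[].
have aeC := geometric_normw2_ae W1 (fun n => measCB (mH (phi n)) mK') Hphi.
have iKG : mu.-integrable setT (EFin \o (fun l => 2 * pi * K * cabs (G l))).
  have := @integrableZl _ _ _ mu _ measurableT (2 * pi * K) _ (integrable_cabs measurableT iG).
  exact: eq_integrable.
have K'b : {ae mu, forall l, cabs (K' l) <= 2 * pi * K}.
  apply: aeS (ae_and K'E hK) => l [-> hl]; rewrite cabsM cabs_real.
  have p2 := @pi2_gt0 R.
  by rewrite ger0_norm ?(ltW p2)// ler_pM2l.
have mKG : measC setT (fun l => conjc (K' l) * G l) by apply: measCM => //; exact: measCJ.
have iK' : integrableC setT (fun l => conjc (K' l) * G l).
  apply/integrableCP => //; split => //.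
  apply: le_lt_trans (integrable_lty measurableT iKG).
  apply: ae_ge0_le_integral => //.
  - by move=> l _; rewrite lee_fin cabs_ge0.
  - exact: measurable_cabsE.
  - by move=> l _; rewrite lee_fin mulr_ge0 ?cabs_ge0// mulr_ge0// ltW// pi2_gt0.
  - by case/integrableP: iKG.
  - by apply: aeS K'b => l hl _; rewrite lee_fin cabsM cabsJ ler_wpM2r ?cabs_ge0.
have E0 : integralC setT (fun l => conjc (K' l) * G l) = 0.
  apply: (@integralC_dominated0 (fun n l => conjc (H (phi n) l) * G l) _
    (fun l => 2 * pi * K * cabs (G l))) => //.
  - by move=> n; apply: measCM => //; exact: measCJ.
  - by apply: aeT => l n; rewrite cabsM cabsJ ler_wpM2r ?cabs_ge0.
  - apply: aeS aeC => l [/eqP|[M M0 HM]]; first by rewrite oner_eq0.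
    apply: (@le_geometric_cvg0 _ _ (M * cabs (G l))) => n; first exact: cabs_ge0.
    rewrite -mulrBl -raddfB cabsM cabsJ mulrAC.
    by rewrite ler_wpM2r ?cabs_ge0.
  move=> n; split.
    under eq_fun do rewrite mulrC.
    apply: (@integrableCMb _ _ _ _ (2 * pi * K)) => //; first exact: measCJ.
    by move=> l _; rewrite cabsJ.
  (* The conjugate of a mean is itself a transform, so the multiplication formula leaves the
     integral of a product with one factor zero on [T] and the other zero on [Ob]. *)
  have -> : (fun l => conjc (H (phi n) l) * G l) =
      (fun l => fourierL1 (-1) setT (fun t => conjc (q (phi n) t)) l * G l).
    by apply/funext => l; rewrite /H fourierL1J.
  rewrite fourierL1_mult//; last exact: integrableCJ.
  rewrite (@ae_eq_integralC _ setT _ (fun=> 0))//.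
  - by apply: complex_ext; rewrite /= /Rintegral integral0.
  - apply: measCM; last exact: measC_fourierL1.
    by apply: measCJ; exact: integrableC_measC.
  - apply: aeS Y0 => t Yt _; have [Tt|/G0 ->] := TO t; last by rewrite mulr0.
    by rewrite /q Yt// mulr0 conjc0 mul0r.
apply: (@mulfI _ ((2 * pi)%:C)); first by rewrite -cabs_eq0 cabs_real gt_eqF// normr_gt0 gt_eqF// pi2_gt0.
have ihG : integrableC setT (fun l => conjc (h l) * G l).
  apply/integrableCP => //; split; first by apply: measCM => //; exact: measCJ.
  have iKG' := @integrableZl _ _ _ mu _ measurableT K _ (integrable_cabs measurableT iG).
  apply: le_lt_trans (integrable_lty measurableT iKG').
  apply: ae_ge0_le_integral => //.
  - by move=> l _; rewrite lee_fin cabs_ge0.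
  - by apply: measurable_cabsE; apply: measCM => //; exact: measCJ.
  - by move=> l _; rewrite lee_fin mulr_ge0 ?cabs_ge0.
  - by case/integrableP: iKG'.
  - by apply: aeS hK => l hl _; rewrite lee_fin cabsM cabsJ ler_wpM2r ?cabs_ge0.
rewrite mulr0 -E0 -integralCZl//; apply: ae_eq_integralC => //.
  by apply: integrableC_measC; exact: integrableCZl.
apply: aeS K'E => l -> _; rewrite conjCM mulrA.
by congr (_ * _ * _); apply: complex_ext; rewrite /= ?oppr0.
Qed.

Lemma pairwJ_nrm w x : pairw w x (fun l => conjc (x l)) = (nrm w x)%:C.
Proof.
rewrite nrm_Rintegral /pairw; apply: complex_ext.
  by apply: eq_Rintegral => l _; rewrite mulJ_cabs -rmorphM.
rewrite (_ : complex.Im _ = \int[mu]_(l in setT) (0 : R)); first by rewrite /Rintegral integral0.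
by apply: eq_Rintegral => l _; rewrite mulJ_cabs -rmorphM.
Qed.

Lemma pairw0 x y : pairw (fun=> 0) x y = 0.
Proof.
rewrite /pairw; under eq_fun do rewrite mulr0.
by apply: complex_ext; rewrite /= /Rintegral integral0.
Qed.

Lemma spectral_density0 : spectral_density (fun=> 0 : R).
Proof. by split => //; exact: integrable0. Qed.

(* The residual [h - k] of the projection [k] is orthogonal to all exponentials
   of [Ob], hence to [h] as well. *)
Lemma L2s_bounded_spectrum T Ob w h (K : R) : (forall t, T t \/ Ob t) ->
  spectral_density w -> spectrum_off T h -> {ae mu, forall l, cabs (h l) <= K} ->
  L2s Ob w h.
Proof.
move=> TO sw sh hK; have ww := spectral_weight sw; have s0 := spectral_density0.
have lh : L2w w h by apply: L2w_ae_bounded hK => //; case: sh => -[].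
have E0 : pairsum w (fun=> 0) = w by apply/funext => l; rewrite /pairsum addr0.
(* With noise density 0 the error is proportional to the squared distance from [h], so the optimal
   estimate is the orthogonal projection. *)
have [k ok] := optimal_exists Ob sw s0 lh.
have lks : L2s Ob w k by move: (ok.1); rewrite E0.
have lk := L2s_L2w lks; pose r l := h l - k l.
have lr : L2w w r by exact: L2wB.
have orth0 e : L2s Ob w e -> pairw w r (fun l => conjc (e l)) = 0.
  move=> le; have := optimal_orth (k := e) sw s0 lh ok.
  by rewrite E0 /orth pairw0 subr0; apply.
have l1 : L2w w (fun=> 1) 
  by apply: (L2w_bounded (K := 1) sw (measC_cst _ _)) => l; rewrite (@cabs_real R) normr1.
have iG : integrableC setT (fun l => r l * (w l)%:C).
  have := integrable_pairw ww lr l1.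
  by congr (integrableC _ _); apply/funext => l; rewrite mulr1.
have G0 t : Ob t -> fourierL1 (-1) setT (fun l => r l * (w l)%:C) t = 0.
  move=> Ot; rewrite -(orth0 _ (L2s_trigpoly sw (trigpoly_exp Ot))).
  apply: eq_integralC => l _; rewrite cexpiJ mulrAC.
  by congr (_ * cexpi _ * _); rewrite mulN1r mulNr mulrC.
have := integral_bounded_spectrum0 TO sh hK iG G0.
rewrite (_ : integralC _ _ = pairw w r (fun l => conjc (h l))); last first.
  by apply: eq_integralC => l _; rewrite mulrA [_ * r l]mulrC.
move=> rh0; apply: L2s_closed => //; first exact: lh.1.
move=> e e0; exists k => //; rewrite -/r (L2w_fin ww lr) lee_fin.
suff : pairw w r (fun l => conjc (r l)) = 0.
  by rewrite pairwJ_nrm => -[]; rewrite /nrm => ->; exact: ltW.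
rewrite pairwC (_ : (fun l => conjc (r l)) = (fun l => conjc (h l) - conjc (k l))); last first.
  by apply/funext => l; rewrite /r conjCD conjCN.
by rewrite pairwBl//; [rewrite ![pairw w _ r]pairwC rh0 orth0// subrr|exact: L2wJ|exact: L2wJ].
Qed.

End SpectralSubspace.

(** * The characteristic built from B^-1 R a *)

Section OptimalCharacteristic.
Context {R : realType}.
Local Notation mu := (@lebesgue_measure R).
Local Notation C := R[i].
Local Notation w1 := (fun=> 1%R : R).
Implicit Types (x y h k A : R -> C) (w f g : R -> R) (T Ob D : set R) (s t : R).

Let W1 : weight w1 := weight1.

(** Here [c] is the function C of the frequency; in [FixedDensities] the letter denotes its preimage
    B^-1 R a, a function of time. *)
Definition schar A (c : R -> C) f g : R -> C :=
  fun l => (A l * (f l)%:C - c l) / (f l + g l)%:C.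

Lemma conjc_real (r : R) : conjc r%:C = r%:C :> C.
Proof. by apply: complex_ext; rewrite /= ?oppr0. Qed.

Lemma measC_invsum f g x : weight f -> weight g -> measC setT x -> measC setT (invsum f g x).
Proof. by move=> [mf _] [mg _] mx; apply: measC_divr => //; exact: measurable_funD. Qed.

Lemma ratio_le1 (u v : R) : 0 <= u -> 0 <= v -> u / (u + v) <= 1.
Proof.
move=> u0 v0; have [->|u1] := eqVneq u 0; first by rewrite mul0r.
by rewrite ler_pdivrMr ?mul1r ?lerDl// ltr_pwDl// lt0r u1.
Qed.

Lemma cabs_invsum_le f g A l : 0 <= f l -> 0 <= g l ->
  cabs (invsum f g (fun l => (f l)%:C * A l) l) <= cabs (A l).
Proof.
move=> f0 g0; rewrite /invsum cabs_divr cabsM cabs_real !ger0_norm ?addr_ge0//.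
by rewrite mulrAC ler_piMl ?cabs_ge0 ?ratio_le1.
Qed.

Lemma cabs_invsumM_le f g A l : 0 <= f l -> 0 <= g l ->
  cabs (invsum f g (fun l => (f l * g l)%:C * A l) l) <= cabs (A l) * f l.
Proof.
move=> f0 g0; rewrite /invsum cabs_divr (cabsM (f l * g l)%:C) cabs_real.
rewrite !ger0_norm ?addr_ge0 ?mulr_ge0//.
have -> : f l * g l * cabs (A l) / (f l + g l) = (cabs (A l) * f l) * (g l / (g l + f l)).
  by rewrite [g l + f l]addrC; ring.
by apply: ler_piMr; [apply: mulr_ge0 => //; exact: cabs_ge0|exact: ratio_le1].
Qed.

(** With h = (z f - v)/(f + g) one has z - h = (z g + v)/(f + g), and in |z - h|^2 f + |h|^2 g the
    cross terms cancel, leaving (|v|^2 + f g |z|^2)/(f + g). At zeros of f + g both sides are 0. *)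
Lemma qf_integrand f g (z v : C) l : 0 <= f l -> 0 <= g l ->
  v / (f l + g l)%:C * conjc v + (f l * g l)%:C * z / (f l + g l)%:C * conjc z =
  (z - (z * (f l)%:C - v) / (f l + g l)%:C) *
    conjc (z - (z * (f l)%:C - v) / (f l + g l)%:C) * (f l)%:C +
  (z * (f l)%:C - v) / (f l + g l)%:C *
    conjc ((z * (f l)%:C - v) / (f l + g l)%:C) * (g l)%:C.
Proof.
move=> f0 g0; have [F0|F0] := eqVneq (f l + g l) 0.
  have fl0 : f l = 0 by apply/eqP; rewrite eq_le f0 andbT -F0 lerDl.
  by move: F0; rewrite fl0 add0r => ->; rewrite !invr0 !mulr0 !mul0r.
have F0' : (f l)%:C + (g l)%:C != 0 :> C.
  by rewrite -rmorphD/= -cabs_eq0 cabs_real normr_eq0.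
rewrite conjCD conjCN !conjCM !invrC !conjc_real conjCD conjCN !conjCM !conjc_real -!invrC.
by rewrite rmorphD/= rmorphM/=; field.
Qed.

Lemma scharE A c f g l : schar A c f g l =
  invsum f g (fun l => (f l)%:C * A l) l - invsum f g c l.
Proof. by rewrite /schar /invsum mulrBl [A l * _]mulrC. Qed.

(** |c/(f+g)|^2 (f+g) = |c/(f+g)| |c| is a product of two square-integrable functions, whether or
    not f + g is bounded. *)
Lemma integrable_invsum_pair f g c : weight f -> weight g -> L2w w1 c ->
  L2w w1 (invsum f g c) -> L2w (pairsum f g) (invsum f g c).
Proof.
move=> wf wg lc lh; split; first exact: lh.1.
have := integrable_pairw W1 lh lc.
move=> /(integrableCP _ measurableT)[_]; apply: le_lt_trans.
rewrite le_eqVlt; apply/orP; left; apply/eqP; apply: eq_integral => l _.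
rewrite cabsM cabs_real normr1 mulr1 (cabsM (invsum f g c l)) /invsum cabs_divr /pairsum.
rewrite ger0_norm; last by rewrite addr_ge0// ?wf.2 ?wg.2.
have [->|F0] := eqVneq (f l + g l) 0; first by rewrite invr0 !mulr0 mul0r.
by congr (_%:E); field.
Qed.

Lemma realCD (r s : R) : (r + s)%:C = r%:C + s%:C :> C.
Proof. exact: rmorphD. Qed.

Lemma realCM (r s : R) : (r * s)%:C = r%:C * s%:C :> C.
Proof. exact: rmorphM. Qed.

Lemma fourierL1E s D x : integrableC D x -> fourier s D x = fourierL1 s D x.
Proof. by move=> ix; rewrite /fourier asboolT. Qed.

Lemma pairwJ w x y : weight w -> L2w w x -> L2w w y ->
  conjc (pairw w x y) = pairw w (fun l => conjc (x l)) (fun l => conjc (y l)).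
Proof.
move=> ww lx ly; rewrite /pairw -(integralCJ measurableT (integrable_pairw ww lx ly)).
by apply: eq_integralC => l _; rewrite !conjCM conjc_real.
Qed.

Lemma inv2pi_neq0 : ((2 * pi)^-1)%:C != 0 :> C.
Proof. by rewrite -cabs_eq0 cabs_real normr_eq0 invr_eq0 gt_eqF// pi2_gt0. Qed.

Lemma ae_eq_fourier2 s x (X Y : R -> C) : L2w w1 x -> measC setT Y ->
  {ae mu, forall l, X l = Y l} -> fourier2 s x X -> fourier2 s x Y.
Proof.
move=> lx mY XY [[mX Xo] cX]; split.
  by split => //; rewrite -(ae_eq_normw2 W1 mX mY)//; apply: aeS XY => l ->; right.
move=> e /cX[n0 Hn]; exists n0 => n /Hn; apply: le_trans.
have mt := measC_fourierL1 s (integrable_L2_trunc n lx).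
rewrite (ae_eq_normw2 W1 (measCB mt mY) (measCB mt mX))//.
by apply: aeS XY => l ->; right.
Qed.

(** A nonzero value persists on a ball inside [U], which has positive measure. *)
Lemma continuous_ae_eq0 (u : R -> R) (U : set R) : open U -> continuous u ->
  {ae mu, forall t, U t -> u t = 0} -> forall t, U t -> u t = 0.
Proof.
move=> oU cu [N [mN N0 NU]] t Ut; apply/eqP/negPn/negP => ut.
have [e /= e0 He] : nbhs t (U `&` [set s | u s != 0]).
  apply: filterI; first exact: open_nbhs_nbhs.
  exact: (cu t _ (open_nbhs_nbhs (conj (@open_neq _ 0) ut))).
have : (mu (ball t e) <= 0)%E.
  rewrite -N0; apply: le_measure; rewrite ?inE//; first exact: measurable_ball.
  by move=> s /He[Us us]; apply: NU => /(_ Us) /eqP; apply/negP.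
by rewrite lebesgue_measure_ball ?(ltW e0)// lee_fin leNgt mulr2n addr_gt0.
Qed.

(** * Error and optimality of the characteristic of one pair of densities *)

Section FixedDensities.
Variables (T : set R) (x : R -> C) (f g : R -> R) (c : R -> C).
Hypotheses (mT : measurable T) (ix : integrableC T x) (lx : L2C T x).
Hypotheses (sf : spectral_density f) (sg : spectral_density g).
Hypothesis (Bc : is_Binv T f g (opR T f g x) c).

Let A := fourierL1 (-1) T x.
Let Cc := fourier 1 T c.
Let Hc := invsum f g Cc.
Let Hr := invsum f g (fun l => (f l)%:C * A l).
Let wf : weight f := spectral_weight sf.
Let wg : weight g := spectral_weight sg.

Let AE : A = fourierL1 (-1) setT (extend0 T x).
Proof. by apply/funext => l; rewrite /A fourierL1_extend0. Qed.

Let ix' : integrableC setT (extend0 T x) := (integrableC_extend0 x mT).1 ix.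
Let lx' : L2w w1 (extend0 T x) := L2C_extend0 mT lx.

Let fourierA : fourier (-1) T x = A.
Proof. exact: fourierL1E. Qed.

Let lA : L2w w1 A.
Proof. by rewrite AE; apply: L2w_fourierL1 => //; exact: sqrN1. Qed.

Let lc : L2C T c. Proof. by case: Bc => -[]. Qed.

Let fC : fourier2 1 (extend0 T c) Cc.
Proof. by apply: fourier_fourier2 => //; rewrite expr1n. Qed.

Let lHc : L2w w1 Hc. Proof. by case: Bc => -[_ _ /L2CP]. Qed.

Let lHr : L2w w1 Hr.
Proof.
apply: (L2w_le W1 lA); first by apply: measC_invsum => //; apply: measCM; [exact: measC_real wf.1|exact: lA.1].
by move=> l; apply: cabs_invsum_le; [exact: wf.2|exact: wg.2].
Qed.

Let opRE : opR T f g x = fun t => ((2 * pi)^-1)%:C * fourier (-1) setT Hr t.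
Proof. by rewrite /opR fourierA. Qed.

Let opBE : opB T f g c = fun t => ((2 * pi)^-1)%:C * fourier (-1) setT Hc t.
Proof. reflexivity. Qed.

(** The characteristic is [Hr] - [Hc], whose transforms on [T] are 2 pi R x and 2 pi B c. The
    equation B c = R x thus says exactly that its transform vanishes on [T]. *)
Lemma schar_spectrum_off : spectrum_off T (schar A Cc f g).
Proof.
rewrite (_ : schar _ _ _ _ = fun l => Hr l - Hc l); last by apply/funext => l; exact: scharE.
split; first exact: L2wB.
have fr : fourier2 (-1) Hr (fourier (-1) setT Hr).
  by have := fourier_fourier2 sqrN1 measurableT ((L2CP _).2 lHr); rewrite extend0_setT.
have fc : fourier2 (-1) Hc (fourier (-1) setT Hc).
  by have := fourier_fourier2 sqrN1 measurableT ((L2CP _).2 lHc); rewrite extend0_setT.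
exists (fun t => fourier (-1) setT Hr t - fourier (-1) setT Hc t).
  exact: (fourier2B sqrN1 lHr lHc fr fc).
have := Bc.2; rewrite opRE opBE; apply: aeS => t h Tt; apply/eqP; rewrite subr_eq0 eq_sym.
apply/eqP; exact: (mulfI inv2pi_neq0 (h Tt)).
Qed.

Lemma fourierL1_in_L2w w : spectral_density w -> L2w w A.
Proof.
move=> sw; have [K AK] := fourierL1_bounded (-1) ix'.
by apply: (L2w_bounded sw lA.1) => l; rewrite AE; exact: AK.
Qed.

Let lFHc : L2w (pairsum f g) Hc.
Proof. exact: (integrable_invsum_pair wf wg fC.1 lHc). Qed.

Lemma L2w_schar : L2w (pairsum f g) (schar A Cc f g).
Proof.
rewrite (_ : schar _ _ _ _ = fun l => Hr l - Hc l); last by apply/funext => l; exact: scharE.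
have wF := weight_pairsum wf wg.
apply: (L2wB wF _ lFHc).
apply: (L2w_le wF (fourierL1_in_L2w (spectral_pairsum sf sg)) lHr.1) => l.
by apply: cabs_invsum_le; [exact: wf.2|exact: wg.2].
Qed.

(* Division by zero makes [Hc] vanish where [f + g] does; there [domB] makes [Cc]
   vanish too. *)
Lemma mul_invsum_ae : {ae mu, forall l, Hc l * (pairsum f g l)%:C = Cc l}.
Proof.
case: Bc => -[_ C0 _] _; apply: aeS C0 => l C0.
rewrite /Hc /invsum /pairsum; have [F0|F0] := eqVneq (f l + g l) 0.
  by rewrite /Cc (C0 F0) !mul0r.
by apply: divfK; rewrite -cabs_eq0 cabs_real normr_eq0.
Qed.

(** The weighted residual (A - h) f - h g equals A f - h (f + g), which is C where f + g does not
    vanish; written as [Hc] times f + g it is right at the zeros as well. *)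
Lemma orth_schar k : L2w (pairsum f g) k ->
  orth A (schar A Cc f g) f g k = pairw (pairsum f g) Hc (fun l => conjc (k l)).
Proof.
move=> lk; have /(L2w_pairsum _ wf wg)[lkf lkg] := lk.
have /(L2w_pairsum _ wf wg)[lhf lhg] := L2w_schar.
have lAf := fourierL1_in_L2w sf.
have i1 := integrable_pairw wf (L2wB wf lAf lhf) (L2wJ lkf).
have i2 := integrable_pairw wg lhg (L2wJ lkg).
rewrite /orth /pairw -(integralCB measurableT i1 i2).
apply: eq_integralC => l _; rewrite /schar /Hc /invsum /pairsum.
have [F0|F0] := eqVneq (f l + g l) 0.
  have f0 : f l = 0 by apply/eqP; rewrite eq_le wf.2 andbT -F0 lerDl wg.2.
  by move: F0; rewrite f0 add0r => ->; rewrite !mulr0 subrr.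
have F0' : (f l)%:C + (g l)%:C != 0 :> C.
  by rewrite -rmorphD/= -cabs_eq0 cabs_real normr_eq0.
by rewrite rmorphD/=; field.
Qed.

Lemma pairw_invsum_conj k : measC setT k ->
  pairw (pairsum f g) Hc (fun l => conjc (k l)) = pairw w1 Cc (fun l => conjc (k l)).
Proof.
move=> mk; have mF := (weight_pairsum wf wg).1.
apply: (ae_eq_integralC measurableT).
- by apply: measCM (measC_real mF); apply: measCM lHc.1 (measCJ mk).
- by apply: measCM (measC_cst _ _); apply: measCM fC.1.1 (measCJ mk).
- by apply: aeS mul_invsum_ae => l <- _; rewrite mulr1 mulrAC.
Qed.

Lemma orth_schar_eq0 k : spectrum_off T k -> L2w (pairsum f g) k ->
  orth A (schar A Cc f g) f g k = 0.
Proof.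
move=> sk lk; rewrite (orth_schar lk) (pairw_invsum_conj lk.1).
have := pairw_spectrum_off mT sk lc fC.
rewrite !pairw1 => /(congr1 conjc); rewrite conjc0 => <-.
have ik : integrableC setT (fun l => k l * conjc (Cc l)).
  have := integrable_pairw W1 sk.1 (L2wJ fC.1).
  by congr (integrableC _ _); apply/funext => l; rewrite mulr1.
rewrite -(integralCJ measurableT ik).
by apply: eq_integralC => l _; rewrite conjCM conjcK mulrC.
Qed.

(** The pointwise identity [qf_integrand], integrated. The function [q] is exposed with its
    integrability, which follows from |q| <= K f with [K] a bound of A and decides which form of
    [fourier] occurs in [opQ]. *)
Lemma qf_schar : exists2 q : R -> C,
    q = invsum f g (fun l => (f l * g l)%:C * A l) /\ integrableC setT q &
    (qf A (schar A Cc f g) f g)%:C =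
    integralC setT (fun l => Hc l * conjc (Cc l)) + integralC setT (fun l => q l * conjc (A l)).
Proof.
have [K AK] := fourierL1_bounded (-1) ix'.
pose q := invsum f g (fun l => (f l * g l)%:C * A l).
have qb l : cabs (q l) <= K * f l.
  have Al : cabs (A l) <= K by rewrite AE; exact: AK.
  apply: (le_trans (cabs_invsumM_le _ (wf.2 l) (wg.2 l))).
  exact: ler_wpM2r (wf.2 l) _ _ Al.
have mq : measC setT q.
  exact: (measC_invsum wf wg (measCM (measC_real (measurable_funM wf.1 wg.1)) lA.1)).
have iq : integrableC setT q.
  apply: (integrableC_le measurableT mq _ (fun l _ => qb l)).
  have := @integrableZl _ _ _ mu _ measurableT K _ sf.2; exact: eq_integrable.
exists q; first by split.
have /(L2w_pairsum _ wf wg)[lhf lhg] := L2w_schar.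
have lAh := L2wB wf (fourierL1_in_L2w sf) lhf.
have i1 := integrable_pairw wf lAh (L2wJ lAh).
have i2 := integrable_pairw wg lhg (L2wJ lhg).
have i3 : integrableC setT (fun l => Hc l * conjc (Cc l)).
  have := integrable_pairw W1 lHc (L2wJ fC.1).
  by congr (integrableC _ _); apply/funext => l; rewrite mulr1.
have i4 : integrableC setT (fun l => q l * conjc (A l)).
  apply: (integrableCMb (K := K) measurableT iq (measCJ lA.1)) => l _.
  by rewrite cabsJ AE; exact: AK.
rewrite /qf realCD -!pairwJ_nrm /pairw -(integralCD measurableT i1 i2) -(integralCD measurableT i3 i4).
by apply: eq_integralC => l _; rewrite -(qf_integrand _ _ (wf.2 l) (wg.2 l)).
Qed.

(** On [T] the function R x may be replaced by B c, and the multiplication formula turns the product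
    of B c and c into the integral of |C|^2/(f + g). *)
Lemma innerT_opR : innerT T (opR T f g x) c =
  ((2 * pi)^-1)%:C * integralC setT (fun l => Hc l * conjc (Cc l)).
Proof.
have fr : fourier2 (-1) Hr (fourier (-1) setT Hr).
  by have := fourier_fourier2 sqrN1 measurableT ((L2CP _).2 lHr); rewrite extend0_setT.
have fc : fourier2 (-1) Hc (fourier (-1) setT Hc).
  by have := fourier_fourier2 sqrN1 measurableT ((L2CP _).2 lHc); rewrite extend0_setT.
have le := L2C_extend0 mT lc.
have fJ := fourier2J (expr1n _ 2) le fC.
have := fourier2_mult sqrN1 lHc (L2wJ le) fc fJ; rewrite !pairw1 => <-.
have i1 : integrableC setT (fun t => fourier (-1) setT Hc t * conjc (extend0 T c t)).
  have := integrable_pairw W1 fc.1 (L2wJ le).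
  by congr (integrableC _ _); apply/funext => l; rewrite mulr1.
rewrite -(integralCZl _ measurableT i1) /innerT integralC_extend0.
have -> : extend0 T (fun t => opR T f g x t * conjc (c t)) =
    (fun t => ((2 * pi)^-1)%:C * (fourier (-1) setT Hr t * conjc (extend0 T c t))).
  apply/funext => t; rewrite opRE; have [Tt|Tt] := pselect (T t).
    rewrite !(extend0_in _ Tt); exact: esym (mulrA _ _ _).
  by rewrite !(extend0_out _ Tt) conjc0; move: (fourier _ _ _ _) => z; rewrite !mulr0.
apply: (ae_eq_integralC measurableT).
- by apply: measCM (measC_cst _ _) _; exact: measCM fr.1.1 (measCJ le.1).
- by apply: measCM (measC_cst _ _) _; exact: measCM fc.1.1 (measCJ le.1).
have := Bc.2; rewrite opRE opBE; apply: aeS => t h _; have [Tt|Tt] := pselect (T t).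
  move: (h Tt); rewrite /= => /(mulfI inv2pi_neq0) ->; exact: erefl.
by rewrite (extend0_out _ Tt) conjc0; move: (fourier _ _ _ _) (fourier _ _ _ _) => z v; rewrite !mulr0.
Qed.

(** Integrability of [q] makes [fourier] the absolutely convergent integral, to which the L_1
    multiplication formula applies. *)
Lemma innerT_opQ (q : R -> C) : q = invsum f g (fun l => (f l * g l)%:C * A l) ->
  integrableC setT q ->
  innerT T (opQ T f g x) x = ((2 * pi)^-1)%:C * integralC setT (fun l => q l * conjc (A l)).
Proof.
move=> qE iq.
have QE : opQ T f g x = fun t => ((2 * pi)^-1)%:C * fourierL1 1 setT q t.
  rewrite /opQ fourierA -qE (fourierL1E 1 iq); reflexivity.
have ixJ := integrableCJ measurableT ix'.
have -> : (fun l => q l * conjc (A l)) =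
    (fun l => q l * fourierL1 1 setT (fun t => conjc (extend0 T x t)) l).
  by apply/funext => l; rewrite AE (fourierL1J _ _ ix') opprK.
rewrite -(fourierL1_mult 1 iq ixJ).
have [M qM] := fourierL1_bounded 1 iq.
have i1 : integrableC setT (fun t => fourierL1 1 setT q t * conjc (extend0 T x t)).
  have := integrableCMb measurableT ixJ (measC_fourierL1 1 iq) (fun l _ => qM l).
  by congr (integrableC _ _); apply/funext => l; rewrite mulrC.
rewrite -(integralCZl _ measurableT i1) /innerT integralC_extend0 QE.
apply: eq_integralC => t _; have [Tt|Tt] := pselect (T t).
  rewrite !(extend0_in _ Tt); exact: esym (mulrA _ _ _).
by rewrite !(extend0_out _ Tt) conjc0; move: (fourierL1 _ _ _ _) => z; rewrite !mulr0.
Qed.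

Lemma opt_valueE : opBinv T f g (opR T f g x) = c ->
  opt_value T x f g = ((2 * pi)^-1 * qf A (schar A Cc f g) f g)%:C.
Proof.
move=> cE; have [q [qE iq] E] := qf_schar.
have VE : opt_value T x f g = innerT T (opR T f g x) c + innerT T (opQ T f g x) x.
  by rewrite /opt_value; congr (innerT T _ _ + _).
apply: (etrans VE); apply: (etrans (f_equal2 +%R innerT_opR (innerT_opQ qE iq))).
apply: (etrans (esym (mulrDr _ _ _))); apply: (etrans (congr1 (fun z => _ * z) (esym E))).
exact: esym (realCM _ _).
Qed.

(** The normal equation is needed at every single exponential e^{i t l} with t in [Ob], whereas
    inversion gives the transform of C only almost everywhere. The integrable version [G] of C has a
    continuous transform, equal to 2 pi c almost everywhere, hence zero almost everywhere on the
    open set [Ob], hence zero at each point of it. *)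
Lemma schar_optimal Ob : open Ob -> (forall t, Ob t -> ~ T t) ->
  L2s Ob (pairsum f g) (schar A Cc f g) -> is_optimal Ob A f g (schar A Cc f g).
Proof.
move=> oO OT ls; have lAf := fourierL1_in_L2w sf.
have sF := spectral_pairsum sf sg; have wF := spectral_weight sF.
apply: (orth_optimal sf sg lAf ls) => k lk; rewrite (orth_schar (L2s_L2w lk)).
pose G l := Hc l * (pairsum f g l)%:C.
have l1 : L2w (pairsum f g) (fun=> 1).
  by apply: (L2w_bounded (K := 1) sF (measC_cst _ _)) => l; rewrite (@cabs_real R) normr1.
have iG : integrableC setT G.
  have := integrable_pairw wF lFHc l1.
  by congr (integrableC _ _); apply/funext => l; rewrite mulr1.
have GC : {ae mu, forall l, Cc l = G l} by apply: aeS mul_invsum_ae.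
have le := L2C_extend0 mT lc.
have fG := ae_eq_fourier2 le (integrableC_measC iG) GC fC.
have fK := fourier2_L1 sqrN1 iG fG.1.
have KE := fourier2_inversion (expr1n _ 2) le fG fK.
have [cR cI] := continuous_fourierL1 (-1) iG.
have K0 t : Ob t -> fourierL1 (-1) setT G t = 0.
  have h : {ae mu, forall t, Ob t -> fourierL1 (-1) setT G t = 0}.
    by apply: aeS KE => u -> /OT Tu; rewrite (extend0_out _ Tu) mulr0.
  move=> Ot; apply: complex_ext.
    by apply: (continuous_ae_eq0 oO cR _ Ot); apply: aeS h => u hu /hu ->.
  by apply: (continuous_ae_eq0 oO cI _ Ot); apply: aeS h => u hu /hu ->.
have : pairw (pairsum f g) k (fun l => conjc (Hc l)) = 0.
  apply: (pairw_L2s_eq0 sF lk (L2wJ lFHc)) => t Ot.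
  have lt := L2w_exp t sF.
  rewrite -(conjcK (pairw _ _ _)) (pairwJ wF lt (L2wJ lFHc)).
  rewrite -[RHS]conjc0; congr conjc; rewrite -(K0 t Ot).
  apply: eq_integralC => l _; rewrite conjcK cexpiJ /G.
  have -> : -1 * l * t = - (t * l) by rewrite mulN1r mulNr mulrC.
  move: (Hc l) (cexpi _) (pairsum f g l) => h z w; rewrite [RHS]mulrC; exact: esym (mulrA _ _ _).
move=> /(congr1 conjc); rewrite conjc0 (pairwJ wF (L2s_L2w lk) (L2wJ lFHc)) => <-.
rewrite pairwC; apply: eq_integralC => l _; congr (_ * _ * _); exact: esym (conjcK _).
Qed.

End FixedDensities.
End OptimalCharacteristic.

(** * Zeros of real entire power series *)

Section PowerSeriesZeros.
Context {R : realType}.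
Local Notation mu := (@lebesgue_measure R).
Implicit Types (b : nat -> R) (x r M : R).

(** Infinite radius of convergence as a coefficient bound, a form that passes to quotients with
    explicit constants. *)
Definition entire b := forall r, 0 < r -> exists M, forall j, `|b j| * r ^+ j <= M.

Definition psum b x : R := limn (pseries b x).

Lemma coef_bound_ge0 b r M : (forall j, `|b j| * r ^+ j <= M) -> 0 <= M.
Proof. by move=> /(_ 0%N); apply: le_trans; rewrite expr0 mulr1. Qed.

Lemma pseries_bound b r M x : 0 < r -> (forall j, `|b j| * r ^+ j <= M) -> `|x| < r ->
  cvgn (pseries b x) /\ `|psum b x| <= M * r / (r - `|x|).
Proof.
move=> r0 bM xr.
have M0 := coef_bound_ge0 bM.
have q1 : `| (`|x| / r) | < 1 by rewrite ger0_norm ?divr_ge0 ?(ltW r0)// ltr_pdivrMr ?mul1r.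
have hle n : `|b n * x ^+ n| <= geometric M (`|x| / r) n.
  rewrite /geometric /= normrM normrX exprMn exprVn.
  rewrite [leRHS]mulrCA [leRHS]mulrC ler_wpM2r ?exprn_ge0//.
  by rewrite ler_pdivlMr ?exprn_gt0.
have cg := is_cvg_geometric_series (a := M) q1.
have cn : cvgn [normed pseries b x].
  by apply: (series_le_cvg _ _ hle cg) => n //; exact: le_trans (hle n).
split; first exact: normed_cvg.
apply: le_trans (lim_series_norm cn) _.
apply: le_trans (lim_series_le cn cg hle) _.
rewrite (cvg_lim _ (cvg_geometric_series (a := M) q1))//.
have d0 : r - `|x| != 0 by rewrite subr_eq0 gt_eqF.
by rewrite le_eqVlt; apply/orP; left; apply/eqP; field; rewrite (gt_eqF r0) d0.
Qed.

Lemma entire_cvg b x : entire b -> cvgn (pseries b x).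
Proof.
move=> eb; have x1 : 0 < `|x| + 1 by rewrite ltr_wpDl.
have [M bM] := eb _ x1.
by have [] := pseries_bound x1 bM (_ : `|x| < `|x| + 1); rewrite ?ltrDl.
Qed.

(* Coefficients of the quotient of [psum b x - psum b a] by [x - a]. *)
Definition pquot (a : R) b k : R := psum (fun j => b (k.+1 + j)%N) a.

(** The radius r stays the same and division costs a factor 1 / (r - |a|), so n divisions cost its
    n-th power. *)
Lemma pquot_bound a b r M : `|a| < r -> (forall j, `|b j| * r ^+ j <= M) ->
  forall k, `|pquot a b k| * r ^+ k <= M / (r - `|a|).
Proof.
move=> ar bM k; have r0 : 0 < r by exact: le_lt_trans (normr_ge0 a) ar.
have bM' j : `|b (k.+1 + j)%N| * r ^+ j <= M / r ^+ k.+1.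
  rewrite ler_pdivlMr ?exprn_gt0//; apply: le_trans (bM (k.+1 + j)%N).
  by rewrite -mulrA -exprD addnC.
have [_ h] := pseries_bound r0 bM' ar.
apply: le_trans (ler_wpM2r _ h) _; first by rewrite exprn_ge0// ltW.
have d0 : r - `|a| != 0 by rewrite subr_eq0 gt_eqF.
have rk : r ^+ k != 0 by rewrite expf_neq0// gt_eqF.
by rewrite exprS le_eqVlt; apply/orP; left; apply/eqP; field; rewrite (gt_eqF r0) d0 rk.
Qed.

Lemma entire_pquot a b : entire b -> entire (pquot a b).
Proof.
move=> eb r r0; pose r' := r + `|a|.
have ar : `|a| < r' by rewrite ltrDr.
have [M bM] := eb _ (le_lt_trans (normr_ge0 a) ar).
exists (M / (r' - `|a|)) => j; apply: le_trans (pquot_bound ar bM j).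
by rewrite ler_wpM2l// lerXn2r ?nnegrE ?(ltW r0) ?addr_ge0 ?(ltW r0)// lerDl.
Qed.

Lemma psum_rec b a : entire b -> psum b a = b 0%N + a * psum (fun j => b j.+1) a.
Proof.
move=> eb; have c := @entire_cvg _ a eb.
have eb' : entire (fun j => b j.+1).
  move=> r r0; have [M bM] := eb r r0; exists (M / r) => j.
  by rewrite ler_pdivlMr// -mulrA -exprSr.
have c' := @entire_cvg _ a eb'.
apply/cvg_lim => //; rewrite -cvg_shiftS.
rewrite (_ : (fun n => _) = (fun n => b 0%N + a * pseries (fun j => b j.+1) a n)).
  by apply: cvgD; [exact: cvg_cst|apply: cvgM; [exact: cvg_cst|exact: c']].
apply/funext => n; rewrite /pseries /series /= big_nat_recl//= expr0 mulr1.
congr (_ + _); rewrite mulr_sumr; apply: eq_bigr => i _.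
by rewrite exprS; ring.
Qed.

Lemma entire_shift b k : entire b -> entire (fun j => b (k + j)%N).
Proof.
move=> eb r r0; have [M bM] := eb r r0; exists (M / r ^+ k) => j.
by rewrite ler_pdivlMr ?exprn_gt0// -mulrA -exprD addnC.
Qed.

Lemma pquotE a b k : entire b -> pquot a b k = b k.+1 + a * pquot a b k.+1.
Proof.
move=> eb; rewrite {1}/pquot psum_rec; last exact: entire_shift.
rewrite addn0; congr (_ + _ * psum _ _).
by apply/funext => j; congr b; rewrite addnS.
Qed.

(** Horner's recurrence e_k = b_(k+1) + a e_(k+1) for the quotient makes the partial sums
    telescope. *)
Lemma psum_division a b x : entire b ->
  psum b x = psum b a + (x - a) * psum (pquot a b) x.
Proof.
move=> eb; pose e := pquot a b.
have ce := @entire_cvg _ x (@entire_pquot a _ eb).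
have c := @entire_cvg _ x eb.
apply/cvg_lim => //; rewrite -cvg_shiftS.
rewrite (_ : (fun n => _) = (fun n => psum b a + x * pseries e x n - a * pseries e x n.+1)).
  rewrite mulrBl addrA; apply: cvgB.
    by apply: cvgD; [exact: cvg_cst|apply: cvgM; [exact: cvg_cst|exact: ce]].
  by apply: cvgM; [exact: cvg_cst|rewrite (cvg_shiftS (pseries e x))].
apply/funext => n; elim: n => [|n IH].
  rewrite /pseries /series /= !big_nat1 big_geq// !expr0 !mulr1 mulr0 addr0.
  by rewrite psum_rec// /e /pquot addrK.
have S (d : nat -> R) m : pseries d x m.+1 = pseries d x m + d m * x ^+ m.
  by rewrite /pseries /series /= big_nat_recr.
rewrite S IH [in RHS]S [X in _ = _ - a * X]S.
by rewrite /e (pquotE a n eb) exprS; ring.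
Qed.

Lemma psum_iter_division a b x n : entire b ->
  (forall m, (m < n)%N -> psum (iter m (pquot a) b) a = 0) ->
  entire (iter n (pquot a) b) /\ psum b x = (x - a) ^+ n * psum (iter n (pquot a) b) x.
Proof.
move=> eb; elim: n => [_|n IH H]; first by rewrite expr0 mul1r.
have [en E] := IH (fun m mn => H m (ltnW mn)).
split; first exact: entire_pquot.
rewrite E (psum_division a x en) (H n (ltnSn n)) add0r exprS iterS; ring.
Qed.

(** After n divisions the value at [x] is bounded by a constant times (|x - a| / (r - |a|))^n, and r
    is taken so large that |x - a| <= |x| + |a| < r - |a|. *)
Lemma psum_infinite_order a b : entire b ->
  (forall n, psum (iter n (pquot a) b) a = 0) -> forall x, psum b x = 0.
Proof.
move=> eb H x; pose r := 2 * `|a| + `|x| + 1.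
have a0 := normr_ge0 a; have x0 := normr_ge0 x.
have r0 : 0 < r by rewrite /r; lra.
have ar : `|a| < r by rewrite /r; lra.
have xr : `|x| < r by rewrite /r; lra.
have [M bM] := eb _ r0.
have bMn n : forall j, `|iter n (pquot a) b j| * r ^+ j <= M / (r - `|a|) ^+ n.
  elim: n => [|n IH]; first by rewrite expr0 divr1.
  move=> j; rewrite exprSr invfM mulrA iterS; exact: pquot_bound.
pose q := `|x - a| / (r - `|a|).
have ra : 0 < r - `|a| by rewrite subr_gt0.
have q1 : `|q| < 1.
  rewrite ger0_norm ?divr_ge0 ?(ltW ra)// ltr_pdivrMr// mul1r.
  by apply: le_lt_trans (ler_normB _ _) _; rewrite /r; lra.
have hle n : `|psum b x| <= (M * r / (r - `|x|)) * q ^+ n.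
  have [_ ->] := psum_iter_division x eb (fun m (_ : (m < n)%N) => H m).
  have [_ h] := pseries_bound r0 (bMn n) xr.
  rewrite normrM normrX; apply: le_trans (ler_wpM2l _ h) _; first by rewrite exprn_ge0.
  have d1 : r - `|x| != 0 by rewrite subr_eq0 gt_eqF.
  have d2 : (r - `|a|) ^+ n != 0 by rewrite expf_neq0// gt_eqF.
  rewrite /q exprMn exprVn le_eqVlt; apply/orP; left; apply/eqP; field.
  by rewrite d1 d2.
apply/eqP; rewrite -normr_eq0 eq_le normr_ge0 andbT.
have h : (fun n => (M * r / (r - `|x|)) * q ^+ n) @ \oo --> (0 : R) by exact: cvg_geometric.
rewrite -(cvg_lim _ h)//; apply: limr_ge; first exact: cvgP h.
exact: nearW.
Qed.

(** A zero of infinite order would make the series vanish identically. So some iterated quotient is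
    nonzero at [a]; the first such one, [q], is left after extracting (x - a)^m, and it stays
    nonzero near [a]. *)
Lemma isolated_zero b a : entire b -> (exists x, psum b x != 0) -> psum b a = 0 ->
  isolated [set x | psum b x = 0] a.
Proof.
move=> eb [x1 /eqP bx1] ba0.
have [n0 Hn0] : exists n, psum (iter n (pquot a) b) a != 0.
  apply: contrapT => Hn; apply: bx1; apply: (@psum_infinite_order a) => // n.
  by apply/eqP/negPn/negP => h; apply: Hn; exists n.
have exn : exists n, psum (iter n (pquot a) b) a != 0 by exists n0.
pose m := ex_minn exn.
have [Hm mmin] : psum (iter m (pquot a) b) a != 0 /\
    forall n, psum (iter n (pquot a) b) a != 0 -> (m <= n)%N.
  by rewrite /m; case: ex_minnP => k; split.
have H k : (k < m)%N -> psum (iter k (pquot a) b) a = 0.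
  by move=> km; apply/eqP/negPn/negP => /mmin; rewrite leqNgt km.
set q := iter m (pquot a) b in Hm.
have eq : entire q by have [] := psum_iter_division a eb H.
pose r := `|a| + 2.
have a0 := normr_ge0 a.
have r0 : 0 < r by rewrite /r; lra.
have [M qM] := entire_pquot a eq r0.
have M0 := coef_bound_ge0 qM.
pose K := M * r.
have K0 : 0 <= K by rewrite mulr_ge0// ltW.
(* For |x - a| < 1 one has r - |x| >= 1, so [K] bounds the next quotient there and |q(x) - q(a)| <=
   K |x - a| < |q(a)| on the ball. *)
pose d := Num.min 1 (`|psum q a| / (K + 1)).
have K1 : 0 < K + 1 by rewrite ltr_wpDl.
have d0 : 0 < d by rewrite lt_min ltr01 divr_gt0// normr_gt0.
split; first exact: mem_set.
exists (ball a d); first by apply: nbhsx_ballx.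
apply/seteqP; split=> [x [/= xd bx0]|x ->]; last by split; [exact: ballxx|].
apply/eqP; apply/negPn/negP => xa.
have [_] := psum_iter_division x eb H.
rewrite bx0 => /esym/eqP; rewrite mulf_eq0 expf_eq0 subr_eq0 (negbTE xa) andbF/= -/q.
rewrite (psum_division a x eq) => /eqP qx0.
move: xd; rewrite /ball/= lt_min distrC => /andP[xd1 xd2].
have xr : `|x| <= r - 1.
  have -> : x = (x - a) + a by rewrite subrK.
  by apply: le_trans (ler_normD _ _) _; rewrite /r; lra.
have xr' : `|x| < r by lra.
have [_ h] := pseries_bound r0 qM xr'.
have h' : `|psum (pquot a q) x| <= K.
  apply: le_trans h _; rewrite ler_pdivrMr ?subr_gt0// ler_peMr//; lra.
move: xd2; rewrite ltr_pdivlMr// ltNge => /negP; apply.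
have -> : psum q a = - ((x - a) * psum (pquot a q) x).
  by apply/eqP; rewrite -addr_eq0; apply/eqP.
rewrite normrN normrM ler_wpM2l//; lra.
Qed.

(** A set that consists of isolated points is countable, hence null. *)
Lemma negligible_zeros b : entire b -> (exists x, psum b x != 0) ->
  {ae mu, forall x, psum b x != 0}.
Proof.
move=> eb bx; pose Z := [set x | psum b x = 0].
have ZE : Z = isolated Z.
  apply/seteqP; split => x; last exact: isolatedS.
  by move=> Zx; exact: isolated_zero.
have cZ : countable Z by rewrite ZE; exact: countable_isolated.
exists Z; split.
- exact: countable_measurable.
- exact: countable_lebesgue_measure0.
- by move=> x /= /negP/negPn/eqP.
Qed.

End PowerSeriesZeros.

(** * The sets T, R^s and the set of observation times *)

Section ObservationSets.
Context {R : realType}.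
Local Notation mu := (@lebesgue_measure R).
Local Notation C := R[i].
Implicit Types (s : nat) (N K : nat -> R).

Let finite_range s : finite_set [set l : nat | (1 <= l <= s)%N].
Proof.
by apply: (@sub_finite_set _ _ `I_s.+1) => [l /= /andP[_]|]; [rewrite ltnS|exact: finite_II].
Qed.

(** Being closed, [Tset] is measurable and its complement, the set of observation times, is open. *)
Lemma closed_Tset s N K : closed (Tset s N K).
Proof.
apply: closedU; last exact: interval_closed.
by apply: closed_bigcup; [exact: finite_range|move=> l _; exact: interval_closed].
Qed.

Lemma measurable_Rs s N K : measurable (Rs s N K).
Proof.
apply: measurableD; first exact: measurable_itv.
by apply: bigcup_measurable => l _; exact: measurable_itv.
Qed.

Lemma ObsE s N K : Obs s N K = ~` Tset s N K.
Proof.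
apply/seteqP; split => t; rewrite /Obs /Tset /= !in_itv /= ?andbT.
  by move=> [t0 tS] [//|]; rewrite leNgt t0.
by move=> h; split => [|St]; [rewrite ltNge; apply/negP => t0; apply: h; right|apply: h; left].
Qed.

Lemma extend0_Tset_Rs s N K (a : R -> C) :
  extend0 (Tset s N K) (extend0 (Rs s N K) a) = extend0 (Rs s N K) a.
Proof.
apply/funext => t; have [Tt|Tt] := pselect (Tset s N K t); first by rewrite extend0_in.
by rewrite (extend0_out _ Tt) extend0_out// => -[h _]; apply: Tt; right.
Qed.

End ObservationSets.

(** * The minimality condition makes f + g positive almost everywhere *)

Section Minimality.
Context {R : realType}.
Local Notation mu := (@lebesgue_measure R).
Local Notation C := R[i].

(** The term c_j r^j is the difference of two consecutive partial sums at the real point r, which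
    stay within a bounded distance of G(r). *)
Lemma entire_coef (c : nat -> C) (G : C -> C) (b : nat -> R) :
  (forall z : C, (fun n : nat => cabs (G z - \sum_(k < n) c k * z ^+ k)) @ \oo --> (0 : R)) ->
  (forall k, `|b k| <= cabs (c k)) -> entire b.
Proof.
move=> cG bc r r0; pose S n := \sum_(k < n) c k * r%:C ^+ k.
have /cvg_seq_bounded[M0 [_ HM]] : cvgn (fun n => cabs (G r%:C - S n)).
  by apply/cvg_ex; exists 0; exact: cG.
have := HM (M0 + 1); rewrite ltrDl ltr01 => /(_ isT) {}HM.
exists (2 * (M0 + 1)) => j; have -> : `|b j| * r ^+ j = `|b j * r ^+ j|.
  by rewrite normrM (ger0_norm (exprn_ge0 _ _))// ltW.
apply: (@le_trans _ _ (cabs (c j * r%:C ^+ j))).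
  have -> : r%:C ^+ j = (r ^+ j)%:C :> C by rewrite rmorphXn.
  by rewrite cabsM cabs_real normrM ler_wpM2r.
have -> : c j * r%:C ^+ j = (G r%:C - S j) - (G r%:C - S j.+1).
  by rewrite /S big_ord_recr /=; ring.
apply: le_trans (cabsD _ _) _; rewrite cabsN mulr2n mulrDl mul1r.
by apply: lerD; [have := HM j I|have := HM j.+1 I]; rewrite /= ger0_norm ?cabs_ge0.
Qed.

(** [p] stands for the real part or the imaginary part. *)
Lemma psum_coef (c : nat -> C) (z : C) (x : R) (p : C -> R) (b : nat -> R) :
  (forall u v, p (u - v) = p u - p v) -> (forall u, `|p u| <= cabs u) ->
  (forall n, p (\sum_(k < n) c k * x%:C ^+ k) = pseries b x n) ->
  (fun n : nat => cabs (z - \sum_(k < n) c k * x%:C ^+ k)) @ \oo --> (0 : R) ->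
  psum b x = p z.
Proof.
move=> pB ple pS cG; apply: cvg_lim => //.
apply/subr_cvg0; apply/norm_cvg0P.
apply: (@squeeze_cvgr _ _ _ _ (cst 0) (fun n : nat => cabs (z - \sum_(k < n) c k * x%:C ^+ k))).
- by apply: nearW => n; rewrite normr_ge0 /= -pS distrC -pB ple.
- exact: cvg_cst.
- exact: cG.
Qed.

(** On the real line the real and imaginary parts of [gam] are sums of real entire power series. One
    of them is not identically zero, and [gam] is nonzero wherever that one is. *)
Lemma exp_type_neq0_ae (gam : R -> C) : exp_type gam -> (exists l, gam l != 0) ->
  {ae mu, forall l, gam l != 0}.
Proof.
move=> [G [c [_ [_ [cG _ gG]]]]] [l0 gl0].
have E n x : complex.Re (\sum_(k < n) c k * x%:C ^+ k) = pseries (fun k => complex.Re (c k)) x n /\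
    complex.Im (\sum_(k < n) c k * x%:C ^+ k) = pseries (fun k => complex.Im (c k)) x n.
  elim: n => [|n [IH1 IH2]]; first by rewrite !big_ord0 /pseries /= /series /= !big_geq.
  rewrite !big_ord_recr /= ReD ImD IH1 IH2 /pseries /series /= !big_nat_recr //=.
  have -> : x%:C ^+ n = (x ^+ n)%:C :> C by rewrite rmorphXn.
  by rewrite ReM ImM /= !mulr0 subr0 add0r.
have Er x : psum (fun k => complex.Re (c k)) x = complex.Re (gam x).
  rewrite gG; apply: (psum_coef (c := c)) (cG _); first by move=> u v; rewrite ReD ReN.
    exact: Re_le_cabs.
  by move=> n; exact: (E n x).1.
have Ei x : psum (fun k => complex.Im (c k)) x = complex.Im (gam x).
  rewrite gG; apply: (psum_coef (c := c)) (cG _); first by move=> u v; rewrite ImD ImN.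
    exact: Im_le_cabs.
  by move=> n; exact: (E n x).2.
have er := entire_coef (b := fun k => complex.Re (c k)) cG (fun k => Re_le_cabs _).
have ei := entire_coef (b := fun k => complex.Im (c k)) cG (fun k => Im_le_cabs _).
have [g0|g0] := eqVneq (complex.Re (gam l0)) 0.
  have : {ae mu, forall x, psum (fun k => complex.Im (c k)) x != 0}.
    apply: negligible_zeros => //; exists l0; rewrite Ei; apply: contra gl0 => /eqP h.
    by apply/eqP; exact: complex_ext.
  by apply: aeS => x; rewrite Ei; apply: contra => /eqP ->.
have : {ae mu, forall x, psum (fun k => complex.Re (c k)) x != 0}.
  by apply: negligible_zeros => //; exists l0; rewrite Er.
by apply: aeS => x; rewrite Er; apply: contra => /eqP ->.
Qed.

(** At a zero of f + g where [gam] does not vanish the integrand is +oo, which a finite integral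
    allows only on a null set. *)
Lemma minimality_neq0_ae (f g : R -> R) : spectral_density f -> spectral_density g ->
  minimality f g -> {ae mu, forall l, pairsum f g l != 0}.
Proof.
move=> sf sg [alpha [gam [ia gE eg ng lty]]].
have wF := weight_pairsum (spectral_weight sf) (spectral_weight sg).
have mg : measC setT gam.
  rewrite gE; have m0 : measurable (`[0, +oo[%classic : set R) by exact: measurable_itv.
  have -> : fourierL1 1 `[0, +oo[%classic alpha = fourierL1 1 setT (extend0 `[0, +oo[%classic alpha).
    by apply/funext => l; rewrite fourierL1_extend0.
  by apply: measC_fourierL1; exact: (integrableC_extend0 _ m0).1.
pose u l := ((cabs (gam l) ^+ 2)%:E * ((pairsum f g l)%:E)^-1)%E.
have u0 l : (0 <= u l)%E.
  apply: mule_ge0; first by rewrite lee_fin exprn_ge0// cabs_ge0.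
  by rewrite inver; case: ifP => // _; rewrite lee_fin invr_ge0 wF.2.
have mu_ : measurable_fun setT u.
  apply: emeasurable_funM.
    by apply/measurable_EFinP; apply: measurable_funX; exact: measurable_cabs.
  under eq_fun do rewrite inver.
  apply: measurable_fun_ifT; last 2 first.
  - exact: measurable_cst.
  - by apply/measurable_EFinP; exact: measurable_invr wF.1.
  by apply: (measurable_fun_eqr wF.1); exact: measurable_cst.
have iu : mu.-integrable setT u.
  by apply/integrableP; split => //; under eq_integral do rewrite gee0_abs//.
have := integrable_ae measurableT iu.
have := exp_type_neq0_ae eg ng.
move=> /ae_and h /h; apply: aeS => l [gl /(_ Logic.I)]; rewrite /u.
apply: contraTneq => ->; rewrite inve0 gt0_muley// lte_fin exprn_gt0//.
by rewrite lt0r cabs_ge0 andbT cabs_eq0.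
Qed.

End Minimality.

(** * Convex combinations of densities *)

Section Mixtures.
Context {R : realType}.
Local Notation mu := (@lebesgue_measure R).
Local Notation C := R[i].
Implicit Types (x y h k A : R -> C) (w f g u v : R -> R) (tau : R).

Definition mix tau u v : R -> R := fun l => (1 - tau) * u l + tau * v l.

Lemma integrable_mix tau u v : mu.-integrable setT (EFin \o u) ->
  mu.-integrable setT (EFin \o v) -> mu.-integrable setT (EFin \o mix tau u v).
Proof.
move=> iu iv.
have i1 := @integrableZl _ _ _ mu _ measurableT (1 - tau) _ iu.
have i2 := @integrableZl _ _ _ mu _ measurableT tau _ iv.
have := @integrableD _ _ _ mu _ measurableT _ _ i1 i2.
exact: eq_integrable.
Qed.

Lemma Rintegral_mix tau u v : mu.-integrable setT (EFin \o u) ->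
  mu.-integrable setT (EFin \o v) ->
  \int[mu]_l mix tau u v l = (1 - tau) * \int[mu]_l u l + tau * \int[mu]_l v l.
Proof.
move=> iu iv; rewrite RintegralD//; first by rewrite !RintegralZl.
  by have := @integrableZl _ _ _ mu _ measurableT (1 - tau) _ iu; exact: eq_integrable.
by have := @integrableZl _ _ _ mu _ measurableT tau _ iv; exact: eq_integrable.
Qed.

Lemma mix_ge0 tau u v l : 0 <= tau <= 1 -> 0 <= u l -> 0 <= v l -> 0 <= mix tau u v l.
Proof.
by move=> /andP[t0 t1] u0 v0; apply: addr_ge0; apply: mulr_ge0 => //; rewrite subr_ge0.
Qed.

Lemma spectral_mix tau u v : 0 <= tau <= 1 -> spectral_density u ->
  spectral_density v -> spectral_density (mix tau u v).
Proof.
move=> t01 [u0 iu] [v0 iv]; split; last exact: integrable_mix.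
by move=> l; exact: mix_ge0.
Qed.

(** Common to both classes: [w] is the mixture itself for the power bound, and the distance of the
    mixture from [g1] for the L_1 ball, where it lies below the mixture of the distances. *)
Lemma integral_le_mix tau u v w (P : R) : 0 <= tau <= 1 ->
  mu.-integrable setT (EFin \o u) -> mu.-integrable setT (EFin \o v) ->
  measurable_fun setT w -> (forall l, 0 <= w l <= mix tau u v l) ->
  (((2 * pi)^-1)%:E * \int[mu]_l (u l)%:E <= P%:E)%E ->
  (((2 * pi)^-1)%:E * \int[mu]_l (v l)%:E <= P%:E)%E ->
  (((2 * pi)^-1)%:E * \int[mu]_l (w l)%:E <= P%:E)%E.
Proof.
move=> /andP[t0 t1] iu iv mw wle.
rewrite (EFin_Rintegral measurableT iu) (EFin_Rintegral measurableT iv) -!EFinM !lee_fin => uP vP.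
have im := integrable_mix tau iu iv.
apply: (@le_trans _ _ (((2 * pi)^-1)%:E * \int[mu]_l (mix tau u v l)%:E)%E).
  apply: lee_wpmul2l; first by rewrite lee_fin invr_ge0 ltW// pi2_gt0.
  apply: ge0_le_integral => //.
  - by move=> l _; rewrite lee_fin; case/andP: (wle l).
  - exact/measurable_EFinP.
  - by case/integrableP: im.
  - by move=> l _; rewrite lee_fin; case/andP: (wle l).
rewrite EFin_Rintegral// -EFinM lee_fin Rintegral_mix//.
rewrite mulrDr !(mulrCA (2 * pi)^-1).
have -> : P = (1 - tau) * P + tau * P by ring.
by apply: lerD; apply: ler_wpM2l => //; rewrite subr_ge0.
Qed.

Lemma D_eps_mix tau eps P f1 u v : 0 <= tau <= 1 ->
  D_eps eps P f1 u -> D_eps eps P f1 v -> D_eps eps P f1 (mix tau u v).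
Proof.
move=> t01 [su [a sa ua] uP] [sv [b sb vb] vP]; have sm := spectral_mix t01 su sv.
split => //.
  exists (mix tau a b); first exact: spectral_mix.
  by apply: aeS (ae_and ua vb) => l [ual vbl]; rewrite /mix ual vbl; ring.
apply: (integral_le_mix t01 su.2 sv.2 _ _ uP vP).
  exact: (spectral_weight sm).1.
by move=> l; rewrite sm.1 lexx.
Qed.

Lemma integrable_dist u v : spectral_density u -> spectral_density v ->
  mu.-integrable setT (EFin \o (fun l => `|u l - v l|)).
Proof.
move=> [_ iu] [_ iv].
have := integrable_abse (@integrableB _ _ _ mu _ measurableT _ _ iu iv).
exact: eq_integrable.
Qed.

Lemma D1_eps_mix tau eps g1 u v : 0 <= tau <= 1 -> spectral_density g1 ->
  D1_eps eps g1 u -> D1_eps eps g1 v -> D1_eps eps g1 (mix tau u v).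
Proof.
move=> t01 sg [su uP] [sv vP]; have sm := spectral_mix t01 su sv; split => //.
have iu := integrable_dist su sg; have iv := integrable_dist sv sg.
have im := integrable_dist sm sg.
apply: (integral_le_mix t01 iu iv _ _ uP vP).
  by case/integrableP: im => /measurable_EFinP.
move: t01 => /andP[t0 t1] l; rewrite normr_ge0 /= /mix.
have -> : (1 - tau) * u l + tau * v l - g1 l =
  (1 - tau) * (u l - g1 l) + tau * (v l - g1 l) by ring.
apply: le_trans (ler_normD _ _) _; rewrite !normrM (ger0_norm t0).
by rewrite (ger0_norm (_ : 0 <= 1 - tau)) ?subr_ge0.
Qed.

Lemma L2w_weight_le w v x (K : R) : weight w -> weight v -> 0 <= K ->
  (forall l, w l <= K * v l) -> L2w v x -> L2w w x.
Proof.
move=> ww wv K0 wle [mx xo]; split => //.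
apply: (@le_lt_trans _ _ (K%:E * normw2 v x)%E); last first.
  by rewrite lte_mul_pinfty// ?lee_fin.
rewrite -ge0_integralZl//; last 2 first.
- exact: measurable_normw2.
- by move=> l _; rewrite lee_fin cabs2_ge0.
apply: ge0_le_integral => //.
- by move=> l _; rewrite lee_fin cabs2_ge0.
- exact: measurable_normw2.
- by apply: measurable_funeM; exact: measurable_normw2.
- by move=> l _; rewrite -EFinM lee_fin mulrCA ler_wpM2l// exprn_ge0// cabs_ge0.
Qed.

Lemma nrm_mix tau u v x : weight u -> weight v -> L2w u x -> L2w v x ->
  nrm (mix tau u v) x = (1 - tau) * nrm u x + tau * nrm v x.
Proof.
move=> wu wv lu lv; rewrite !nrm_Rintegral.
rewrite -(Rintegral_mix tau (integrable_cabs2 wu lu) (integrable_cabs2 wv lv)).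
by apply: eq_Rintegral => l _; rewrite /mix; ring.
Qed.

Lemma pairsum_mix tau f g u v :
  pairsum (mix tau f u) (mix tau g v) = mix tau (pairsum f g) (pairsum u v).
Proof. by apply/funext => l; rewrite /pairsum /mix; ring. Qed.

(** Each component is at most a multiple of the mixture, by 1/(1 - tau) or 1/tau; hence [tau] is
    kept strictly between 0 and 1. *)
Lemma L2w_mix tau u v x : 0 < tau < 1 -> weight u -> weight v ->
  L2w (mix tau u v) x -> L2w u x /\ L2w v x.
Proof.
move=> /andP[t0 t1] wu wv lx.
have t01 : 0 <= tau <= 1 by rewrite !ltW.
have wm : weight (mix tau u v).
  split; last by move=> l; apply: mix_ge0 => //; [exact: wu.2|exact: wv.2].
  by apply: measurable_funD; apply: measurable_funM => //; [case: wu|case: wv].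
have t1' : 0 < 1 - tau by rewrite subr_gt0.
split.
  apply: (L2w_weight_le (K := (1 - tau)^-1) wu wm _ _ lx) => [|l].
    by rewrite invr_ge0 ltW.
  by rewrite /mix mulrDr mulKf ?gt_eqF// lerDl !mulr_ge0 ?invr_ge0 ?(ltW t0) ?(ltW t1')// wv.2.
apply: (L2w_weight_le (K := tau^-1) wv wm _ _ lx) => [|l].
  by rewrite invr_ge0 ltW.
by rewrite /mix mulrDr mulKf ?gt_eqF// lerDr !mulr_ge0 ?invr_ge0 ?(ltW t0) ?(ltW t1')// wu.2.
Qed.

Lemma qf_mix tau A h f g u v : weight f -> weight g -> weight u -> weight v ->
  L2w f (fun l => A l - h l) -> L2w u (fun l => A l - h l) -> L2w g h -> L2w v h ->
  qf A h (mix tau f u) (mix tau g v) = (1 - tau) * qf A h f g + tau * qf A h u v.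
Proof. by move=> wf wg wu wv l1 l2 l3 l4; rewrite /qf !nrm_mix//; ring. Qed.

End Mixtures.

(** * The saddle point and its consequences *)

Section SaddlePoint.
Context {R : realType}.
Local Notation mu := (@lebesgue_measure R).
Local Notation C := R[i].
Implicit Types (f g : R -> R) (tau : R) (A h : R -> C).

(* The characteristic [h] of a mixture lies in the domain of both quadratic forms;
   completing the square at [h0] bounds its distance to [h0], since the value
   at the mixture does not exceed the value at [(f0, g0)]. *)
Lemma mixture_bounds tau A h0 h f0 g0 f g : 0 < tau < 1 ->
  weight f0 -> weight g0 -> weight f -> weight g ->
  L2w f0 A -> L2w f A -> L2w (pairsum f0 g0) h0 ->
  L2w (pairsum (mix tau f0 f) (mix tau g0 g)) h ->
  orth A h0 f0 g0 (fun l => h l - h0 l) = 0 ->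
  qf A h (mix tau f0 f) (mix tau g0 g) <= qf A h0 f0 g0 ->
  [/\ L2w (pairsum f g) h, qf A h f g <= qf A h0 f0 g0 &
    (1 - tau) * nrm (pairsum f0 g0) (fun l => h l - h0 l) <= tau * qf A h0 f0 g0].
Proof.
move=> t01 wf0 wg0 wf wg lA0 lA l0 lm orth0.
have wF0 := weight_pairsum wf0 wg0; have wF := weight_pairsum wf wg.
rewrite pairsum_mix in lm; have [lh0 lh] := L2w_mix t01 wF0 wF lm.
have /(L2w_pairsum _ wf0 wg0)[lhf0 lhg0] := lh0.
have /(L2w_pairsum _ wf wg)[lhf lhg] := lh.
have lk := L2wB wF0 lh0 l0.
rewrite (qf_mix tau wf0 wg0 wf wg (L2wB wf0 lA0 lhf0) (L2wB wf lA lhf) lhg0 lhg).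
have := qfD wf0 wg0 lA0 l0 lk; rewrite orth0 mulr0 subr0.
have -> : (fun l => h0 l + (h l - h0 l)) = h by apply/funext => l; rewrite addrC subrK.
move=> ->.
have k0 := nrm_ge0 (fun l => h l - h0 l) wF0.
have q0 := qf_ge0 A h wf wg.
case/andP: t01 => t0 t1 Vle; split => //; last first.
  have : 0 <= tau * qf A h f g by apply: mulr_ge0 => //; exact: ltW.
  lra.
rewrite -(ler_pM2l t0).
have : 0 <= (1 - tau) * nrm (pairsum f0 g0) (fun l => h l - h0 l).
  by apply: mulr_ge0 => //; rewrite subr_ge0 ltW.
lra.
Qed.

(** Both terms of the error form one nonnegative integrand for Fatou's lemma. Convergence is asked
    for Lebesgue measure, since f and g may charge any set of positive measure. *)
Lemma qf_fatou A (h_ : nat -> R -> C) h f g : weight f -> weight g -> L2w f A ->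
  (forall n, L2w (pairsum f g) (h_ n)) -> L2w (pairsum f g) h ->
  {ae mu, forall l, (fun n => cabs (h_ n l - h l)) @ \oo --> (0 : R)} ->
  forall b : R, (forall n, qf A (h_ n) f g <= b) -> qf A h f g <= b.
Proof.
move=> wf wg lA lh_ lh ch b qb.
pose u k l := cabs (A l - k l) ^+ 2 * f l + cabs (k l) ^+ 2 * g l.
have E k : L2w (pairsum f g) k -> ((qf A k f g)%:E = \int[mu]_l (u k l)%:E)%E.
  move=> /(L2w_pairsum _ wf wg)[lf lg]; have la := L2wB wf lA lf.
  rewrite /qf !nrm_Rintegral -(RintegralD measurableT (integrable_cabs2 wf la) (integrable_cabs2 wg lg)).
  rewrite EFin_Rintegral//.
  have := @integrableD _ _ _ mu _ measurableT _ _ (integrable_cabs2 wf la) (integrable_cabs2 wg lg).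
  exact: eq_integrable.
have mu_ k : measC setT k -> measurable_fun setT (u k).
  move=> mk; apply: measurable_funD; apply/measurable_EFinP.
    by apply: measurable_normw2 => //; apply: measCB => //; case: lA.
  exact: measurable_normw2.
rewrite -lee_fin E//; apply: (@fatou_ae _ (fun n => u (h_ n))).
- by move=> n; apply: mu_; case: (lh_ n).
- by apply: mu_; case: lh.
- by move=> n l; apply: addr_ge0; apply: mulr_ge0 => //; rewrite ?exprn_ge0 ?cabs_ge0// ?wf.2 ?wg.2.
- apply: aeS ch => l cl; apply: cvgD; last exact: cvg_cabs_sqr.
  apply: cvg_cabs_sqr; rewrite (_ : (fun n => _) = (fun n => cabs (h_ n l - h l)))//.
  by apply/funext => n; rewrite -cabsN; congr cabs; ring.
- by exists 0%N => n _; rewrite -E// lee_fin.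
Qed.

Lemma saddle_point A h0 f0 g0 f g : weight f0 -> weight g0 -> weight f -> weight g ->
  L2w f0 A -> L2w f A -> L2w (pairsum f0 g0) h0 -> L2w (pairsum f g) h0 ->
  {ae mu, forall l, pairsum f0 g0 l != 0} ->
  (forall tau, 0 < tau < 1 -> exists h,
    [/\ L2w (pairsum (mix tau f0 f) (mix tau g0 g)) h,
      orth A h0 f0 g0 (fun l => h l - h0 l) = 0 &
      qf A h (mix tau f0 f) (mix tau g0 g) <= qf A h0 f0 g0]) ->
  qf A h0 f g <= qf A h0 f0 g0.
Proof.
move=> wf0 wg0 wf wg lA0 lA l0 l0' F0 ex.
have wF0 := weight_pairsum wf0 wg0.
set V := qf A h0 f0 g0; have V0 : 0 <= V by exact: qf_ge0.
(* With 1 - tau >= 1/2 the bound (1 - tau) |h_n - h0|^2 <= tau V gives |h_n - h0|^2 <= 8^-(n+1), the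
   rate that yields convergence almost everywhere along the whole sequence. The added 1 covers V =
   0. *)
pose tau n : R := (8^-1) ^+ n.+1 / (2 * (V + 1)).
have V1 : 0 < 2 * (V + 1) by rewrite mulr_gt0// ltr_pwDr.
have e0 n : 0 < (8^-1 : R) ^+ n.+1 by rewrite exprn_gt0// invr_gt0.
have e1 n : (8^-1 : R) ^+ n.+1 <= 1.
  by apply: exprn_ile1; rewrite ?invr_ge0// invf_le1// ler1n.
have t0 n : 0 < tau n by rewrite divr_gt0.
have t1 n : tau n <= 2^-1.
  rewrite /tau ler_pdivrMr//; apply: le_trans (e1 n) _; lra.
have t01 n : 0 < tau n < 1 by rewrite t0 /=; apply: le_lt_trans (t1 n) _; lra.
have /choice[h_ Hh] (n : nat) := ex _ (t01 n).
have B n := let: And3 a b c := Hh n in mixture_bounds (t01 n) wf0 wg0 wf wg lA0 lA l0 a b c.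
have lF n : L2w (pairsum f g) (h_ n) by have [] := B n.
have mh n := (lF n).1.
apply: (qf_fatou wf wg lA lF l0'); last by move=> n; have [] := B n.
have := @geometric_normw2_ae _ (pairsum f0 g0) (fun n l => h_ n l - h0 l) wF0
  (fun n => measCB (mh n) l0.1) _.
move=> H; have {}H : {ae mu, forall l, pairsum f0 g0 l = 0 \/
     exists2 K, 0 <= K & forall n, cabs (h_ n l - h0 l) <= K * (2^-1) ^+ n}.
  apply: H => n; have [_ _ Hn] := B n.
  have lhm : L2w (pairsum f0 g0) (h_ n).
    have [+ _ _] := Hh n; rewrite pairsum_mix => lm.
    by have [] := L2w_mix (t01 n) wF0 (weight_pairsum wf wg) lm.
  have lk := L2wB wF0 lhm l0.
  rewrite (nrmE wF0 lk) lee_fin.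
  have tV : tau n * V <= (8^-1) ^+ n.+1 / 2.
    rewrite /tau mulrAC ler_pdivrMr// -mulrA ler_pM2l//; lra.
  have k0 := nrm_ge0 (fun l => h_ n l - h0 l) wF0.
  move: (t1 n) Hn; rewrite -/V; move: (nrm _ _) k0 (tau n) ((8^-1) ^+ n.+1) tV => k k0 t e tV.
  nra.
(* Positivity of f0 + g0 turns convergence for the measure (f0 + g0) dl into convergence for
   Lebesgue measure. *)
apply: aeS (ae_and F0 H) => l [/eqP F0l [//|[K K0 HK]]].
exact: le_geometric_cvg0 (fun n => cabs_ge0 _) HK.
Qed.

(** Delta(f, g) <= Delta(h0; f, g) <= Delta(h0; f0, g0) = Delta(f0, g0) makes the pair least
    favorable. For [h] in H_D the worst error is at least Delta(h; f0, g0) >= Delta(h0; f0, g0),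
    which is the worst error of [h0]. *)
Lemma minimax_of_saddle Ob A (D : set ((R -> R) * (R -> R))) h0 f0 g0 :
  (forall f g, D (f, g) -> [/\ spectral_density f, spectral_density g, L2w f A,
     L2s Ob (pairsum f g) h0 & qf A h0 f g <= qf A h0 f0 g0]) ->
  D (f0, g0) -> is_optimal Ob A f0 g0 h0 ->
  least_favorable Ob A D f0 g0 /\ minimax_robust Ob A D h0.
Proof.
move=> HD D0 opt0.
have mle f g : D (f, g) -> (mse A h0 f g <= mse A h0 f0 g0)%E.
  have E u v : D (u, v) -> mse A h0 u v = ((2 * pi)^-1 * qf A h0 u v)%:E.
    move=> /HD[/spectral_weight wu /spectral_weight wv lA /L2s_L2w lh _].
    have /(L2w_pairsum _ wu wv)[lhu lhv] := lh.
    by apply: mseE => //; exact: L2wB.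
  move=> Dfg; rewrite !E// lee_fin ler_pM2l ?invr_gt0 ?pi2_gt0//.
  by have [] := HD _ _ Dfg.
have optP f g : D (f, g) -> is_optimal Ob A f g (opt_char Ob A f g).
  move=> /HD[sf sg lA _ _].
  exact: (xgetPex (fun=> 0) (optimal_exists Ob sf sg lA)).
have worst0 : worst_mse A D h0 = mse A h0 f0 g0.
  apply/le_anti/andP; split.
    by apply: ub_ereal_sup => _ [[f g] Dfg <-]; exact: mle.
  by apply: ereal_sup_ubound; exists (f0, g0).
split.
  split => // f g Dfg; have [_ _ _ lh _] := HD _ _ Dfg.
  apply: le_trans ((optP _ _ Dfg).2 _ lh) _; apply: le_trans (mle _ _ Dfg) _.
  exact: opt0.2 (optP _ _ D0).1.
split.
- by move=> f g /HD[].
- by exists (f0, g0).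
- move=> h Hh; rewrite worst0; apply: le_trans (opt0.2 _ (Hh _ _ D0)) _.
  by apply: ereal_sup_ubound; exists (f0, g0).
Qed.

Lemma is_Binv_opBinv (T : set R) f g (r : R -> C) : B_invertible_at T f g r ->
  is_Binv T f g r (opBinv T f g r).
Proof. by move=> [_ ex]; exact: (xgetPex (fun=> 0) ex). Qed.

(** The class [D] enters only through closure under mixing with [(f0, g0)] and the invertibility of
    B at each of its pairs, in particular at the mixtures. A bound is imposed on the characteristic
    of [(f0, g0)] alone. *)
Lemma minimax_of_opt_value (T Ob : set R) (x : R -> C)
    (D : set ((R -> R) * (R -> R))) f0 g0 (K : R) :
  measurable T -> integrableC T x -> L2C T x -> open Ob -> Ob = ~` T ->
  (forall f g, D (f, g) -> [/\ spectral_density f, spectral_density g &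
     B_invertible_at T f g (opR T f g x)]) ->
  (forall tau f g, 0 < tau < 1 -> D (f, g) -> D (mix tau f0 f, mix tau g0 g)) ->
  D (f0, g0) -> {ae mu, forall l, pairsum f0 g0 l != 0} ->
  (forall f g, D (f, g) -> opt_value T x f g <= opt_value T x f0 g0) ->
  let A := fourierL1 (-1) T x in
  let h0 := schar A (Cfun T x f0 g0) f0 g0 in
  {ae mu, forall l, cabs (h0 l) <= K} ->
  [/\ least_favorable Ob A D f0 g0, is_optimal Ob A f0 g0 h0 &
      minimax_robust Ob A D h0].
Proof.
move=> mT ix lx oO OE HD Dmix D0 F0 Vmax A h0 h0K.
pose hopt f g := schar A (Cfun T x f g) f g.
have [sf0 sg0 /is_Binv_opBinv B0] := HD _ _ D0.
have lA w : spectral_density w -> L2w w A by exact: fourierL1_in_L2w.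
have sp0 : spectrum_off T h0 := schar_spectrum_off mT ix lx sf0 sg0 B0.
have l0 : L2w (pairsum f0 g0) h0 := L2w_schar mT ix lx sf0 sg0 B0.
have orth0 k : spectrum_off T k -> L2w (pairsum f0 g0) k -> orth A h0 f0 g0 k = 0
  := @orth_schar_eq0 _ T x f0 g0 _ mT ix lx sf0 sg0 B0 k.
have V0 : opt_value T x f0 g0 = ((2 * pi)^-1 * qf A h0 f0 g0)%:C
  := opt_valueE mT ix lx sf0 sg0 B0 erefl.
have TO t : T t \/ Ob t by rewrite OE; exact: EM.
have ls w : spectral_density w -> L2s Ob w h0.
  by move=> sw; exact: (L2s_bounded_spectrum TO sw sp0 h0K).
have opt0 : is_optimal Ob A f0 g0 h0.
  apply: (schar_optimal mT ix lx sf0 sg0 B0 oO); first by rewrite OE.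
  exact: ls (spectral_pairsum sf0 sg0).
suff sad f g : D (f, g) -> qf A h0 f g <= qf A h0 f0 g0.
  have [] := @minimax_of_saddle Ob A D h0 f0 g0 _ D0 opt0; last by split.
  move=> f g Dfg; have [sf sg _] := HD _ _ Dfg; split => //.
  - exact: lA.
  - exact: ls (spectral_pairsum sf sg).
  - exact: sad.
move=> Dfg; have [sf sg _] := HD _ _ Dfg.
apply: (saddle_point (spectral_weight sf0) (spectral_weight sg0) (spectral_weight sf)
  (spectral_weight sg) (lA _ sf0) (lA _ sf) l0 (L2s_L2w (ls _ (spectral_pairsum sf sg))) F0).
move=> tau t01; have Dm := Dmix _ _ _ t01 Dfg.
have [sfm sgm /is_Binv_opBinv Bm] := HD _ _ Dm.
exists (hopt (mix tau f0 f) (mix tau g0 g)).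
have lm := L2w_schar mT ix lx sfm sgm Bm.
have spm := schar_spectrum_off mT ix lx sfm sgm Bm.
have Vm : opt_value T x (mix tau f0 f) (mix tau g0 g) =
    ((2 * pi)^-1 * qf A (hopt (mix tau f0 f) (mix tau g0 g)) (mix tau f0 f) (mix tau g0 g))%:C
  := opt_valueE mT ix lx sfm sgm Bm erefl.
split.
- exact: lm.
(* Both characteristics lie in W, hence so does their difference, on which the linear term at [h0]
   vanishes. *)
- apply: orth0; first exact: (spectrum_offB spm sp0).
  apply: (L2wB (spectral_weight (spectral_pairsum sf0 sg0)) _ l0).
  move: lm; rewrite pairsum_mix => lm.
  by have [] := L2w_mix t01 (spectral_weight (spectral_pairsum sf0 sg0))
    (spectral_weight (spectral_pairsum sf sg)) lm.
- have := Vmax _ _ Dm; rewrite V0 Vm lecR ler_pM2l//.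
  by rewrite invr_gt0 pi2_gt0.
Qed.

End SaddlePoint.

(** * The contamination class of signal densities with the L_1 ball of noise densities *)

Theorem theorem5p1 (R : realType)
  (s : nat) (hs : (1 <= s)%N)
  (N K : nat -> R) (hN0 : N 0%N = 0) (hK0 : K 0%N = 0)
  (hN : forall l, 0 <= N l) (hK : forall l, 0 <= K l)
  (a : R -> R[i])
  (ha_meas : measC (Rs s N K) a)
  (ha_int : integrableC (Rs s N K) a)
  (ha_sq : (\int[@lebesgue_measure R]_(t in Rs s N K)
              (t * ComplexField.Normc.normc (a t) ^+ 2)%:E < +oo)%E)
  (ha_L2 : L2C (Tset s N K) (extend0 (Rs s N K) a))
  (eps1 eps2 P1 : R) (f1 g1 : R -> R)
  (hf1 : spectral_density f1) (hg1 : spectral_density g1)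
  (f0 g0 : R -> R)
  (hf0 : D_eps eps1 P1 f1 f0) (hg0 : D1_eps eps2 g1 g0)
  (alpha1 alpha2 : R) (halpha1 : alpha1 != 0) (phi Psi : R -> R) :
  let cabs := @ComplexField.Normc.normc R in
  let mu := @lebesgue_measure R in
  let T := Tset s N K in
  let Ob := Obs s N K in
  let D := D_eps eps1 P1 f1 `*` D1_eps eps2 g1 in
  let ba := extend0 (Rs s N K) a in
  let A := Afun (Rs s N K) a in
  let C0 := Cfun T ba f0 g0 in
  let h0 := fun l => (A l * (f0 l)%:C - C0 l) / (f0 l + g0 l)%:C in
  (forall f g, D (f, g) -> B_invertible_at T f g (opR T f g ba)) ->
  minimality f0 g0 ->
  ess_bounded (fun l => cabs (A l * (g0 l)%:C + C0 l) ^+ 2 / (f0 l + g0 l) ^+ 2) ->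
  ess_bounded (fun l => cabs (A l * (f0 l)%:C - C0 l) ^+ 2 / (f0 l + g0 l) ^+ 2) ->
  {ae mu, forall l,
     cabs (A l * (g0 l)%:C + C0 l) = (f0 l + g0 l) * (phi l + alpha1^-1)} ->
  {ae mu, forall l,
     cabs (A l * (f0 l)%:C - C0 l) = (f0 l + g0 l) * Psi l * alpha2} ->
  {ae mu, forall l,
     phi l <= 0 /\ (f0 l > (1 - eps1) * f1 l -> phi l = 0)} ->
  {ae mu, forall l,
     `|Psi l| <= 1 /\ (g0 l != g1 l -> Psi l = Num.sg (g0 l - g1 l))} ->
  (forall f g, D (f, g) -> opt_value T ba f g <= opt_value T ba f0 g0) ->
  [/\ least_favorable Ob A D f0 g0,
      is_optimal Ob A f0 g0 h0 &
      minimax_robust Ob A D h0].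
Proof.
move=> cabs mu T Ob D ba A C0 h0 Binv mini _ hg_bounded _ _ _ _ Vmax.
have cT : closed T by exact: closed_Tset.
have mT : measurable T by exact: closed_measurable.
have iba : integrableC T ba.
  apply: (integrableC_extend0 ba mT).2; rewrite extend0_Tset_Rs.
  exact: (integrableC_extend0 a (measurable_Rs s N K)).1.
have AE : A = fourierL1 (-1) T ba.
  apply/funext => l; rewrite [RHS]fourierL1_extend0 extend0_Tset_Rs.
  exact: fourierL1_extend0.
have h0E : h0 = schar (fourierL1 (-1) T ba) (Cfun T ba f0 g0) f0 g0 by rewrite -AE.
have [[sf0 _ _] [sg0 _]] := (hf0, hg0).
have [K0 hK0b] := hg_bounded.
(* The hypothesis bounds |h0|^2 by [K0]; since y <= y^2 + 1, the modulus itself is at most K0 +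
   1. *)
rewrite AE h0E; apply: (@minimax_of_opt_value _ T Ob ba D f0 g0 (K0 + 1)) => //.
- by rewrite /Ob ObsE openC.
- exact: ObsE.
- by move=> f g Dfg; split; [case: Dfg => -[]|case: Dfg => _ []|exact: Binv].
- move=> tau f g /andP[t0 t1] [Df Dg]; have t01 : 0 <= tau <= 1 by rewrite !ltW.
  by split; [exact: D_eps_mix|exact: D1_eps_mix].
- exact: minimality_neq0_ae.
- rewrite -h0E; apply: aeS hK0b => l hl.
  have : @ComplexField.Normc.normc R (h0 l) ^+ 2 <= K0.
    apply: le_trans (le_trans (ler_norm _) hl).
    by rewrite /h0 cabs_divr expr_div_n -normrX (ger0_norm (sqr_ge0 _)).
  by move: (@ComplexField.Normc.normc R (h0 l)) => y; nra.
Qed.
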